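(* For every finite family $A^1,\dots,A^k\in\mathfrak A_2$, $$(\Phi_N(A^1),\dots,\Phi_N(A^k))\Longrightarrow(\Phi(A^1),\dots,\Phi(A^k))\quad\text{in law in }\mathcal S_2(E)^k\quad(N\to\infty).$$ Moreover there is a common auxiliary coupling of the source block sums and these responses, i.e. one probability space carrying, for each $N$, copies of $\big((S_{j,N})_j,\Phi_N(A^1),\dots,\Phi_N(A^k)\big)$ with the correct joint law, together with the Gaussian responses $\Phi(A^1),\dots,\Phi(A^k)$, under which the copies of $\Phi_N(A^i)$ converge to $\Phi(A^i)$ in every $L^p(\mathcal S_2(E))$, $1\le p<\infty$. Every fixed noncommutative $*$-polynomial with zero constant term in these responses converges in the same sense. These conclusions also hold with $\Phi_N(A^i)$ replaced by $\Phi_N(A^i_N)$ whenever $A_N^i\to A^i$ in all norms $p_\rho$, $\rho\ge1$.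
   Context: $H$ is a real separable Hilbert space with orthonormal basis $(e_j)$, $E$ a complex separable Hilbert space, $\mathcal S_2(E)$ the Hilbert--Schmidt operators. Coefficient arrays are $A=(A_\alpha)$, $A_\alpha\in\mathcal S_2(E)$, indexed by finitely supported multi-indices $\alpha$ over the basis index set; $p_\rho(A)=\sum_{m\ge0}\rho^m\big(\sum_{|\alpha|=m}\|A_\alpha\|_2^2\big)^{1/2}$ and $\mathfrak A_2=\{A:p_\rho(A)<\infty\ \forall\rho\ge1\}$. Let $(\xi_{j,a})$ be independent symmetric $\pm1$ signs and $S_{j,N}=N^{-1/2}\sum_{a=1}^N\xi_{j,a}$. For $0\le k\le N$, $Q^{(j)}_{k,N}=k!N^{-k/2}\sum_{I\subset\{1,\dots,N\},|I|=k}\prod_{a\in I}\xi_{j,a}$; $Q_{k,N}^{(j)}=0$ for $k>N$. $\Psi_{\alpha,N}=\prod_jQ^{(j)}_{\alpha_j,N}/\sqrt{\alpha_j!}$ and $\Phi_N(A)=\sum_\alpha A_\alpha\Psi_{\alpha,N}$. With independent standard real Gaussians $(g_j)$ and probabilists' Hermite polynomials $H_n$, $\Psi_\alpha=\prod_jH_{\alpha_j}(g_j)/\sqrt{\alpha_j!}$ and $\Phi(A)=\sum_\alpha A_\alpha\Psi_\alpha$. Both series converge in $L^2(\mathcal S_2)$. *)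

(* Defs.v *)
From HB Require Import structures.
From mathcomp Require Import all_boot all_order all_algebra finmap.
From mathcomp Require Import sesquilinear complex.
From mathcomp Require Import all_classical all_reals all_analysis.
From mathcomp Require Import summability ring lra.

Set Implicit Arguments.
Unset Strict Implicit.
Unset Printing Implicit Defensive.

Import Order.TTheory GRing.Theory Num.Theory Num.Def.
Import numFieldNormedType.Exports.

Local Open Scope classical_set_scope.
Local Open Scope ring_scope.
Local Open Scope complex_scope.

(* A complex Hilbert space with a countable orthonormal basis, i.e. a separable
   one (finite dimensions allowed). The basis serves to define the
   Hilbert--Schmidt norm, whose value does not depend on it. *)
Record sepHilbert (R : realType) := SepHilbert {
  hil_sort :> completeNormedModType R[i] ;
  hil_dot : {dot hil_sort for @Num.conj R[i]} ;
  hil_normE : forall x : hil_sort, `|x| ^+ 2 = hil_dot x x ;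
  hil_idx : countType ;
  hil_basis : hil_idx -> hil_sort ;
  hil_orthonormal : forall i j,
    hil_dot (hil_basis i) (hil_basis j) = (i == j)%:R ;
  hil_total : dense [set x : hil_sort | exists (F : {fset hil_idx})
    (c : hil_idx -> R[i]), x = \sum_(i <- F) c i *: hil_basis i] }.

Section HilbertSchmidt.
Context {R : realType}.
Variable E : sepHilbert R.

Definition hil_norm (x : E) : R := complex.Re `|x|.

Lemma hil_norm_complex (x : E) : (hil_norm x)%:C = `|x|.
Proof.
rewrite /hil_norm; have := normr_ge0 x; case: `|x| => a b.
by rewrite lecE /= => /andP[/eqP -> _].
Qed.

Lemma hil_norm_ge0 (x : E) : 0 <= hil_norm x.
Proof. by rewrite -lecR hil_norm_complex; exact: normr_ge0. Qed.

Lemma hil_normD (x y : E) : hil_norm (x + y) <= hil_norm x + hil_norm y.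
Proof. by rewrite -lecR rmorphD/= !hil_norm_complex ler_normD. Qed.

Lemma hil_normZ (a : R[i]) (x : E) :
  hil_norm (a *: x) = complex.Re `|a| * hil_norm x.
Proof.
by apply/complexI; rewrite rmorphM/= !hil_norm_complex normrZ.
Qed.

(* The squared Hilbert--Schmidt norm. *)
Definition hs_sum (T : E -> E) : \bar R :=
  \esum_(i in [set: hil_idx E]) (hil_norm (T (hil_basis i)) ^+ 2)%:E.

Lemma hs_sum_ge0 T : (0 <= hs_sum T)%E.
Proof. by apply: esum_ge0 => i _; rewrite lee_fin sqr_ge0. Qed.

Lemma hs_sum_le (a b : R) (S T U : E -> E) : 0 <= a -> 0 <= b ->
  (forall i, hil_norm (S (hil_basis i)) ^+ 2 <=
     a * hil_norm (T (hil_basis i)) ^+ 2 +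
     b * hil_norm (U (hil_basis i)) ^+ 2) ->
  (hs_sum S <= a%:E * hs_sum T + b%:E * hs_sum U)%E.
Proof.
move=> a0 b0 le; apply: ge_ereal_sup => _ [X [finX _] <-].
apply: (@le_trans _ _ (\sum_(i \in X) (a%:E *
   (hil_norm (T (hil_basis i)) ^+ 2)%:E +
  b%:E * (hil_norm (U (hil_basis i)) ^+ 2)%:E)%E)%E).
  by apply: lee_fsum => // i _; rewrite -!EFinM -EFinD lee_fin.
rewrite fsbig_split//= -!ge0_mule_fsumr//; last 2 first.
- by move=> i; rewrite lee_fin sqr_ge0.
- by move=> i; rewrite lee_fin sqr_ge0.
by apply: leeD; apply: lee_wpmul2l; rewrite ?lee_fin//; apply: esum_ge; exists X.
Qed.

Definition is_hs (T : E -> E) : Prop :=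
  [/\ linear T, continuous T & (hs_sum T < +oo)%E].

Definition hs_pred : {pred E -> E} := mem [set T | is_hs T].

Lemma hs_submod_closed : submod_closed hs_pred.
Proof.
split.
  apply: mem_set; split.
  - by move=> a u v; rewrite /= scaler0 addr0.
  - by move=> x; exact: cvg_cst.
  - rewrite /hs_sum esum1 ?ltry// => i _.
    by rewrite /= -[X in hil_norm X](scale0r (0 : E)) hil_normZ normr0/= mul0r expr0n.
move=> a S T /set_mem[linS cS hS] /set_mem[linT cT hT].
have aSTE x : (a *: S + T) x = a *: S x + T x by [].
apply: mem_set; split.
- move=> c u v; rewrite !aSTE linS linT !scalerDr !scalerA (mulrC a c).
  by rewrite addrACA.
- by move=> x; apply: continuousD; [apply: continuousZr; exact: cS|exact: cT].
- pose r := complex.Re `|a|.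
  apply: (@le_lt_trans _ _
      ((2 * r ^+ 2)%:E * hs_sum S + 2%:E * hs_sum T)%E).
    apply: hs_sum_le => //; first by rewrite mulr_ge0 ?sqr_ge0.
    move=> i; set x := hil_basis i.
    have := hil_normD (a *: S x) (T x); rewrite hil_normZ -/r => h.
    have h0 := hil_norm_ge0 (a *: S x + T x).
    apply: (@le_trans _ _ ((r * hil_norm (S x) + hil_norm (T x)) ^+ 2)).
      by rewrite lerXn2r// nnegrE // (le_trans h0).
    have := sqr_ge0 (r * hil_norm (S x) - hil_norm (T x)); nra.
  have r20 : 0 <= 2 * r ^+ 2 by rewrite mulr_ge0 ?sqr_ge0.
  by rewrite lte_add_pinfty// lte_mul_pinfty.
Qed.

HB.instance Definition _ := GRing.isSubmodClosed.Build _ _ hs_pred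
  hs_submod_closed.

Record hs_op := HsOp { hs_fun :> E -> E ; hs_funP : hs_fun \in hs_pred }.

HB.instance Definition _ := [isSub for hs_fun].
HB.instance Definition _ := [Choice of hs_op by <:].
HB.instance Definition _ := [SubChoice_isSubLmodule of hs_op by <:].

Lemma hs_linear (T : hs_op) : linear T.
Proof. by have /set_mem[] := hs_funP T. Qed.

Lemma hs_continuous (T : hs_op) : continuous T.
Proof. by have /set_mem[] := hs_funP T. Qed.

Lemma hs_sum_lty (T : hs_op) : (hs_sum T < +oo)%E.
Proof. by have /set_mem[] := hs_funP T. Qed.

HB.instance Definition _ (T : hs_op) :=
  GRing.isLinear.Build R[i] E E _ (hs_fun T) (hs_linear T).

Definition hs_norm (T : hs_op) : R := Num.sqrt (fine (hs_sum T)).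

Lemma hs_norm_ge0 T : 0 <= hs_norm T. Proof. exact: sqrtr_ge0. Qed.

Lemma hs_norm_sqr T : ((hs_norm T ^+ 2)%:E = hs_sum T)%E.
Proof.
rewrite sqr_sqrtr ?fine_ge0 ?hs_sum_ge0// fineK//.
by rewrite ge0_fin_numE ?hs_sum_ge0// hs_sum_lty.
Qed.

Lemma hs_normD S T : hs_norm (S + T) <= hs_norm S + hs_norm T.
Proof.
apply/ler_addgt0Pr => e e0; set a := hs_norm S; set b := hs_norm T.
pose A := a + e / 2; pose B := b + e / 2.
have A0 : 0 < A by rewrite ltr_wpDl ?hs_norm_ge0// divr_gt0.
have B0 : 0 < B by rewrite ltr_wpDl ?hs_norm_ge0// divr_gt0.
have -> : a + b + e = A + B by rewrite /A /B; lra.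
rewrite -(@ler_pXn2r _ 2)// ?nnegrE ?hs_norm_ge0 ?(addr_ge0 (ltW A0) (ltW B0))//.
have BA0 : 0 <= 1 + B / A by rewrite addr_ge0// divr_ge0// ltW.
have AB0 : 0 <= 1 + A / B by rewrite addr_ge0// divr_ge0// ltW.
have : hs_norm (S + T) ^+ 2 <= (1 + B / A) * a ^+ 2 + (1 + A / B) * b ^+ 2.
  rewrite -lee_fin EFinD (EFinM (1 + B / A)) (EFinM (1 + A / B)) !hs_norm_sqr.
  apply: hs_sum_le => // i; set x := hil_basis i.
  apply: (@le_trans _ _ ((hil_norm (S x) + hil_norm (T x)) ^+ 2)).
    rewrite lerXn2r// ?nnegrE ?addr_ge0 ?hil_norm_ge0//.
    exact: hil_normD.
  rewrite -subr_ge0; set s := hil_norm (S x); set t := hil_norm (T x).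
  have -> : (1 + B / A) * s ^+ 2 + (1 + A / B) * t ^+ 2 - (s + t) ^+ 2 =
      (B * s - A * t) ^+ 2 / (A * B).
    by field; rewrite !gt_eqF.
  by rewrite divr_ge0 ?sqr_ge0 ?mulr_ge0 ?ltW.
move=> h; apply: (le_trans h) => {h}.
have -> : (A + B) ^+ 2 = (1 + B / A) * A ^+ 2 + (1 + A / B) * B ^+ 2.
  by field; rewrite !gt_eqF.
have e20 : 0 <= e / 2 by rewrite divr_ge0 ?ltW.
by apply: lerD; apply: ler_wpM2l => //; rewrite lerXn2r// ?nnegrE
  ?hs_norm_ge0 ?(ltW A0) ?(ltW B0)// lerDl.
Qed.

Let hs_normZ_le (l : R[i]) T : hs_norm (l *: T) <= complex.Re `|l| * hs_norm T.
Proof.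
have l0 : 0 <= complex.Re `|l|.
  by have := normr_ge0 l; case: `|l| => u v; rewrite lecE /= => /andP[].
rewrite -(@ler_pXn2r _ 2)// ?nnegrE ?mulr_ge0 ?hs_norm_ge0//.
have -> : (complex.Re `|l| * hs_norm T) ^+ 2 =
  complex.Re `|l| ^+ 2 * hs_norm T ^+ 2 + 0 * hs_norm T ^+ 2.
  by rewrite mul0r addr0 exprMn.
rewrite -lee_fin EFinD (EFinM (_ ^+ 2)) (EFinM 0) !hs_norm_sqr.
apply: hs_sum_le; rewrite ?sqr_ge0// => i.
by rewrite hil_normZ mul0r addr0 exprMn.
Qed.

Lemma hs_normZ (l : R[i]) T : hs_norm (l *: T) = complex.Re `|l| * hs_norm T.
Proof.
apply/eqP; rewrite eq_le hs_normZ_le andTb.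
have [->|l0] := eqVneq l 0; first by rewrite normr0/= mul0r hs_norm_ge0.
have := hs_normZ_le l^-1 (l *: T); rewrite scalerA mulVf// scale1r => h.
rewrite normrV ?unitfE// in h.
move: h; have := normr_gt0 l; rewrite l0; case: `|l| => u v.
rewrite ltcE /= => /andP[/eqP -> u0]; rewrite expr0n/= addr0.
rewrite expr2 invfM mulrA divff ?mul1r ?gt_eqF// mulrC.
by rewrite ler_pdivlMr// mulrC.
Qed.

Lemma hs_norm_eq0 T : hs_norm T = 0 -> T = 0.
Proof.
move=> T0; apply: val_inj; apply/funext => x /=; apply: contrapT => /eqP Tx.
have Te i : T (hil_basis i) = 0.
  have : ((hil_norm (T (hil_basis i)) ^+ 2)%:E <= hs_sum T)%E.
    apply: esum_ge; exists [set i]; first by split; [exact: finite_set1|].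
    by rewrite fsbig_set1.
  rewrite -hs_norm_sqr T0 expr0n lee_fin => le0.
  have : hil_norm (T (hil_basis i)) ^+ 2 == 0 by rewrite eq_le le0 sqr_ge0.
  rewrite sqrf_eq0 => /eqP h; apply/eqP; rewrite -normr_eq0 -hil_norm_complex.
  by rewrite h.
have oU : open (T @^-1` ~` [set 0]).
  apply: open_comp; first by move=> y _; exact: hs_continuous.
  rewrite openC; apply: accessible_closed_set1.
  by apply: hausdorff_accessible; exact: norm_hausdorff.
have U0 : (T @^-1` ~` [set 0]) !=set0 by exists x => /= /eqP; rewrite (negPf Tx).
have [y [/= Ty [F [c yE]]]] := hil_total U0 oU.
apply: Ty; rewrite yE linear_sum big1// => i _.
by rewrite linearZ/= Te scaler0.
Qed.

Let cnorm (T : hs_op) : R[i] := (hs_norm T)%:C.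
Let cnormD S T : cnorm (S + T) <= cnorm S + cnorm T.
Proof. by rewrite /cnorm -rmorphD lecR hs_normD. Qed.
Let cnormZ (l : R[i]) T : cnorm (l *: T) = `|l| * cnorm T.
Proof. by rewrite /cnorm hs_normZ rmorphM. Qed.
Let cnorm_eq0 T : cnorm T = 0 -> T = 0.
Proof. by move=> /complexI/hs_norm_eq0. Qed.

HB.instance Definition _ := Lmodule_isNormed.Build R[i] hs_op
  cnormD cnormZ cnorm_eq0.

Lemma hs_normE (T : hs_op) : `|T| = (hs_norm T)%:C.
Proof. by []. Qed.

Lemma hs_compP (S T : hs_op) : (S \o T) \in hs_pred.
Proof.
apply: mem_set; split.
- by move=> a x y; rewrite /= !linearP.
- by move=> x; apply: continuous_comp; exact: hs_continuous.
have [M M0 SM] : exists2 M : R, 0 <= M & forall x, hil_norm (S x) <= M * hil_norm x.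
  have /linear_bounded_continuous/linear_boundedP := @hs_continuous S.
  move=> /pinfty_ex_gt0[r r0 Sr]; exists (complex.Re r) => [|x].
    by move: r0; case: r {Sr} => u v; rewrite ltcE /= => /andP[_ /ltW].
  rewrite -lecR rmorphM/= !hil_norm_complex; move: (Sr x) r0.
  by case: r {Sr} => u v h; rewrite ltcE /= => /andP[/eqP v0 _]; move: h; rewrite v0.
apply: (@le_lt_trans _ _ ((M ^+ 2)%:E * hs_sum T + 0%:E * hs_sum T)%E).
  apply: hs_sum_le; rewrite ?sqr_ge0// => i; rewrite mul0r addr0 -exprMn.
  rewrite lerXn2r// ?nnegrE ?mulr_ge0 ?hil_norm_ge0//.
  exact: SM.
by rewrite lte_add_pinfty// lte_mul_pinfty ?lee_fin ?sqr_ge0// hs_sum_lty.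
Qed.

Definition hs_comp (S T : hs_op) : hs_op := HsOp (hs_compP S T).

(* The adjoint is characterised uniquely by this identity (hil_dot is linear on
   the left and antilinear on the right), and the adjoint of a Hilbert--Schmidt
   operator exists and is Hilbert--Schmidt, so the default 0 is never used. *)
Definition hs_adj (T : hs_op) : hs_op :=
  xget 0 [set S : hs_op | forall x y, hil_dot E (T x) y = hil_dot E x (S y)].

End HilbertSchmidt.

(* A noncommutative *-polynomial with zero constant term in k variables, as a
   finite list of terms: a coefficient and a nonempty word, given by its first
   letter and the sequence of the others. The letter (i, false) is the variable
   x_i and (i, true) is its adjoint. *)
Definition star_letter (k : nat) : Type := ('I_k * bool)%type.
Definition star_poly (R : realType) (k : nat) : Type :=
  seq (R[i] * (star_letter k * seq (star_letter k))).

Section StarPoly.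
Context {R : realType} {E : sepHilbert R} {k : nat}.

Definition star_letter_eval (T : 'I_k -> hs_op E) (l : star_letter k) :
    hs_op E :=
  if l.2 then hs_adj (T l.1) else T l.1.

Definition star_poly_eval (p : star_poly R k) (T : 'I_k -> hs_op E) : hs_op E :=
  \sum_(t <- p) t.1 *: foldl (fun S l => hs_comp S (star_letter_eval T l))
                             (star_letter_eval T t.2.1) t.2.2.

End StarPoly.

Section Arrays.
Context {R : realType}.
Variables (J : countType) (E : sepHilbert R).

(* J indexes the orthonormal basis (e_j) of the real separable Hilbert space H,
   which enters only through it. *)
Definition mindex : Type := {fsfun J -> nat with 0%N}.

Definition mdeg (al : mindex) : nat := (\sum_(j <- finsupp al) al j)%N.

Definition array : Type := mindex -> hs_op E.

Definition arrayB (A B : array) : array := fun al => A al - B al.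

Definition p_norm (rho : R) (A : array) : \bar R :=
  (\sum_(0 <= m <oo) (rho ^+ m)%:E *
     sqrte (\esum_(al in [set al : mindex | mdeg al = m])
              (hs_norm (A al) ^+ 2)%:E))%E.

Definition frakA2 (A : array) : Prop :=
  forall rho : R, 1 <= rho -> (p_norm rho A < +oo)%E.

End Arrays.

Section RandomVariables.
Context {R : realType} {d : measure_display} {W : measurableType d}.
Variable P : probability W R.

Definition mutually_independent (I : choiceType) (X : I -> {RV P >-> R}) :
    Prop :=
  forall (F : {fset I}) (B : I -> set R), (forall i, measurable (B i)) ->
    P (\bigcap_(i in [set` F]) (X i @^-1` B i)) =
    (\prod_(i <- F) P (X i @^-1` B i))%E.

Definition independent_signs (J : countType) (xi : J -> nat -> {RV P >-> R}) :
    Prop :=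
  mutually_independent (fun ja : J * nat => xi ja.1 ja.2) /\
  forall j a, P (xi j a @^-1` [set 1]) = (2^-1)%:E /\
              P (xi j a @^-1` [set -1]) = (2^-1)%:E.

Definition independent_std_gaussians (J : countType) (g : J -> {RV P >-> R}) :
    Prop :=
  mutually_independent g /\
  forall j (B : set R), measurable B -> distribution P (g j) B = normal_prob 0 1 B.

Definition borel_rv (T : ptopologicalType) (X : W -> T) : Prop :=
  measurable_fun [set: W] (X : W -> g_sigma_algebraType (@open T)).

Definition hs_Lnorm (E : sepHilbert R) (p : R) (X : W -> hs_op E) : \bar R :=
  Lnorm P p%:E (fun w => (hs_norm (X w))%:E).

Definition cvg_Lp (E : sepHilbert R) (p : R) (X : nat -> W -> hs_op E)
    (Y : W -> hs_op E) : Prop :=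
  [/\ forall N, (0 < N)%N -> borel_rv (X N) /\ (hs_Lnorm p (X N) < +oo)%E,
      borel_rv Y /\ (hs_Lnorm p Y < +oo)%E
    & hs_Lnorm p (fun w => X N w - Y w) @[N --> \oo] --> 0%E].

Section Chaos.
Context {J : countType} {E : sepHilbert R}.

(* X is (a version of) the sum of A_al Psi_al, converging unconditionally in
   L^2(S_2(E)), i.e. along the finite sets of multi-indices. *)
Definition is_L2_sum (Psi : mindex J -> W -> R) (A : array J E)
    (X : W -> hs_op E) : Prop :=
  borel_rv X /\
  (fun F : {fset mindex J} =>
     hs_Lnorm 2 (fun w => X w - \sum_(al <- F) (Psi al w)%:C *: A al))
    @ totally --> 0%E.

Definition block_sum (xi : J -> nat -> {RV P >-> R}) (j : J) (N : nat) (w : W)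
    : R :=
  (Num.sqrt N%:R)^-1 * \sum_(a < N) xi j a w.

(* The indices a = 1, ..., N are shifted to 0, ..., N - 1. *)
Definition Q_block (xi : J -> nat -> {RV P >-> R}) (j : J) (k N : nat) (w : W)
    : R :=
  k`!%:R / Num.sqrt N%:R ^+ k *
  \sum_(I : {set 'I_N} | #|I| == k) \prod_(a in I) xi j a w.

(* Indices j outside the support contribute the factor Q_0 = 1. *)
Definition Psi_block (xi : J -> nat -> {RV P >-> R}) (N : nat) (al : mindex J)
    (w : W) : R :=
  \prod_(j <- finsupp al) (Q_block xi j (al j) N w / Num.sqrt (al j)`!%:R).

Definition is_Phi_block xi N := is_L2_sum (Psi_block xi N).

Fixpoint hermite (n : nat) : {poly R} :=
  if n is m.+1 then 'X * hermite m - (hermite m)^`() else 1.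

Definition Psi_gauss (g : J -> {RV P >-> R}) (al : mindex J) (w : W) : R :=
  \prod_(j <- finsupp al) ((hermite (al j)).[g j w] / Num.sqrt (al j)`!%:R).

Definition is_Phi_gauss g := is_L2_sum (Psi_gauss g).

End Chaos.

End RandomVariables.

Section Laws.
Context {R : realType} {d d' : measure_display}.
Context {W : measurableType d} {W' : measurableType d'}.
Variables (P : probability W R) (P' : probability W' R).

Definition cvg_in_law (T : topologicalType) (X : nat -> W -> T) (Y : W' -> T) :
    Prop :=
  forall F : T -> R, continuous F -> (exists M : R, forall x, `|F x| <= M) ->
    ('E_P[F \o X N] @[N --> \oo] --> 'E_P'[F \o Y])%E.

(* The product sigma-algebra on R^J * S_2(E)^k. *)
Definition joint_cylinders (J : countType) (E : sepHilbert R) (k : nat) :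
    set (set ((J -> R) * ('I_k -> hs_op E))) :=
  [set C | (exists j, exists2 B : set R, measurable B & C = [set z | B (z.1 j)])
        \/ (exists i, exists2 U : set (hs_op E), open U & C = [set z | U (z.2 i)])].

Definition same_joint_law (J : countType) (E : sepHilbert R) (k : nat)
    (S : J -> W -> R) (X : 'I_k -> W -> hs_op E)
    (S' : J -> W' -> R) (X' : 'I_k -> W' -> hs_op E) : Prop :=
  forall C, <<s @joint_cylinders J E k >> C ->
    P [set w | C (S ^~ w, X ^~ w)] = P' [set w | C (S' ^~ w, X' ^~ w)].

End Laws.

Section Conclusions.
Context {R : realType} {J : countType} {E : sepHilbert R} {k : nat}.
Context {d d' : measure_display}.
Context {W : measurableType d} {W' : measurableType d'}.
Variables (P : probability W R) (P' : probability W' R).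
Variables (xi : J -> nat -> {RV P >-> R}) (g : J -> {RV P' >-> R}).
Variables (AN : nat -> 'I_k -> array J E) (A : 'I_k -> array J E).

(* One probability space carrying, for each block size N, a copy X' N of
   (Phi_N(A_N^i))_i together with a copy S' N of the block sums, and Gaussian
   responses Y' i = Phi(A^i) built from Gaussians g' on that same space. *)
Definition has_coupling (X : nat -> 'I_k -> W -> hs_op E) : Prop :=
  exists (d0 : measure_display) (W0 : measurableType d0)
    (P0 : probability W0 R)
    (S' : nat -> J -> {RV P0 >-> R}) (X' : nat -> 'I_k -> W0 -> hs_op E)
    (g' : J -> {RV P0 >-> R}) (Y' : 'I_k -> W0 -> hs_op E),
    [/\ independent_std_gaussians g' /\
        (forall i, is_Phi_gauss g' (A i) (Y' i)),
        (forall N, (0 < N)%N ->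
          same_joint_law P P0 (fun j => block_sum xi j N) (X N)
                              (fun j => S' N j : W0 -> R) (X' N)),
        (forall (p : R) (i : 'I_k), 1 <= p ->
          cvg_Lp P0 p (fun N => X' N i) (Y' i))
      & (forall (p : R) (q : star_poly R k), 1 <= p ->
          cvg_Lp P0 p (fun N w => star_poly_eval q (X' N ^~ w))
                      (fun w => star_poly_eval q (Y' ^~ w)))].

Definition responses_converge : Prop :=
  forall (X : nat -> 'I_k -> W -> hs_op E) (Y : 'I_k -> W' -> hs_op E),
    (forall N i, (0 < N)%N -> is_Phi_block xi N (AN N i) (X N i)) ->
    (forall i, is_Phi_gauss g (A i) (Y i)) ->
    [/\ cvg_in_law P P' (fun N w => (X N ^~ w : {ptws 'I_k -> hs_op E}))
                        (fun w => (Y ^~ w : {ptws 'I_k -> hs_op E})),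
        (forall q : star_poly R k,
          cvg_in_law P P' (fun N w => star_poly_eval q (X N ^~ w))
                          (fun w => star_poly_eval q (Y ^~ w)))
      & has_coupling X].

End Conclusions.

(* Main.v *)
Require Import Defs.
From HB Require Import structures.
From mathcomp Require Import all_boot all_order all_algebra finmap.
From mathcomp Require Import sesquilinear complex.
From mathcomp Require Import all_classical all_reals all_analysis.
From mathcomp Require Import measurable_realfun summability ring lra.

(** The block sums are coupled with the Gaussians by a quantile transform. Let
    [h] be the nondecreasing map that carries the standard normal law to the law
    of [S_{j,N}]. The variables [h (g_j)] are independent in [j] and have the
    laws of the block sums, hence together they have the joint law of the family
    of block sums; and the central limit theorem is equivalent to [h x --> x]
    for every real [x] ([quantile_map_cvg]). So, on the probability space of the
    Gaussians, the copies of the block sums converge at every point. The central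
    limit theorem itself is obtained in one-sided form ([clt_upper]) by Gaussian
    smoothing: adding one small sign to a Gaussian costs at most a constant
    factor and a slightly larger variance ([heat_step]).

    Since the entries of a block are signs, [Q_{k,N}] is a function of the block
    sum alone: it is a Krawtchouk polynomial, whose three-term recursion
    converges to that of the Hermite polynomials ([Q_fun_krawtchouk],
    [krawtchouk_cvg]). Therefore [Psi_{al,N}], evaluated at the coupled sums,
    converges pointwise to [Psi_al], and so does every finite sum of terms
    [A_al Psi_{al,N}] ([chaos_cvg]).

    Uniform control of the infinite sums comes from hypercontractivity on the
    discrete cube for functions with Hilbert--Schmidt values: for finite [F],
      [E (||sum_F A_al Psi_{al,N}||^(2r))
         <= (sum_F (4r+1)^|al| ||A_al||^2)^r],
    whatever [N] is ([hypercontractive], [block_hypercontr]). The bound passes to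
    the coupled sums by equality of laws and to the Gaussian chaos by Fatou's
    lemma, and its right-hand side is dominated by the norm [p_rho] for
    [rho = 4r+1] ([wnorm_le_p]). Hence the tails of the series are small in
    [L^(2r)] uniformly in [N], also along arrays that vary with [N], while the
    finite partial sums converge in [L^(2r)] because their moments of higher
    order stay bounded ([vitali]). This gives convergence of all moments of the
    distance between the coupled responses and the Gaussian ones
    ([chaos_converges]). That mode of convergence implies convergence in every
    [L^p] and is stable under sums, adjoints and products, the
    Hilbert--Schmidt norm being submultiplicative; so it passes to *-polynomials
    ([cvg_moments_star_poly]).

    A response is, almost surely, a Borel function of the family of block sums:
    the pointwise limit along finite sets of multi-indices exhausting the series
    fast enough ([exists_response]). Evaluating the same function at the coupled
    sums yields copies with the correct joint law. Convergence in law follows by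
    dominated convergence along almost surely convergent subsequences
    ([expectation_cvg]). The responses to a fixed array are the case of a
    constant sequence of arrays. *)

Import Order.TTheory GRing.Theory Num.Theory.
Import numFieldNormedType.Exports.
Local Open Scope classical_set_scope.
Local Open Scope ring_scope.
Set Implicit Arguments.
Unset Strict Implicit.
Unset Printing Implicit Defensive.

(** * Sign averages and the heat kernel *)

Section SignAverage.
Context {R : realType} {I : eqType}.

Definition upd (x : I -> R) (i : I) (a : R) : I -> R :=
  fun k => if k == i then a else x k.

(** Averaging one sign at a time, rather than summing over the cube, makes
    every estimate below an induction on the list of signs. Coordinates outside
    [s] are read from [x]. *)
Fixpoint savg (s : seq I) (G : (I -> R) -> R) (x : I -> R) : R :=
  if s is i :: s' then (savg s' G (upd x i 1) + savg s' G (upd x i (-1))) / 2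
  else G x.

Lemma le_savg s (G G' : (I -> R) -> R) x :
  (forall z, (forall k, k \notin s -> z k = x k) -> G z <= G' z) ->
  savg s G x <= savg s G' x.
Proof.
elim: s x => [|i s IH] x h /=; first exact: h.
rewrite ler_pM2r// lerD// IH// => z hz; apply: h => k;
  by rewrite inE negb_or => /andP[/negPf ki ks]; rewrite hz// /upd ki.
Qed.

Lemma eq_savg s (G G' : (I -> R) -> R) x :
  (forall z, (forall k, k \notin s -> z k = x k) -> G z = G' z) ->
  savg s G x = savg s G' x.
Proof.
by move=> h; apply/le_anti/andP; split; apply: le_savg => z hz; rewrite h.
Qed.

Lemma savg_cst s (c : R) x : savg s (fun=> c) x = c.
Proof. by elim: s x => //= i s IH x; rewrite !IH; lra. Qed.

Lemma savgZ s (c : R) G x : savg s (fun z => c * G z) x = c * savg s G x.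
Proof. by elim: s x => //= i s IH x; rewrite !IH mulrA mulrDr. Qed.

Lemma savg_ge0 s G x : (forall z, 0 <= G z) -> 0 <= savg s G x.
Proof. by move=> h; rewrite -(savg_cst s 0 x); apply: le_savg. Qed.

Lemma savg_cat s t G x : savg (s ++ t) G x = savg s (savg t G) x.
Proof. by elim: s x => //= i s IH x; rewrite !IH. Qed.

End SignAverage.

Section HeatStep.
Context {R : realType}.
Implicit Types (m s h u y c : R) (B : set R).
Notation mu := (@lebesgue_measure R).

(** The quotient of the two sides decreases on the half-line, because
    [sinh x <= x cosh x] there. *)
Lemma cosh_le (t : R) : expR t + expR (- t) <= 2 * expR (t ^+ 2 / 2).
Proof.
wlog t0 : t / 0 <= t => [hw|].
  have [/hw//|/ltW tn] := leP 0 t.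
  by have := hw (- t); rewrite opprK sqrrN addrC; apply; lra.
pose f (x : R) : R := expR (- (x ^+ 2 / 2)) * (expR x + expR (- x)).
pose g (x : R) : R := expR x - expR (- x) - x * (expR x + expR (- x)).
have dg (x : R) : is_derive x 1 g (- (x * (expR x - expR (- x)))).
  rewrite /g; apply: is_derive_eq; rewrite /GRing.scale/=; ring.
have df (x : R) : is_derive x 1 f (expR (- (x ^+ 2 / 2)) * g x).
  by rewrite /f /g; apply: is_derive_eq; rewrite /GRing.scale/=; field.
have g0 (z : R) : 0 <= z -> g z <= 0.
  move=> z0; have -> : 0 = g 0 by rewrite /g oppr0 expR0; ring.
  apply: (@ler0_derive1_nincry _ g 0) => //.
  - move=> y; rewrite in_itv/= andbT => y0.
    rewrite derive1E (@derive_val _ _ _ _ _ _ _ (dg y)) oppr_le0 mulr_ge0 ?(ltW y0)//.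
    by rewrite subr_ge0 ler_expR; lra.
  - apply: continuous_subspaceT => y; apply: differentiable_continuous; exact/derivable1_diffP.
have : f t <= f 0.
  apply: (@ler0_derive1_nincry _ f 0) => //.
  - move=> y; rewrite in_itv/= andbT => y0.
    rewrite derive1E (@derive_val _ _ _ _ _ _ _ (df y)) mulr_ge0_le0 ?expR_ge0//.
    exact/g0/ltW.
  - apply: continuous_subspaceT => y; apply: differentiable_continuous; exact/derivable1_diffP.
rewrite /f expr0n/= mul0r oppr0 expR0 mul1r expRN mulrC.
by rewrite ler_pdivrMr ?expR_gt0//; lra.
Qed.

Definition gauss_dens (s u : R) : R := (Num.sqrt (s * pi *+ 2))^-1 * expR (- (u ^+ 2 / (s *+ 2))).

Lemma gauss_densE m s y : 0 < s -> normal_pdf m (Num.sqrt s) y = gauss_dens s (y - m).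
Proof.
move=> s0; rewrite normal_pdfE ?gt_eqF ?sqrtr_gt0// /normal_peak /normal_fun /gauss_dens.
by rewrite sqr_sqrtr ?ltW// mulNr.
Qed.

(** Averaging a Gaussian density of variance [s] over the shifts by [h] and [-h]
    gives [exp (- h^2/2s) cosh (u h/s)] times the density, and [cosh] is at most
    the Gaussian [exp (u^2 h^2/2s^2)]: up to a constant factor the average is
    dominated by the density of variance [s + h^2 r]. The excess of [r] over [1]
    and the exponential factor are uniform over all variances [s >= s0], so the
    step can be iterated. *)
Lemma heat_step (s0 s h r u : R) : r = s0 / (s0 - h ^+ 2) -> 0 < h -> h ^+ 2 < s0 -> s0 <= s ->
  gauss_dens s (u - h) + gauss_dens s (u + h) <=
  2 * (expR (h ^+ 2 * (r - 1) / (2 * s0)) * gauss_dens (s + h ^+ 2 * r) u).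
Proof.
move=> rE h0 hs0 s0s.
have s00 : 0 < s0 by apply: lt_trans hs0; rewrite exprn_gt0.
have s_gt0 : 0 < s by lra.
have q0 : 0 < s0 - h ^+ 2 by lra.
have h20 : 0 < h ^+ 2 by rewrite exprn_gt0.
have r1 : 1 <= r by rewrite rE ler_pdivlMr//; lra.
have s'0 : 0 < s + h ^+ 2 * r by rewrite addr_gt0// mulr_gt0//; lra.
set s' := s + h ^+ 2 * r.
pose cs := (Num.sqrt (s * pi *+ 2))^-1; pose cs' := (Num.sqrt (s' * pi *+ 2))^-1.
have pi0 := pi_gt0 R.
have sp0 : 0 < s * pi *+ 2 by rewrite mulrn_wgt0// mulr_gt0.
have sp'0 : 0 < s' * pi *+ 2 by rewrite mulrn_wgt0// mulr_gt0.
have cs0 : 0 < cs by rewrite invr_gt0 sqrtr_gt0.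
have cs'0 : 0 < cs' by rewrite invr_gt0 sqrtr_gt0.
(* normalising constants: sqrt (s'/s) <= exp (h^2 r / 2s) *)
have cc : cs <= cs' * expR (h ^+ 2 * r / (2 * s)).
  rewrite mulrC -ler_pdivrMr// /cs' invrK /cs mulrC.
  rewrite ler_pdivrMr ?sqrtr_gt0//.
  have -> : expR (h ^+ 2 * r / (2 * s)) = Num.sqrt (expR (h ^+ 2 * r / s)).
    rewrite -[RHS]ger0_norm ?sqrtr_ge0// -sqrtr_sqr sqr_sqrtr ?expR_ge0//.
    rewrite -[LHS]ger0_norm ?expR_ge0// -sqrtr_sqr -expRM_natl.
    by congr (Num.sqrt (expR _)); field; lra.
  rewrite -sqrtrM ?expR_ge0// ler_sqrt; last by rewrite mulr_ge0 ?expR_ge0// ltW.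
  rewrite -!mulrnAr mulrA ler_pM2r; last by rewrite mulrn_wgt0.
  rewrite -[leRHS]mulrC -ler_pdivrMl//.
  apply: le_trans (expR_ge1Dx _).
  by rewrite /s' le_eqVlt; apply/orP; left; apply/eqP; field; lra.
have e1 : expR (- ((u - h) ^+ 2 / (s *+ 2))) + expR (- ((u + h) ^+ 2 / (s *+ 2)))
   <= 2 * expR (- ((u ^+ 2 + h ^+ 2) / (s *+ 2)) + u ^+ 2 * h ^+ 2 / (s ^+ 2 *+ 2)).
  have -> : - ((u - h) ^+ 2 / (s *+ 2)) = - ((u ^+ 2 + h ^+ 2) / (s *+ 2)) + u * h / s.
    by field; lra.
  have -> : - ((u + h) ^+ 2 / (s *+ 2)) = - ((u ^+ 2 + h ^+ 2) / (s *+ 2)) + - (u * h / s).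
    by field; lra.
  rewrite !expRD -mulrDr mulrCA ler_pM2l ?expR_gt0//.
  apply: le_trans (cosh_le _) _; rewrite ler_pM2l// ler_expR le_eqVlt.
  by apply/orP; left; apply/eqP; field; lra.
have e2 : h ^+ 2 * r / (2 * s) + (- ((u ^+ 2 + h ^+ 2) / (s *+ 2)) + u ^+ 2 * h ^+ 2 / (s ^+ 2 *+ 2))
   <= h ^+ 2 * (r - 1) / (2 * s0) - u ^+ 2 / (s' *+ 2).
  have a1 : h ^+ 2 * (r - 1) / (2 * s) <= h ^+ 2 * (r - 1) / (2 * s0).
    apply: ler_wpM2l; first by rewrite mulr_ge0//; lra.
    by rewrite lef_pV2 ?posrE; lra.
  have a2 : u ^+ 2 * (1 / s' - (1 / s - h ^+ 2 / s ^+ 2)) <= 0.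
    apply: mulr_ge0_le0; first exact: sqr_ge0.
    have -> : 1 / s' - (1 / s - h ^+ 2 / s ^+ 2) = (s ^+ 2 - s' * (s - h ^+ 2)) / (s' * s ^+ 2).
      by field; rewrite !gt_eqF//.
    apply: mulr_le0_ge0; last by rewrite invr_ge0 mulr_ge0 ?sqr_ge0// ltW.
    have -> : s ^+ 2 - s' * (s - h ^+ 2) = h ^+ 2 * (s - r * (s - h ^+ 2)).
      by rewrite /s'; ring.
    apply: mulr_ge0_le0; first exact: ltW.
    have -> : s - r * (s - h ^+ 2) = h ^+ 2 * (s0 - s) / (s0 - h ^+ 2).
      by rewrite rE; field; lra.
    apply: mulr_le0_ge0; last by rewrite invr_ge0 ltW.
    by apply: mulr_ge0_le0; lra.
  have -> : h ^+ 2 * r / (2 * s) + (- ((u ^+ 2 + h ^+ 2) / (s *+ 2)) + u ^+ 2 * h ^+ 2 / (s ^+ 2 *+ 2))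
     = h ^+ 2 * (r - 1) / (2 * s) + (u ^+ 2 * (1 / s' - (1 / s - h ^+ 2 / s ^+ 2))) / 2 - u ^+ 2 / (s' *+ 2).
    by field; rewrite !gt_eqF.
  by lra.
rewrite /gauss_dens -/cs -/cs' -mulrDr.
apply: le_trans (ler_wpM2l (ltW cs0) e1) _.
rewrite mulrCA ler_pM2l//.
apply: le_trans (ler_wpM2r (expR_ge0 _) cc) _.
rewrite -(mulrA cs') -expRD [leRHS]mulrCA ler_pM2l// -expRD ler_expR.
exact: e2.
Qed.

End HeatStep.

(** * A one-sided central limit estimate *)

(** Parametrised by the variance, which is what grows additively when signs are
    averaged in. *)
HB.lock Definition gauss_prob (R : realType) (m s : R) (B : set R) : R :=
  fine (normal_prob m (Num.sqrt s) B).

Section CLT.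
Context {R : realType}.
Implicit Types (m s h u y c : R) (B : set R).
Notation mu := (@lebesgue_measure R).

Lemma gauss_probE m s B : measurable B -> normal_prob m (Num.sqrt s) B = (gauss_prob m s B)%:E.
Proof. by move=> mB; rewrite gauss_prob.unlock fineK// fin_num_measure. Qed.

Lemma gauss_prob_ge0 m s B : 0 <= gauss_prob m s B.
Proof. by rewrite gauss_prob.unlock fine_ge0. Qed.

Lemma gauss_prob_le1 m s B : measurable B -> gauss_prob m s B <= 1.
Proof. by move=> mB; rewrite -lee_fin -gauss_probE// probability_le1. Qed.

Lemma gauss_probC m s B : measurable B -> gauss_prob m s (~` B) = 1 - gauss_prob m s B.
Proof.
move=> mB; apply: EFin_inj; rewrite -gauss_probE ?EFinB -?gauss_probE//; last exact: measurableC.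
by rewrite probability_setC.
Qed.

(** Domination of densities integrates to domination of probabilities. *)
Lemma gauss_prob_dom2 m1 s1 m2 s2 m3 s3 c B : measurable B ->
  0 < s1 -> 0 < s2 -> 0 < s3 -> 0 <= c ->
  (forall y, B y -> gauss_dens s1 (y - m1) + gauss_dens s2 (y - m2) <= c * gauss_dens s3 (y - m3)) ->
  gauss_prob m1 s1 B + gauss_prob m2 s2 B <= c * gauss_prob m3 s3 B.
Proof.
move=> mB s10 s20 s30 c0 H.
have mpdf m s : measurable_fun B (fun y : R => (normal_pdf m s y)%:E : \bar R).
  by apply/measurable_EFinP; apply: measurable_funTS; exact: measurable_normal_pdf.
have pdf0 m s y : (0 <= (normal_pdf m s y)%:E)%E by rewrite lee_fin normal_pdf_ge0.
have toE (a b d : R) : (a%:E + b%:E <= c%:E * d%:E)%E -> a + b <= c * d.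
  by rewrite -EFinD -EFinM lee_fin.
apply: toE; rewrite -(gauss_probE m1 s1 mB) -(gauss_probE m2 s2 mB) -(gauss_probE m3 s3 mB).
rewrite /normal_prob.
rewrite -ge0_integralD; [|by []|by []|exact: mpdf|by []|exact: mpdf].
rewrite -ge0_integralZl; [|by []|exact: mpdf|by []|by rewrite lee_fin].
apply: ge0_le_integral => //.
- by move=> y _; rewrite adde_ge0.
- by apply: emeasurable_funD; exact: mpdf.
- by apply: measurable_funeM; exact: mpdf.
- by move=> y By; rewrite -EFinD -EFinM lee_fin !gauss_densE//; exact: H.
Qed.

Lemma gauss_prob_dom m1 s1 m2 s2 c B : measurable B ->
  0 < s1 -> 0 < s2 -> 0 <= c ->
  (forall y, B y -> gauss_dens s1 (y - m1) <= c * gauss_dens s2 (y - m2)) ->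
  gauss_prob m1 s1 B <= c * gauss_prob m2 s2 B.
Proof.
move=> mB s10 s20 c0 H.
suff : gauss_prob m1 s1 B + gauss_prob m1 s1 B <= (2 * c) * gauss_prob m2 s2 B by lra.
apply: gauss_prob_dom2 => // [|y By]; first by rewrite mulr_ge0.
by have := H _ By; lra.
Qed.

Lemma gauss_dens_gt0 s u : 0 < s -> 0 < gauss_dens s u.
Proof.
move=> s0; rewrite /gauss_dens mulr_gt0 ?expR_gt0// invr_gt0 sqrtr_gt0.
by rewrite mulrn_wgt0// mulr_gt0// pi_gt0.
Qed.

(** Chebyshev's inequality up to the constant, by comparison with the density of
    twice the variance. *)
Lemma gauss_prob_tail m s (e : R) B : 0 < s -> 0 < e -> measurable B ->
  (forall y, B y -> e <= `|y - m|) -> gauss_prob m s B <= 8 * s / e ^+ 2.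
Proof.
move=> s0 e0 mB H.
have k0 : 0 <= 8 * s / e ^+ 2 by rewrite divr_ge0 ?sqr_ge0// mulr_ge0// ltW.
apply: (@le_trans _ _ (8 * s / e ^+ 2 * gauss_prob m (2 * s) B)); last first.
  by rewrite ler_piMr// gauss_prob_le1.
apply: gauss_prob_dom => // [|y By]; first by rewrite mulr_gt0.
have pi0 := pi_gt0 R.
have sp : 0 < s * pi *+ 2 by rewrite mulrn_wgt0// mulr_gt0.
set v := y - m; have ev : e ^+ 2 <= v ^+ 2.
  by rewrite -[v ^+ 2](real_normK (num_real v)) lerXn2r// ?nnegrE ?(ltW e0)// H.
have v20 : 0 < v ^+ 2 by apply: lt_le_trans ev; rewrite exprn_gt0.
rewrite /gauss_dens.
have -> : Num.sqrt (2 * s * pi *+ 2) = Num.sqrt 2 * Num.sqrt (s * pi *+ 2).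
  by rewrite -sqrtrM//; congr (Num.sqrt _); ring.
set c := Num.sqrt (s * pi *+ 2); have c0 : 0 < c by rewrite sqrtr_gt0.
have r20 : 0 < Num.sqrt 2 :> R by rewrite sqrtr_gt0.
have r22 : Num.sqrt 2 <= 2 :> R.
  by rewrite -[leRHS]ger0_norm// -sqrtr_sqr ler_sqrt//; lra.
have -> : - (v ^+ 2 / (s *+ 2)) = - (v ^+ 2 / (2 * s *+ 2)) + - (v ^+ 2 / (s *+ 4)).
  by field; lra.
rewrite expRD (invfM (Num.sqrt 2)); set w := expR (- (v ^+ 2 / (2 * s *+ 2))).
have -> : 8 * s / e ^+ 2 * ((Num.sqrt 2)^-1 / c * w) =
    (c^-1 * w) * (8 * s / e ^+ 2 / Num.sqrt 2) by ring.
rewrite mulrA ler_pM2l; last by rewrite mulr_gt0 ?invr_gt0 ?expR_gt0.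
rewrite expRN; apply: (@le_trans _ _ (v ^+ 2 / (s *+ 4))^-1).
  rewrite lef_pV2 ?posrE ?expR_gt0//; last first.
    by rewrite divr_gt0 ?mulrn_wgt0.
  by have := expR_ge1Dx (v ^+ 2 / (s *+ 4)); lra.
rewrite invf_div.
apply: (@le_trans _ _ (s *+ 4 / e ^+ 2)).
  apply: ler_wpM2l; first by rewrite mulrn_wge0// ltW.
  by rewrite lef_pV2 ?posrE// exprn_gt0.
have -> : 8 * s / e ^+ 2 / Num.sqrt 2 = (8 / Num.sqrt 2) * (s / e ^+ 2) by field; rewrite !gt_eqF.
have -> : s *+ 4 / e ^+ 2 = 4 * (s / e ^+ 2) by field; rewrite !gt_eqF.
apply: ler_wpM2r; first by rewrite divr_ge0 ?sqr_ge0 ?ltW.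
by rewrite ler_pdivlMr//; lra.
Qed.

(** The density of variance [s] is at least [1/s] times the standard one; this is
    applied to the complement of [B]. *)
Lemma gauss_prob_widen s B : 1 <= s -> measurable B -> gauss_prob 0 s B <= gauss_prob 0 1 B + (s - 1).
Proof.
move=> s1 mB; have s0 : 0 < s by lra.
have H : s^-1 * gauss_prob 0 1 (~` B) <= gauss_prob 0 s (~` B).
  rewrite mulrC ler_pdivrMr// mulrC.
  apply: gauss_prob_dom => //; [exact: measurableC|exact: ltW|move=> y _].
  have pi0 := pi_gt0 R.
  rewrite /gauss_dens subr0 mulrA; apply: ler_pM.
  - by rewrite invr_ge0 sqrtr_ge0.
  - exact: expR_ge0.
  - rewrite ler_pdivlMr ?sqrtr_gt0; last by rewrite mulrn_wgt0// mulr_gt0.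
    rewrite mulrC ler_pdivrMr ?sqrtr_gt0; last by rewrite mulrn_wgt0// mulr_gt0.
    rewrite -[in leRHS](ger0_norm (ltW s0)) -sqrtr_sqr -sqrtrM ?sqr_ge0//.
    rewrite ler_sqrt; last by rewrite mulr_ge0 ?sqr_ge0// mulrn_wge0// mul1r ltW.
    by rewrite mul1r -mulrnAr; apply: ler_wpM2r; [rewrite mulrn_wge0// ltW|nra].
  - rewrite ler_expR lerN2; apply: ler_wpM2l; first exact: sqr_ge0.
    by rewrite lef_pV2 ?posrE; lra.
move: H; rewrite !gauss_probC// => H.
have b1 := gauss_prob_le1 0 1 mB; have b0 := gauss_prob_ge0 0 1 B.
have : 1 - (s - 1) <= s^-1 by rewrite -[leRHS]mul1r ler_pdivlMr//; nra.
have : s^-1 <= 1 by rewrite invf_le1.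
nra.
Qed.

(** Iterating the heat step over all signs of a block. *)
Lemma savg_gauss_prob (I : eqType) (l : seq I) (x : I -> R) m s0 h r B :
  measurable B -> uniq l -> r = s0 / (s0 - h ^+ 2) -> 0 < h -> h ^+ 2 < s0 ->
  savg l (fun z => gauss_prob (m + h * \sum_(i <- l) z i) s0 B) x <=
  expR (h ^+ 2 * (r - 1) / (2 * s0)) ^+ size l *
    gauss_prob m (s0 + (size l)%:R * (h ^+ 2 * r)) B.
Proof.
move=> mB + rE h0 hs0.
have h20 : 0 < h ^+ 2 by rewrite exprn_gt0.
have s00 : 0 < s0 by lra.
have r0 : 0 < r by rewrite rE divr_gt0//; lra.
have hr0 : 0 < h ^+ 2 * r by rewrite mulr_gt0.
elim: l m x => [|i l IH] m x /=.
  by move=> _; rewrite big_nil mulr0 addr0 expr0 mul1r mul0r addr0.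
move=> /andP[il ul]; set f := expR _.
have E a : savg l (fun z => gauss_prob (m + h * \sum_(j <- i :: l) z j) s0 B) (upd x i a) =
    savg l (fun z => gauss_prob ((m + h * a) + h * \sum_(j <- l) z j) s0 B) (upd x i a).
  apply: eq_savg => z hz; rewrite big_cons hz// /upd eqxx.
  by rewrite mulrDr addrA.
rewrite !E ler_pdivrMr//.
apply: le_trans (lerD (IH _ _ ul) (IH _ _ ul)) _.
rewrite mulr1 mulrN1 (exprS f); set F := f ^+ size l.
have F0 : 0 <= F by rewrite exprn_ge0 ?expR_ge0.
set a := gauss_prob (m + h) _ B; set b := gauss_prob (m - h) _ B; set c := gauss_prob m _ B.
suff : b + a <= 2 * f * c.
  move=> /(ler_wpM2l F0) H; apply: le_trans (_ : F * (b + a) <= _); first by rewrite mulrDr addrC.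
  by apply: le_trans H _; rewrite le_eqVlt; apply/orP; left; apply/eqP; ring.
rewrite /a /b /c.
have sl0 : 0 <= (size l)%:R * (h ^+ 2 * r) by rewrite mulr_ge0// ltW.
apply: gauss_prob_dom2 => //.
- by rewrite ltr_wpDr.
- by rewrite ltr_wpDr.
- by rewrite ltr_wpDr// mulr_ge0// ltW.
- by rewrite mulr_ge0 ?expR_ge0.
move=> y _.
have -> : y - (m - h) = (y - m) + h by ring.
have -> : y - (m + h) = (y - m) - h by ring.
rewrite addrC.
have -> : s0 + (size l).+1%:R * (h ^+ 2 * r) = (s0 + (size l)%:R * (h ^+ 2 * r)) + h ^+ 2 * r.
  by rewrite -natr1; ring.
have := @heat_step R s0 (s0 + (size l)%:R * (h ^+ 2 * r)) h r (y - m) rE h0 hs0.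
rewrite lerDl => /(_ sl0) H.
by rewrite -mulrA.
Qed.

(** The law of the normalised sum is compared with its convolution with a
    Gaussian of small variance [s0]: the convolution gives [B] almost full mass
    from every point of [A], because [B] contains the [e]-neighbourhood of [A].
    By the iterated heat step it is dominated, up to a factor close to [1], by
    the Gaussian of variance [s0 + r], itself close to the standard one. *)
Lemma clt_upper (A B : set R) (e eta : R) : measurable B -> 0 < e -> 0 < eta ->
  (forall m y, A m -> `|y - m| < e -> B y) ->
  \forall N \near \oo, forall (I : eqType) (l : seq I) (x : I -> R),
    uniq l -> size l = N ->
    savg l (fun z => \1_A ((Num.sqrt N%:R)^-1 * \sum_(i <- l) z i)) x <=
    gauss_prob 0 1 B + eta.
Proof.
move=> mB e0 eta0 AB.
(* [s0 K] bounds the tail of the smoothing Gaussian together with the variance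
   that it adds; [D] bounds the excess variance accumulated by the heat steps *)
pose K := 8 / e ^+ 2 + 1.
have K0 : 0 < K by rewrite addr_gt0// divr_gt0// exprn_gt0.
pose s0 := Num.min 1 (eta / 2 / K).
have s00 : 0 < s0 by rewrite lt_min ltr01 !divr_gt0.
have s01 : s0 <= 1 by rewrite ge_min lexx.
have s0K : s0 * K <= eta / 2 by rewrite -ler_pdivlMr// ge_min lexx orbT.
pose D := Num.min s0 (eta / 2 / (1 + 2 / s0)).
have D0' : 0 < 1 + 2 / s0 by rewrite addr_gt0// divr_gt0.
have D0 : 0 < D by rewrite lt_min s00 !divr_gt0.
have Ds0 : D <= s0 by rewrite ge_min lexx.
have De : D * (1 + 2 / s0) <= eta / 2 by rewrite -ler_pdivlMr// ge_min lexx orbT.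
near=> N => I l x ul sl.
have N0 : 0 < N%:R :> R by near: N; exact: nbhs_infty_gtr.
pose h := (Num.sqrt N%:R)^-1 : R.
have h0 : 0 < h by rewrite invr_gt0 sqrtr_gt0.
have h2 : h ^+ 2 = N%:R^-1 by rewrite /h exprVn sqr_sqrtr// ltW.
have NN : (1 + D^-1) / s0 <= N%:R by near: N; exact: nbhs_infty_ger.
have hs0 : N%:R^-1 < s0.
  rewrite -[ltLHS]mul1r ltr_pdivrMr// mulrC -ltr_pdivrMr//.
  by apply: lt_le_trans NN; rewrite ltr_pM2r ?invr_gt0// ltrDl invr_gt0.
pose r := s0 / (s0 - h ^+ 2).
have r1 : r - 1 <= D.
  rewrite /r h2.
  have -> : s0 / (s0 - N%:R^-1) - 1 = (N%:R * s0 - 1)^-1.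
    have q1 : 0 < N%:R * s0 - 1 by rewrite subr_gt0 -ltr_pdivrMl// mulr1.
    field.
    by rewrite !gt_eqF.
  rewrite -[leRHS]invrK lef_pV2 ?posrE ?invr_gt0//; last first.
    by rewrite subr_gt0 -ltr_pdivrMl// mulr1.
  by move: NN; rewrite ler_pdivrMr//; lra.
have r_ge1 : 1 <= r by rewrite /r h2 ler_pdivlMr ?subr_gt0// mul1r gerBl invr_ge0 ltW.
set V := savg _ _ _.
have V1 : V <= 1.
  by rewrite -(savg_cst l 1 x); apply: le_savg => z _; rewrite indicE lern1 leq_b1.
have V0 : 0 <= V by apply: savg_ge0 => z; rewrite indicE ler0n.
pose k := 8 * s0 / e ^+ 2.
have k0 : 0 <= k by rewrite divr_ge0 ?sqr_ge0// mulr_ge0// ltW.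
have VE : (1 - k) * V <= savg l (fun z => gauss_prob (0 + h * \sum_(i <- l) z i) s0 B) x.
  rewrite -savgZ; apply: le_savg => z _; rewrite add0r -/h.
  rewrite indicE; case: (boolP (_ \in A)); last by rewrite mulr0 gauss_prob_ge0.
  move=> /set_mem Am; rewrite mulr1 lerBlDr -lerBlDl -gauss_probC//.
  apply: gauss_prob_tail => //; first exact: measurableC.
  by move=> y By; rewrite leNgt; apply/negP => ye; apply: By; exact: AB Am ye.
have := le_trans VE (@savg_gauss_prob _ l x 0 s0 h r B mB ul erefl h0 _).
rewrite h2 => /(_ hs0); rewrite sl.
have -> : N%:R * (N%:R^-1 * r) = r by field; rewrite gt_eqF.
rewrite -expRM_natl.
have -> : N%:R * (N%:R^-1 * (r - 1) / (2 * s0)) = (r - 1) / (2 * s0) by field; rewrite !gt_eqF.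
set t := (r - 1) / (2 * s0); move=> H.
have t0 : 0 <= t by rewrite divr_ge0 ?subr_ge0// mulr_ge0// ltW.
have t12 : t <= 2^-1.
  by rewrite ler_pdivrMr; [lra|rewrite mulr_gt0].
have et : expR t <= 1 + 2 * t.
  have := expR_ge1Dx (- t); rewrite expRN => et1.
  have := expR_gt0 t => et0.
  have : expR t * (1 - t) <= 1 by rewrite -ler_pdivlMl// mulr1.
  nra.
have W := @gauss_prob_widen (s0 + r) B _ mB; have {}W := W _.
have W' : gauss_prob 0 (s0 + r) B <= gauss_prob 0 1 B + (s0 + r - 1) by apply: W; lra.
have p1 := gauss_prob_le1 0 (s0 + r) mB; have p0 := gauss_prob_ge0 0 (s0 + r) B.
have tE : 2 * t = (r - 1) / s0 by rewrite /t; field; rewrite gt_eqF.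
have kK : k + s0 <= eta / 2 by move: s0K; rewrite /K /k mulrDr mulr1; lra.
have De2 : (r - 1) + 2 * t <= eta / 2.
  rewrite tE; apply: le_trans De.
  rewrite mulrDr mulr1; apply: lerD => //.
  rewrite mulrA; apply: ler_wpM2r; first by rewrite invr_ge0 ltW.
  by nra.
have : k * V <= k by rewrite ler_piMr.
have : expR t * gauss_prob 0 (s0 + r) B <= gauss_prob 0 (s0 + r) B + 2 * t by nra.
lra.
Unshelve. all: by end_near. Qed.

End CLT.

(** * The quantile coupling with a Gaussian *)

Section Quantile.
Context {R : realType}.
Notation mu := (@lebesgue_measure R).

(** Rays generate the Borel sets and are stable under intersection. *)
Lemma eq_prob_rays (m1 m2 : probability (R : measurableType default_measure_display) R) :
  (forall x, m1 `]x, +oo[%classic = m2 `]x, +oo[%classic) ->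
  forall A, measurable A -> m1 A = m2 A.
Proof.
move=> H A mA.
apply: (@measure_unique _ R R (@RGenOInfty.G R) (fun n => `](- n%:R), +oo[%classic)) => //.
- exact: RGenOInfty.measurableE.
- move=> _ _ [x ->] [y ->]; exists (Num.max x y).
  by apply/seteqP; split => z; rewrite /= !in_itv/= !andbT gt_max;
    [move=> [-> ->]|move=> /andP[]].
- by move=> i; exists (- i%:R).
- apply/seteqP; split => // x _; have /ltrNnormlW := archi_boundP (normr_ge0 x).
  by exists (Num.bound `|x|) => //=; rewrite in_itv/= andbT.
- move=> ? [x ->]; exact: H.
- by move=> n; rewrite (le_lt_trans (probability_le1 _ _)) ?ltry.
Qed.

Definition Phi (x : R) : R := gauss_prob 0 1 `]-oo, x].

Lemma PhiB (x y : R) : x <= y -> Phi y - Phi x = gauss_prob 0 1 `]x, y].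
Proof.
move=> xy; apply: EFin_inj; rewrite EFinB /Phi -!gauss_probE//.
have -> : `]-oo, y]%classic = `]-oo, x] `|` `]x, y].
  by rewrite -itv_bndbnd_setU// bnd_simp.
rewrite measureU//; last first.
  by apply/seteqP; split => // z [/=]; rewrite !in_itv/= => zx /andP[/lt_le_trans/(_ zx)]; rewrite ltxx.
by rewrite addeAC subee ?add0e// fin_num_measure.
Qed.

Lemma Phi_lip (x y : R) : x <= y -> Phi y - Phi x <= gauss_dens 1 0 * (y - x).
Proof.
move=> xy; rewrite PhiB// -lee_fin -gauss_probE//.
apply: (@le_trans _ _ (\int[mu]_(z in `]x, y]) (gauss_dens 1 0)%:E)%E); last first.
  rewrite integral_cst// /= lebesgue_measure_itv/= lte_fin.
  by move: xy; rewrite le_eqVlt => /predU1P[->|->]; rewrite ?ltxx ?subrr ?mulr0 ?mule0.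
apply: ge0_le_integral => //.
- by move=> z _; rewrite lee_fin normal_pdf_ge0.
- by apply/measurable_EFinP; apply: measurable_funTS; exact: measurable_normal_pdf.
- move=> z _; rewrite lee_fin gauss_densE// /gauss_dens; apply: ler_wpM2l.
    by rewrite invr_ge0 sqrtr_ge0.
  rewrite ler_expR lerN2 expr0n/= mul0r divr_ge0 ?sqr_ge0//.
Qed.

Lemma Phi_lt (x y : R) : x < y -> Phi x < Phi y.
Proof.
move=> xy; rewrite -subr_gt0 PhiB ?ltW//.
pose M := `|x| + `|y|.
have M0 : 0 <= M by rewrite addr_ge0.
apply: (@lt_le_trans _ _ (gauss_dens 1 M * (y - x))).
  by rewrite mulr_gt0 ?gauss_dens_gt0 ?subr_gt0.
rewrite -lee_fin -gauss_probE//.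
apply: (@le_trans _ _ (\int[mu]_(z in `]x, y]) (gauss_dens 1 M)%:E)%E).
  by rewrite integral_cst// /= lebesgue_measure_itv/= lte_fin xy.
apply: ge0_le_integral => //.
- by move=> z _; rewrite lee_fin ltW// gauss_dens_gt0.
- by apply/measurable_EFinP; apply: measurable_funTS; exact: measurable_normal_pdf.
- move=> z /=; rewrite in_itv/= => /andP[xz zy].
  rewrite lee_fin gauss_densE// /gauss_dens subr0; apply: ler_wpM2l.
    by rewrite invr_ge0 sqrtr_ge0.
  rewrite ler_expR lerN2; apply: ler_wpM2r => //.
  rewrite -[z ^+ 2](real_normK (num_real z)) lerXn2r// ?nnegrE//.
  rewrite ler_norml /M; apply/andP; split.
    have := ler_norm (- x); rewrite normrN; have := normr_ge0 y; lra.
  have := ler_norm y; have := normr_ge0 x; lra.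
Qed.

Lemma Phi_le (x y : R) : (Phi x <= Phi y) = (x <= y).
Proof. by apply: le_mono => u v; exact: Phi_lt. Qed.

Lemma Phi_continuous : continuous Phi.
Proof.
have g0 : 0 < gauss_dens 1 0 :> R by exact: gauss_dens_gt0.
have L (x y : R) : `|Phi x - Phi y| <= gauss_dens 1 0 * `|x - y|.
  wlog xy : x y / x <= y => [hw|].
    by have [/hw//|/ltW/hw] := leP x y; rewrite distrC (distrC y).
  rewrite distrC (distrC x) !ger0_norm ?subr_ge0 ?Phi_le//.
  exact: Phi_lip.
move=> x; apply/cvgrPdist_le => e e0; near=> y.
apply: le_trans (L _ _) _; rewrite mulrC -ler_pdivlMr//.
near: y; apply: cvgr_dist_le; first exact: cvg_id.
by rewrite divr_gt0.
Unshelve. all: by end_near. Qed.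

Lemma Phi_ge0 x : 0 <= Phi x. Proof. exact: gauss_prob_ge0. Qed.
Lemma Phi_le1 x : Phi x <= 1. Proof. exact: gauss_prob_le1. Qed.
Lemma Phi_gt0 x : 0 < Phi x.
Proof. by apply: le_lt_trans (Phi_ge0 (x - 1)) _; apply: Phi_lt; lra. Qed.
Lemma Phi_lt1 x : Phi x < 1.
Proof. by apply: lt_le_trans (Phi_le1 (x + 1)); apply: Phi_lt; lra. Qed.

Lemma PhiC x : gauss_prob 0 1 `]x, +oo[ = 1 - Phi x.
Proof. by rewrite /Phi -gauss_probC// setCitvl. Qed.

Lemma Phi_onto (p : R) : 0 < p -> p < 1 -> exists y, Phi y = p.
Proof.
move=> p0 p1.
pose q := Num.min p (1 - p).
have q0 : 0 < q by rewrite lt_min p0 subr_gt0.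
have [qp q1p] : q <= p /\ q <= 1 - p by split; rewrite ge_min lexx ?orbT.
pose M := 8 / q + 1.
have M0 : 1 <= M by rewrite lerDr divr_ge0// ltW.
have MM : 8 * 1 / M ^+ 2 <= q.
  rewrite ler_pdivrMr ?exprn_gt0//; last by lra.
  apply: (@le_trans _ _ (q * M)).
    by rewrite /M mulrDr mulrCA divff ?gt_eqF//; lra.
  apply: ler_wpM2l; first exact: ltW.
  by rewrite expr2 ler_peMr//; lra.
have M00 : 0 < M by lra.
have a1 : Phi (- M) <= p.
  apply: le_trans qp; apply: le_trans MM; apply: gauss_prob_tail => // y /=.
  by rewrite in_itv/= subr0 ler_normr => h; apply/orP; right; lra.
have a2 : p <= Phi M.
  have : gauss_prob 0 1 `]M, +oo[ <= q.
    apply: le_trans MM; apply: gauss_prob_tail => // y /=.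
    by rewrite in_itv/= andbT subr0 ler_normr => h; apply/orP; left; lra.
  by rewrite PhiC; lra.
have [|||c _ <-] := @IVT R Phi (- M) M p; [lra| | |by exists c].
  by apply: continuous_subspaceT; exact: Phi_continuous.
by rewrite ge_min le_max a1 a2 orbT.
Qed.

(** The normal distribution function of a normal variable is uniform on the unit
    interval: half-lines are its sublevel sets, and [Phi] is onto. *)
Lemma gauss_prob_Phi (p : R) : 0 <= p -> p <= 1 -> gauss_prob 0 1 [set x | Phi x <= p] = p.
Proof.
move=> p0 p1; have [->|pn0] := eqVneq p 0.
  have -> : [set x | Phi x <= 0] = set0.
    by apply/seteqP; split => // x /=; rewrite leNgt Phi_gt0.
  by apply: EFin_inj; rewrite -gauss_probE// measure0.
have [->|pn1] := eqVneq p 1.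
  have -> : [set x | Phi x <= 1] = setT.
    by apply/seteqP; split => // x _ /=; exact: Phi_le1.
  by apply: EFin_inj; rewrite -gauss_probE// probability_setT.
have [||y yE] := @Phi_onto p; [by rewrite lt_def pn0|by rewrite lt_def eq_sym pn1|].
have -> : [set x | Phi x <= p] = `]-oo, y]%classic.
  by apply/seteqP; split => x /=; rewrite in_itv/= -yE Phi_le.
exact: yE.
Qed.

Section OneVariable.
Context {d} {W : measurableType d} (P : probability W R) (S : {RV P >-> R}).

Definition rcdf (t : R) : R := fine (cdf S t).

Lemma rcdfE t : cdf S t = (rcdf t)%:E.
Proof. by rewrite /rcdf fineK// fin_num_measure. Qed.

(** The generalised inverse of the distribution function of [S], composed with
    the normal distribution function. *)
Definition quantile_map (x : R) : R := inf [set t | Phi x <= rcdf t].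

Lemma rcdf_nondecreasing s t : s <= t -> rcdf s <= rcdf t.
Proof. by move=> st; rewrite -lee_fin -!rcdfE; exact: cdf_nondecreasing. Qed.

Lemma quantile_set_neq0 x : [set t | Phi x <= rcdf t] !=set0.
Proof.
have h : rcdf t @[t --> +oo] --> (1 : R) by exact: (fine_cvg (cvg_cdfy1 S)).
near (pinfty_nbhs R) => M; exists M => /=; near: M.
by apply: (cvgr_ge _ h); exact: Phi_lt1.
Unshelve. all: by end_near. Qed.

Lemma quantile_set_lb x : has_lbound [set t | Phi x <= rcdf t].
Proof.
have h : rcdf t @[t --> -oo] --> (0 : R) by exact: (fine_cvg (cvg_cdfNy0 S)).
near (ninfty_nbhs R) => M; exists M => t /= Pt.
have MP : rcdf M < Phi x by near: M; apply: (cvgr_lt _ h); exact: Phi_gt0.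
rewrite leNgt; apply/negP => tM; move: MP; rewrite ltNge.
by rewrite (le_trans Pt)// rcdf_nondecreasing// ltW.
Unshelve. all: by end_near. Qed.

(** The Galois connection between a distribution function and its generalised
    inverse; right continuity gives the direction that is not immediate. *)
Lemma quantile_mapP x t : (quantile_map x <= t) = (Phi x <= rcdf t).
Proof.
apply/idP/idP => [|h]; last by apply: ge_inf => //; exact: quantile_set_lb.
move=> h.
have rc : rcdf s @[s --> t^'+] --> rcdf t.
  by apply: fine_cvg; rewrite -rcdfE; exact: cdf_right_continuous.
apply: (cvgr_to_ge rc); near=> s.
have ts : t < s by near: s; exact: nbhs_right_gt.
have [|u /= Pu us] := @inf_lt _ [set t | Phi x <= rcdf t] s _ (le_lt_trans h ts).
  exact: quantile_set_neq0.
by apply: le_trans Pu _; apply: rcdf_nondecreasing; exact: ltW.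
Unshelve. all: by end_near. Qed.

Lemma measurable_quantile_map : measurable_fun [set: R] quantile_map.
Proof.
apply: (measurability (@RGenOInfty.G R)); first exact: RGenOInfty.measurableE.
move=> _ /= [_ [t ->] <-]; rewrite setTI.
have -> : quantile_map @^-1` `]t, +oo[ = ~` (Phi @^-1` `]-oo, rcdf t]).
  by apply/seteqP; split => x /=; rewrite !in_itv/= andbT ltNge quantile_mapP => /negP.
apply: measurableC; rewrite -[X in measurable X]setTI.
exact: (continuous_measurable_fun Phi_continuous).
Qed.

(** By the Galois connection, the event that the quantile map is at most [x] is a
    sublevel set of [Phi], of probability the distribution function of [S]. *)
Lemma quantile_map_law (B : set R) : measurable B ->
  normal_prob 0 1 (quantile_map @^-1` B) = P (S @^-1` B).
Proof.
have mh : @measurable_fun _ _ (measurableTypeR R) R setT quantile_map.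
  exact: measurable_quantile_map.
pose h := @mfun_Sub _ _ (measurableTypeR R) R quantile_map (mem_set mh).
pose np := normal_prob 0 1 : probability (measurableTypeR R) R.
move=> mB.
suff H x : distribution np h `]x, +oo[%classic = distribution P S `]x, +oo[%classic.
  exact: (@eq_prob_rays (distribution np h) (distribution P S) H B mB).
have -> : `]x, +oo[%classic = ~` `]-oo, x]%classic by rewrite setCitvl.
rewrite !probability_setC//; congr (_ - _)%E.
rewrite [RHS]rcdfE -(gauss_prob_Phi (p := rcdf x)).
- rewrite -gauss_probE; last first.
    have -> : [set y | Phi y <= rcdf x] = Phi @^-1` `]-oo, rcdf x].
      by apply/seteqP; split => y /=; rewrite in_itv.
    rewrite -[X in measurable X]setTI.
    exact: (continuous_measurable_fun Phi_continuous).
  rewrite sqrtr1; congr (normal_prob 0 1 _).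
  by apply/seteqP; split => y /=; rewrite in_itv/= quantile_mapP.
- by rewrite /rcdf fine_ge0.
- by rewrite -lee_fin -rcdfE cdf_le1.
Qed.

End OneVariable.

(** The one-sided estimates place the distribution function of [S N] below
    [Phi x] at [x - e] and above it at [x + e], which by the Galois connection
    traps the quantile map in between. Convergence holds at every point because
    the normal distribution function is strictly increasing. *)
Lemma quantile_map_cvg d (W : measurableType d) (P : probability W R)
    (S : nat -> {RV P >-> R}) :
  (forall (A B : set R) (e eta : R), measurable A -> measurable B ->
     0 < e -> 0 < eta ->
     (forall m y, A m -> `|y - m| < e -> B y) ->
     \forall N \near \oo, (P (S N @^-1` A) <= (gauss_prob 0 1 B + eta)%:E)%E) ->
  forall x, quantile_map (S N) x @[N --> \oo] --> x.
Proof.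
move=> clt x; apply/cvgrPdist_le => e e0.
pose a := x - e / 2; pose b := x + e / 2.
have e20 : 0 < e / 2 by rewrite divr_gt0.
have ax : Phi a < Phi x by apply: Phi_lt; rewrite /a; lra.
have xb : Phi x < Phi b by apply: Phi_lt; rewrite /b; lra.
pose A1 : set R := `]-oo, x - e]%classic; pose A2 : set R := `]x + e, +oo[%classic.
have h1 := @clt A1 `]-oo, a]%classic (e / 2) ((Phi x - Phi a) / 2).
have h2 := @clt A2 `]b, +oo[%classic (e / 2) ((Phi b - Phi x) / 2).
near=> N.
have H1 : (P (S N @^-1` A1) <= (Phi a + (Phi x - Phi a) / 2)%:E)%E.
  near: N; apply: h1; [exact: measurable_itv|exact: measurable_itv|by []|
    by rewrite divr_gt0 ?subr_gt0|].
  move=> m y; rewrite /A1 /= !in_itv/= /a => mx; rewrite ltr_norml => /andP[_ ym]; lra.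
have H2 : (P (S N @^-1` A2) <= (1 - Phi b + (Phi b - Phi x) / 2)%:E)%E.
  rewrite -PhiC; near: N; apply: h2; [exact: measurable_itv|exact: measurable_itv|by []|
    by rewrite divr_gt0 ?subr_gt0|].
  move=> m y; rewrite /A2 /= !in_itv/= !andbT /b => mx; rewrite ltr_norml => /andP[ym _]; lra.
have {}H1 : rcdf (S N) (x - e) < Phi x.
  have : rcdf (S N) (x - e) <= Phi a + (Phi x - Phi a) / 2 by rewrite -lee_fin -rcdfE.
  by clear -ax; lra.
have {}H2 : Phi x <= rcdf (S N) (x + e).
  move: H2.
  have -> : A2 = ~` `]-oo, x + e]%classic by rewrite /A2 setCitvl.
  rewrite preimage_setC probability_setC; last exact: (measurable_funPTI (S N) (measurable_itv _)).
  rewrite [P _](rcdfE (S N) (x + e)) -EFinB lee_fin; lra.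
rewrite ler_distlC; apply/andP; split; last by rewrite quantile_mapP.
by rewrite ltW// ltNge quantile_mapP -ltNge.
Unshelve. all: by end_near. Qed.

End Quantile.

(** * Independent signs and their block sums *)

Section SignExpectation.
Context {R : realType} {d : measure_display} {W : measurableType d}.
Variable P : probability W R.
Context {I : choiceType}.
Variable xi : I -> {RV P >-> R}.
Hypothesis xi_indep : mutually_independent xi.
Hypothesis xi_sign : forall i, P (xi i @^-1` [set 1]) = (2^-1)%:E /\
                               P (xi i @^-1` [set -1]) = (2^-1)%:E.

Definition sign_event (t : seq I) (sg : I -> R) : set W :=
  [set w | forall i, i \in t -> xi i w = sg i].

Lemma measurable_xi_eq i (a : R) : measurable (xi i @^-1` [set a]).
Proof. exact: measurable_funPTI. Qed.

Lemma sign_event_cons i t sg :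
  sign_event (i :: t) sg = xi i @^-1` [set sg i] `&` sign_event t sg.
Proof.
apply/seteqP; split => w /=.
  by move=> h; split; [apply: h; rewrite mem_head|move=> k kt; apply: h; rewrite inE kt orbT].
by move=> [hi ht] k; rewrite inE => /predU1P[->|/ht].
Qed.

Lemma measurable_sign_event t sg : measurable (sign_event t sg).
Proof.
elim: t => [|i t IH].
  by rewrite (_ : sign_event _ _ = setT)//; apply/seteqP; split.
by rewrite sign_event_cons; apply: measurableI => //; exact: measurable_xi_eq.
Qed.

Lemma prob_sign_event t sg : uniq t -> (forall i, i \in t -> sg i = 1 \/ sg i = -1) ->
  P (sign_event t sg) = (2^-1 ^+ size t)%:E.
Proof.
move=> ut hs.
have -> : sign_event t sg = \bigcap_(i in [set` [fset i in t]%fset]) (xi i @^-1` [set sg i]).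
  apply/seteqP; split => w /= h i; first by rewrite /= !inE; exact: h.
  by move=> it; apply: h; rewrite /= !inE.
rewrite (@xi_indep _ (fun i => [set sg i])); last by move=> i; exact: measurable_set1.
rewrite (perm_big t)/=; last first.
  by apply: uniq_perm => // i; rewrite !inE.
elim: t ut hs => [|i t IH] /=; first by rewrite big_nil expr0.
move=> /andP[_ ut] hs; rewrite big_cons IH//; last by move=> k kt; apply: hs; rewrite inE kt orbT.
rewrite exprS EFinM; congr (_ * _)%E.
by have [->|->] := hs i (mem_head _ _); have [] := xi_sign i.
Qed.

Lemma sign_ae i : P (~` (xi i @^-1` [set 1] `|` xi i @^-1` [set -1])) = 0%E.
Proof.
rewrite probability_setC; last by apply: measurableU; exact: measurable_xi_eq.
rewrite measureU; [|exact: measurable_xi_eq|exact: measurable_xi_eq|]; last first.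
  apply/seteqP; split => // w [/= -> /eqP]; rewrite -subr_eq0 opprK.
  by rewrite (_ : 1 + 1 = 2%:R)// pnatr_eq0.
have [h1 h2] := xi_sign i.
have half (a b : \bar R) : a = (2^-1 : R)%:E -> b = (2^-1 : R)%:E -> (1 - (a + b) = 0)%E.
  move=> -> ->; rewrite -EFinD; have -> : (2^-1 + 2^-1 = 1 :> R)%R by lra.
  by rewrite subrr.
exact: half.
Qed.

(** Induction on the signs still to be averaged: [t] lists those already fixed by
    the event. Each step splits the event according to one more sign, the values
    other than [1] and [-1] forming a null set. *)
Lemma int_savg_event (G : (I -> R) -> R) s t sg : uniq (s ++ t) ->
  (forall z, 0 <= G z) -> measurable_fun setT (fun w => G (fun i => xi i w)) ->
  (forall x y, (forall i, i \in s ++ t -> x i = y i) -> G x = G y) ->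
  (forall i, i \in t -> sg i = 1 \/ sg i = -1) ->
  (\int[P]_(w in sign_event t sg) (G (fun i => xi i w))%:E =
   (2^-1 ^+ size t * savg s G sg)%:E)%E.
Proof.
move=> + G0 mG; elim: s t sg => [|i s IH] t sg /=.
  move=> ut dG hs.
  rewrite (eq_integral (fun=> (G sg)%:E)).
    rewrite integral_cst; last exact: measurable_sign_event.
    by rewrite /= prob_sign_event// -EFinM mulrC.
  by move=> w /set_mem hw; congr (_%:E); exact: dG.
move=> /andP[ist ust] dG hs.
have iNt : i \notin t by move: ist; rewrite mem_cat negb_or => /andP[].
have iNs : i \notin s by move: ist; rewrite mem_cat negb_or => /andP[].
have half a : a = 1 \/ a = -1 ->
    (\int[P]_(w in sign_event t sg `&` xi i @^-1` [set a]) (G (fun k => xi k w))%:E =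
     (2^-1 ^+ (size t).+1 * savg s G (upd sg i a))%:E)%E.
  move=> ha.
  have -> : sign_event t sg `&` xi i @^-1` [set a] = sign_event (i :: t) (upd sg i a).
    have E : upd sg i a i = a by rewrite /upd eqxx.
    rewrite sign_event_cons setIC E; congr (_ `&` _).
    apply/seteqP; split => w /= h k kt; rewrite h// /upd;
      by case: eqP kt => // ->; rewrite (negPf iNt).
  rewrite IH//.
  - by rewrite cat_uniq /= negb_or cat_uniq in ust *; move: ust iNt iNs => /and3P[-> -> ->] -> ->.
  - move=> x y h; apply: dG => k hk; apply: h.
    by move: hk; rewrite !(inE, mem_cat) => /or3P[]->; rewrite ?orbT.
  - move=> k; rewrite inE /upd; case: eqP => //= _; exact: hs.
have mD a : measurable (sign_event t sg `&` xi i @^-1` [set a]).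
  by apply: measurableI; [exact: measurable_sign_event|exact: measurable_xi_eq].
have mGE D : measurable_fun D (fun w => (G (fun k => xi k w))%:E).
  by apply/measurable_EFinP; apply: measurable_funTS.
pose N := ~` (xi i @^-1` [set 1] `|` xi i @^-1` [set -1]).
have mN : measurable N by apply/measurableC/measurableU; exact: measurable_xi_eq.
have -> : sign_event t sg = (sign_event t sg `&` xi i @^-1` [set 1] `|`
     sign_event t sg `&` xi i @^-1` [set -1]) `|` (sign_event t sg `&` N).
  by rewrite -!setIUr /N setUv setIT.
have mNt : measurable (sign_event t sg `&` N).
  by apply: measurableI => //; exact: measurable_sign_event.
have G0E w : (0 <= (G (fun k => xi k w))%:E)%E by rewrite lee_fin.
have dN : [disjoint sign_event t sg `&` xi i @^-1` [set 1] `|`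
     sign_event t sg `&` xi i @^-1` [set -1] & sign_event t sg `&` N].
  by apply/disj_setPLR => w [[_ h1]|[_ h1]] [_] /=; apply; [left|right].
have d1 : [disjoint sign_event t sg `&` xi i @^-1` [set 1] &
     sign_event t sg `&` xi i @^-1` [set -1]].
  apply/disj_setPLR => w [_ /= ->] [_] /= /eqP; rewrite -subr_eq0 opprK.
  by rewrite (_ : 1 + 1 = 2%:R)// pnatr_eq0.
rewrite ge0_integral_setU; [|exact: measurableU|exact: mNt|exact: mGE|by []|exact: dN].
have N0 : P (sign_event t sg `&` N) = 0%E.
  by apply: subset_measure0 (sign_ae i) => //; exact: subIsetr.
rewrite [X in (_ + X)%E](null_set_integral mNt (mGE _) N0).
rewrite adde0 ge0_integral_setU; [|exact: mD|exact: mD|exact: mGE|by []|exact: d1].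
rewrite half; last by left.
rewrite half; last by right.
by rewrite -EFinD exprS; congr (_%:E); field.
Qed.

Lemma int_savg (G : (I -> R) -> R) s x : uniq s ->
  (forall z, 0 <= G z) -> measurable_fun setT (fun w => G (fun i => xi i w)) ->
  (forall y z, (forall i, i \in s -> y i = z i) -> G y = G z) ->
  (\int[P]_w (G (fun i => xi i w))%:E = (savg s G x)%:E)%E.
Proof.
move=> us G0 mG dG.
have := @int_savg_event G s [::] x; rewrite cats0 expr0 mul1r => <- //.
by congr (integral _ _ _); apply/seteqP; split.
Qed.

Lemma prob_savg (D : set (I -> R)) s x : uniq s ->
  measurable [set w | D (fun i => xi i w)] ->
  (forall y z, (forall i, i \in s -> y i = z i) -> D y -> D z) ->
  (P [set w | D (fun i => xi i w)] = (savg s (\1_D) x)%:E)%E.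
Proof.
move=> us mD dD.
pose D' := [set w | D (fun i => xi i w)].
have E w : \1_D' w = \1_D (fun i => xi i w) :> R.
  by rewrite !indicE; congr (nat_of_bool _)%:R; apply/idP/idP => /set_mem h; apply/mem_set.
rewrite -[X in _ = X](@int_savg (\1_D) s x us).
- under eq_integral do rewrite -E.
  by rewrite integral_indic// setIT.
- by move=> z; rewrite indicE ler0n.
- apply: (eq_measurable_fun (\1_D' : W -> R)); first by move=> w _; exact: E.
  exact: measurable_indic.
- move=> y z yz; rewrite !indicE; congr (nat_of_bool _)%:R.
  apply/idP/idP => /set_mem Dy; apply/mem_set; first exact: dD Dy.
  by apply: dD Dy => i /yz.
Qed.

End SignExpectation.

Section SignAverageProduct.
Context {R : realType} {I J : eqType}.
Implicit Types (G : (I -> R) -> R) (s : seq I).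

Definition depends_on s (T : Type) (G : (I -> R) -> T) : Prop :=
  forall y z, (forall i, i \in s -> y i = z i) -> G y = G z.

Lemma savg_dep s G : depends_on s G -> forall x y, savg s G x = savg s G y.
Proof.
move=> dG.
suff H t x y : (forall i, i \in s -> i \notin t -> x i = y i) -> savg t G x = savg t G y.
  by move=> x y; apply: H => i ->.
elim: t x y => [|i t IH] x y h /=; first by apply: dG => i si; exact: h.
congr ((_ + _) / 2); apply: IH => k ks kt; rewrite /upd; case: eqP => // /eqP ki;
  by apply: h => //; rewrite inE negb_or ki.
Qed.

(** Fubini's theorem for the cube: each factor depends on its own group of signs. *)
Lemma savg_prod (blk : J -> seq I) (e : seq J) (G : J -> (I -> R) -> R) x :
  uniq e -> (forall j k i, i \in blk j -> i \in blk k -> j = k) ->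
  (forall j, depends_on (blk j) (G j)) ->
  savg (flatten [seq blk j | j <- e]) (fun z => \prod_(j <- e) G j z) x =
  \prod_(j <- e) savg (blk j) (G j) x.
Proof.
move=> + dblk dG; elim: e x => [|j e IH] x /=; first by move=> _; rewrite !big_nil.
move=> /andP[je ue]; rewrite savg_cat big_cons -IH//.
set H := fun z => \prod_(k <- e) G k z.
have dH : depends_on (flatten [seq blk k | k <- e]) H.
  move=> y z yz; rewrite /H !big_seq; apply: eq_bigr => k ke; apply: dG => i ik.
  by apply: yz; apply/flattenP; exists (blk k) => //; exact: map_f.
under eq_savg => z hz.
  rewrite (_ : savg _ _ z = G j z * savg (flatten [seq blk k | k <- e]) H x).
    over.
  rewrite (savg_dep dH x z) -savgZ; apply: eq_savg => y hy.
  rewrite big_cons; congr (_ * _); apply: dG => i ij; apply: hy.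
  apply/negP => /flattenP[_ /mapP[k ke ->]] ik.
  by move: je; rewrite (dblk _ _ _ ij ik) ke.
rewrite -[RHS]mulrC -savgZ; apply: eq_savg => z _; exact: mulrC.
Qed.

End SignAverageProduct.

Section BlockSums.
Context {R : realType} {d : measure_display} {W : measurableType d}.
Variable P : probability W R.
Context {J : countType}.
Variable xi : J -> nat -> {RV P >-> R}.
Hypothesis xi_signs : independent_signs xi.

Let xi2 (ja : J * nat) : {RV P >-> R} := xi ja.1 ja.2.
Let xi2_indep : mutually_independent xi2. Proof. by case: xi_signs. Qed.
Let xi2_sign ja : P (xi2 ja @^-1` [set 1]) = (2^-1)%:E /\
                  P (xi2 ja @^-1` [set -1]) = (2^-1)%:E.
Proof. by case: xi_signs => _; apply. Qed.

Definition blk (N : nat) (j : J) : seq (J * nat) := [seq (j, a) | a <- iota 0 N].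

Lemma mem_blk N j i : (i \in blk N j) = (i.1 == j) && (i.2 < N)%N.
Proof.
apply/mapP/andP => [[a + ->]|[/eqP <- lt]]; first by rewrite mem_iota /= eqxx.
by exists i.2; rewrite ?mem_iota//; case: i lt.
Qed.

Lemma blk_uniq N j : uniq (blk N j).
Proof. by rewrite map_inj_uniq ?iota_uniq// => a b []. Qed.

Definition Sfun (N : nat) (j : J) (z : J * nat -> R) : R :=
  (Num.sqrt N%:R)^-1 * \sum_(a < N) z (j, a : nat).

Lemma Sfun_dep N j : depends_on (blk N j) (Sfun N j).
Proof.
move=> y z yz; rewrite /Sfun; congr (_ * _); apply: eq_bigr => a _; apply: yz.
by rewrite mem_blk /= eqxx ltn_ord.
Qed.

Lemma Sfun_blk N j z : Sfun N j z = (Num.sqrt N%:R)^-1 * \sum_(i <- blk N j) z i.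
Proof. by rewrite /Sfun big_map -[X in iota 0 X]subn0 -/(index_iota 0 N) big_mkord. Qed.

Lemma measurable_block_sum j N : measurable_fun setT (block_sum xi j N).
Proof.
apply: measurable_funM => //; apply: measurable_sum => a; exact: measurable_funPT.
Qed.

Definition block_rv (N : nat) (j : J) : {RV P >-> R} :=
  mfun_Sub (mem_set (measurable_block_sum j N)).

Lemma block_prob N j (B : set R) x : measurable B ->
  P (block_rv N j @^-1` B) = (savg (blk N j) (\1_[set z | B (Sfun N j z)]) x)%:E.
Proof.
move=> mB.
have := @prob_savg _ _ _ P _ xi2 xi2_indep xi2_sign [set z | B (Sfun N j z)] (blk N j) x.
apply; first exact: blk_uniq.
- exact: (measurable_funPTI (block_rv N j)).
- by move=> y z yz /=; rewrite (Sfun_dep yz).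
Qed.

(** The joint probability is an average over all signs of the blocks involved,
    which factorises because the blocks are disjoint. *)
Lemma block_indep N : mutually_independent (block_rv N).
Proof.
move=> F B mB.
pose D := [set z | forall j, j \in F -> B j (Sfun N j z)].
have -> : \bigcap_(j in [set` F]) (block_rv N j @^-1` B j) =
    [set w | D (fun i => xi2 i w)].
  by apply/seteqP; split => w h j jF; exact: (h j jF).
have dblk j k i : i \in blk N j -> i \in blk N k -> j = k.
  by rewrite !mem_blk => /andP[/eqP <- _] /andP[/eqP <- _].
have dB j : depends_on (blk N j) (\1_[set z | B j (Sfun N j z)] : _ -> R).
  move=> y z yz; rewrite !indicE; congr (nat_of_bool _)%:R.
  by apply/idP/idP => /set_mem /= h; apply/mem_set => /=; move: h; rewrite (Sfun_dep yz).
pose x : J * nat -> R := fun=> 0.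
rewrite (@prob_savg _ _ _ P _ xi2 xi2_indep xi2_sign D
   (flatten [seq blk N j | j <- F]) x).
- rewrite (eq_bigr (fun j => (savg (blk N j) (\1_[set z | B j (Sfun N j z)]) x)%:E)).
    rewrite prodEFin -(savg_prod x (fset_uniq F) dblk dB).
    congr EFin; apply: eq_savg => z _.
    rewrite indicE; case: (boolP (z \in D)) => [/set_mem Dz|/negP Dz].
      by rewrite big_seq big1// => j jF; rewrite indicE mem_set//=; exact: Dz.
    apply/esym/eqP; rewrite prodf_seq_eq0.
    apply: contrapT => /negP/hasPn h; apply: Dz; apply/mem_set => j jF.
    by have := h j jF; rewrite /= indicE; case: (boolP (_ \in _)) => [/set_mem//|]; rewrite eqxx.
  by move=> j _; exact: block_prob.
- elim: {D} (F : seq J) (fset_uniq F) => //= j e IH /andP[je ue].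
  rewrite cat_uniq blk_uniq IH// andbT; apply/hasPn => i /flattenP[_ /mapP[k ke ->]] ik.
  by apply/negP => ij; move: je; rewrite (dblk _ _ _ ij ik) ke.
- have -> : [set w | D (fun i => xi2 i w)] = \bigcap_(j in [set` F]) (block_rv N j @^-1` B j).
    by apply/seteqP; split => w h j jF; exact: (h j jF).
  apply: fin_bigcap_measurable => // j _; exact: measurable_funPTI.
- move=> y z yz Dy j jF; have := Dy j jF; rewrite (Sfun_dep (z := z))// => i ij.
  by apply: yz; apply/flattenP; exists (blk N j) => //; exact: map_f.
Qed.

Lemma block_clt j (A B : set R) (e eta : R) : measurable A -> measurable B ->
  0 < e -> 0 < eta -> (forall m y, A m -> `|y - m| < e -> B y) ->
  \forall N \near \oo, (P (block_rv N j @^-1` A) <= (gauss_prob 0 1 B + eta)%:E)%E.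
Proof.
move=> mA mB e0 eta0 AB.
have H := clt_upper mB e0 eta0 AB.
near=> N.
have HN : forall (I : eqType) (l : seq I) (x : I -> R), uniq l -> size l = N ->
    savg l (fun z => \1_A ((Num.sqrt N%:R)^-1 * \sum_(i <- l) z i)) x <= gauss_prob 0 1 B + eta.
  by near: N; exact: H.
rewrite (@block_prob N j A (fun=> 0))// lee_fin.
apply: le_trans (HN _ (blk N j) (fun=> 0) (blk_uniq N j) _); last by rewrite size_map size_iota.
apply: le_savg => z _; rewrite -Sfun_blk !indicE.
by rewrite (_ : (z \in _) = (Sfun N j z \in A))//; apply/idP/idP => /set_mem h; apply/mem_set.
Unshelve. all: by end_near. Qed.

End BlockSums.

(** * Geometry of a separable Hilbert space *)

Local Open Scope complex_scope.

Section HilbertGeometry.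
Context {R : realType}.
Variable E : sepHilbert R.
Local Notation d := (hil_dot E).
Local Notation e := (@hil_basis R E).
Implicit Types (x y : E) (z : R[i]).

Definition cabs z : R := complex.Re `|z|.

Lemma cabsE z : (cabs z)%:C = `|z|.
Proof.
rewrite /cabs; have := normr_ge0 z; case: `|z| => a b.
by rewrite lecE /= => /andP[/eqP -> _].
Qed.

Lemma cabs_ge0 z : 0 <= cabs z.
Proof. by rewrite -lecR cabsE normr_ge0. Qed.

Lemma cabsM z z' : cabs (z * z') = cabs z * cabs z'.
Proof. by apply/complexI; rewrite rmorphM/= !cabsE normrM. Qed.

Lemma cabsD z z' : cabs (z + z') <= cabs z + cabs z'.
Proof. by rewrite -lecR rmorphD/= !cabsE ler_normD. Qed.

Lemma cabs_real (r : R) : cabs r%:C = `|r|.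
Proof. by apply/complexI; rewrite cabsE normc_def/= expr0n/= addr0 sqrtr_sqr. Qed.

Lemma cabs_conj z : cabs (Num.conj z) = cabs z.
Proof. by apply/complexI; rewrite !cabsE norm_conjC. Qed.

Lemma cabs_sqr z : (cabs z ^+ 2)%:C = z * Num.conj z.
Proof. by rewrite rmorphXn/= cabsE normCK. Qed.

Lemma cabs_eq0 z : cabs z = 0 -> z = 0.
Proof. by move=> h; apply/eqP; rewrite -normr_eq0 -cabsE h. Qed.

Lemma hil_normZc z x : hil_norm (z *: x) = cabs z * hil_norm x.
Proof. exact: hil_normZ. Qed.

Lemma hil_sqr x : (hil_norm x ^+ 2)%:C = d x x.
Proof. by rewrite rmorphXn/= hil_norm_complex hil_normE. Qed.

Lemma dotC x y : d x y = Num.conj (d y x).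
Proof. by rewrite hermC/= expr0 mul1r. Qed.

Lemma dot_basis i j : d (e i) (e j) = (i == j)%:R.
Proof. exact: hil_orthonormal. Qed.

Lemma hil_norm0 : hil_norm (0 : E) = 0.
Proof. by rewrite /hil_norm normr0. Qed.

Lemma hil_normN x : hil_norm (- x) = hil_norm x.
Proof. by rewrite /hil_norm normrN. Qed.

Lemma hil_norm_eq0 x : hil_norm x = 0 -> x = 0.
Proof. by move=> h; apply/eqP; rewrite -normr_eq0 -hil_norm_complex h. Qed.

Lemma hil_approx1 x u z : d u u = 1 ->
  hil_norm (x - z *: u) ^+ 2 = hil_norm x ^+ 2 - cabs (d x u) ^+ 2 + cabs (d x u - z) ^+ 2.
Proof.
move=> u1; apply/complexI; rewrite rmorphD rmorphB/= !hil_sqr !cabs_sqr.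
rewrite linearBl/= !linearBr/= linearZl_LR linearZr_LR/= linearZlr/=.
by rewrite /= u1 (dotC u x) rmorphB/=; ring.
Qed.

(** The Pythagorean identity from which Bessel's inequality, the norm of a finite
    combination and the optimality of Fourier coefficients are all read off. *)
Lemma hil_approx (F : seq (hil_idx E)) x (b : hil_idx E -> R[i]) : uniq F ->
  hil_norm (x - \sum_(i <- F) b i *: e i) ^+ 2 =
  hil_norm x ^+ 2 - \sum_(i <- F) cabs (d x (e i)) ^+ 2
    + \sum_(i <- F) cabs (d x (e i) - b i) ^+ 2.
Proof.
elim: F x => [|i F IH] x /=; first by rewrite !big_nil !subr0 addr0.
move=> /andP[iF uF]; rewrite !big_cons opprD addrA IH//.
rewrite hil_approx1 ?dot_basis ?eqxx//.
have dE k : k \in F -> d (x - b i *: e i) (e k) = d x (e k).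
  move=> kF; rewrite linearBl/= linearZl_LR/= dot_basis.
  case: eqP => [ik|_]; last by rewrite mulr0 subr0.
  by move: iF; rewrite ik kF.
rewrite [in X in _ - X + _]big_seq [in X in _ - _ + X]big_seq.
under eq_bigr => k kF do rewrite dE//.
under [in X in _ - _ + X]eq_bigr => k kF do rewrite dE//.
by rewrite -!big_seq; ring.
Qed.

Lemma bessel (F : seq (hil_idx E)) x : uniq F ->
  \sum_(i <- F) cabs (d x (e i)) ^+ 2 <= hil_norm x ^+ 2.
Proof.
move=> uF; have := hil_approx x (fun i => d x (e i)) uF.
rewrite [X in _ = _ - _ + X]big1 ?addr0 => [h|i _]; last by rewrite subrr /cabs normr0 expr0n.
by rewrite -subr_ge0 -h sqr_ge0.
Qed.

Lemma hil_norm_sum (F : seq (hil_idx E)) (b : hil_idx E -> R[i]) : uniq F ->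
  hil_norm (\sum_(i <- F) b i *: e i) ^+ 2 = \sum_(i <- F) cabs (b i) ^+ 2.
Proof.
move=> uF; have := hil_approx 0 b uF.
rewrite sub0r hil_normN hil_norm0 expr0n/= sub0r => ->.
rewrite [X in - X + _]big1; last by move=> i _; rewrite linear0l /cabs normr0 expr0n.
rewrite oppr0 add0r; apply: eq_bigr => i _.
by rewrite linear0l sub0r /cabs normrN.
Qed.

Lemma cauchy_schwarz x y : cabs (d x y) <= hil_norm x * hil_norm y.
Proof.
have [->|y0] := eqVneq y 0; first by rewrite linear0r /cabs normr0 mulr_ge0 ?hil_norm_ge0.
have ny : 0 < hil_norm y.
  rewrite lt_def hil_norm_ge0 andbT; apply: contra_neq y0; exact: hil_norm_eq0.
pose u := ((hil_norm y)^-1)%:C *: y.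
have u1 : d u u = 1.
  rewrite -hil_sqr hil_normZc cabs_real ger0_norm ?invr_ge0 ?hil_norm_ge0//.
  by rewrite mulVf ?gt_eqF// expr1n.
have := hil_approx1 x (d x u) u1.
rewrite subrr [cabs 0]/cabs normr0 expr0n/= addr0 => h.
have : cabs (d x u) ^+ 2 <= hil_norm x ^+ 2 by rewrite -subr_ge0 -h sqr_ge0.
rewrite ler_sqr ?nnegrE ?cabs_ge0 ?hil_norm_ge0//.
rewrite /u linearZr_LR/= cabsM cabs_conj cabs_real ger0_norm ?invr_ge0 ?hil_norm_ge0//.
by rewrite mulrC ler_pdivrMr.
Qed.

(** A finite combination of basis vectors near [x] exists by totality of the
    basis; Fourier coefficients do at least as well as its own coefficients. *)
Lemma parseval_approx x (eps : R) : 0 < eps -> exists F : {fset hil_idx E},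
  forall G : {fset hil_idx E}, (F `<=` G)%fset ->
  hil_norm x ^+ 2 <= \sum_(i <- G) cabs (d x (e i)) ^+ 2 + eps.
Proof.
move=> e0.
pose r := Num.sqrt eps.
have r0 : 0 < r by rewrite sqrtr_gt0.
have := @hil_total R E [set y | `|x - y| < r%:C].
case.
- by exists x => /=; rewrite subrr normr0 ltcR.
- have -> : [set y | `|x - y| < r%:C] = ball x r%:C by rewrite -ball_normE.
  by apply: ball_open; rewrite ltcR.
move=> y [/= h0 [F [c yE]]]; move: h0; rewrite yE -hil_norm_complex ltcR => h.
exists F => G FG; pose b i := if i \in F then c i else 0.
have bE : \sum_(i <- F) c i *: e i = \sum_(i <- G) b i *: e i.
  rewrite [RHS](big_fsetID _ (mem F))/= [X in _ + X]big1_seq ?addr0; last first.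
    by move=> i /= ; rewrite !inE /b => /andP[_ /negPf ->]; rewrite scale0r.
  have -> : [fset i | i in G & i \in F]%fset = F.
    apply/fsetP => i; rewrite !inE/=; case: (boolP (i \in F)); rewrite ?andbF// => iF.
    by rewrite (fsubsetP FG).
  by apply: eq_fbigr => i iF _; rewrite /b iF.
have h2 : hil_norm (x - \sum_(i <- G) b i *: e i) ^+ 2 <= eps.
  have re : r ^+ 2 = eps by rewrite sqr_sqrtr// ltW.
  rewrite -bE -[leRHS]re ler_sqr ?nnegrE ?hil_norm_ge0 ?(ltW r0)//.
  exact: ltW.
have := hil_approx x b (fset_uniq G).
have : 0 <= \sum_(i <- G) cabs (d x (e i) - b i) ^+ 2 by apply: sumr_ge0 => i _; rewrite sqr_ge0.
lra.
Qed.

Lemma hil_parallelogram x y :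
  hil_norm (x + y) ^+ 2 + hil_norm (x - y) ^+ 2 = 2 * hil_norm x ^+ 2 + 2 * hil_norm y ^+ 2.
Proof.
rewrite !(mulr_natl _ 2) !mulr2n.
apply/complexI; rewrite !rmorphD/= !hil_sqr.
by rewrite !linearDl/= !linearDr/= !linearNl/= !linearNr/=; ring.
Qed.

End HilbertGeometry.

(** * Hilbert--Schmidt operators: norm bounds and completeness *)

Section RealSums.
Context {R : realType}.

Lemma sum_cauchy_schwarz (I : Type) (s : seq I) (a b : I -> R) :
  (forall i, 0 <= a i) -> (forall i, 0 <= b i) ->
  \sum_(i <- s) a i * b i <=
  Num.sqrt (\sum_(i <- s) a i ^+ 2) * Num.sqrt (\sum_(i <- s) b i ^+ 2).
Proof.
move=> a0 b0; elim: s => [|i s IH]; first by rewrite !big_nil mulr_ge0 ?sqrtr_ge0.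
rewrite !big_cons; set A := \sum_(_ <- _) a _ ^+ 2; set B := \sum_(_ <- _) b _ ^+ 2.
have A0 : 0 <= A by apply: sumr_ge0 => j _; rewrite sqr_ge0.
have B0 : 0 <= B by apply: sumr_ge0 => j _; rewrite sqr_ge0.
apply: le_trans (lerD (lexx _) IH) _; rewrite -/A -/B.
set p := Num.sqrt A; set q := Num.sqrt B.
have pA : p ^+ 2 = A by rewrite sqr_sqrtr.
have qB : q ^+ 2 = B by rewrite sqr_sqrtr.
have p0 : 0 <= p by rewrite sqrtr_ge0.
have q0 : 0 <= q by rewrite sqrtr_ge0.
rewrite -sqrtrM; last by rewrite addr_ge0 ?sqr_ge0.
rewrite -[leLHS]ger0_norm; last by rewrite addr_ge0 ?mulr_ge0.
rewrite -sqrtr_sqr ler_sqrt; last by rewrite mulr_ge0 ?addr_ge0 ?sqr_ge0.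
rewrite -pA -qB -subr_ge0.
rewrite (_ : _ - _ = (a i * q - b i * p) ^+ 2); last by ring.
exact: sqr_ge0.
Qed.

(** The order of the complex numbers makes positive elements real. *)
Lemma gt0_complex (z : R[i]) : 0 < z -> exists2 r : R, 0 < r & z = r%:C.
Proof.
by case: z => a b; rewrite ltcE /= => /andP[/eqP -> a0]; exists a.
Qed.

End RealSums.

Section HilbertSpaceTopology.
Context {R : realType} {E : sepHilbert R}.
Implicit Types (x y : E).

Lemma hil_cvgP (u : nat -> E) x :
  u n @[n --> \oo] --> x <-> hil_norm (u n - x) @[n --> \oo] --> (0 : R).
Proof.
split=> [/cvgrPdist_lt h|/cvgrPdist_lt h].
  apply/cvgrPdist_lt => eps e0.
  have := h eps%:C; rewrite ltcR => /(_ e0); apply: filterS => n.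
  rewrite -hil_norm_complex ltcR sub0r normrN ger0_norm ?hil_norm_ge0//.
  by rewrite -[x - _]opprB hil_normN.
apply/cvgrPdist_lt => _ /gt0_complex[eps e0 ->].
have := h eps e0; apply: filterS => n.
rewrite -hil_norm_complex ltcR sub0r normrN ger0_norm ?hil_norm_ge0//.
by rewrite -[x - _]opprB hil_normN.
Qed.

Lemma hil_norm_dist x y : `|hil_norm x - hil_norm y| <= hil_norm (x - y).
Proof.
rewrite ler_norml lerNl opprB !lerBlDr; apply/andP; split.
  by rewrite -(opprB y) hil_normN -[X in hil_norm X <= _](subrK x) hil_normD.
by rewrite -[X in hil_norm X <= _](subrK y) hil_normD.
Qed.

Lemma hil_norm_cvg (u : nat -> E) x :
  u n @[n --> \oo] --> x -> hil_norm (u n) @[n --> \oo] --> hil_norm x.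
Proof.
move=> /hil_cvgP/cvgrPdist_lt h; apply/cvgrPdist_lt => eps e0.
apply: filterS (h _ e0) => n; rewrite sub0r normrN ger0_norm ?hil_norm_ge0//.
by rewrite distrC; apply: le_lt_trans; exact: hil_norm_dist.
Qed.

Lemma hil_complete (u : nat -> E) :
  (forall eps : R, 0 < eps -> exists N, forall m n, (N <= m)%N -> (N <= n)%N ->
     hil_norm (u m - u n) <= eps) ->
  exists x, hil_norm (u n - x) @[n --> \oo] --> (0 : R).
Proof.
move=> H.
have cu : cauchy (u n @[n --> \oo]).
  apply: cauchy_exP => _ /gt0_complex[eps e0 ->].
  have [|N HN] := H (eps / 2); first by rewrite divr_gt0.
  exists (u N); exists N => // n /= Nn.
  rewrite -ball_normE /ball_ /= -hil_norm_complex ltcR.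
  by apply: le_lt_trans (HN _ _ (leqnn N) Nn) _; lra.
by exists (lim (u n @[n --> \oo])); apply/hil_cvgP; exact: cauchy_cvg.
Qed.

Lemma hil_bounded_continuous (S : {linear E -> E}) (M : R) :
  (forall x, hil_norm (S x) <= M * hil_norm x) -> continuous S.
Proof.
move=> H; apply/linear_bounded_continuous/linear_boundedP.
have M'0 : 0 <= Num.max M 0 by rewrite le_max lexx orbT.
exists (Num.max M 0)%:C; split; first by rewrite ger0_real// lecR.
move=> r Mr x; rewrite -!hil_norm_complex.
have [r' r'0 rE] : exists2 r' : R, 0 < r' & r = r'%:C.
  by apply: gt0_complex; apply: le_lt_trans Mr; rewrite lecR.
rewrite rE -rmorphM/= lecR; apply: le_trans (H x) _; apply: ler_wpM2r; first exact: hil_norm_ge0.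
by move: Mr; rewrite rE ltcR gt_max => /andP[/ltW].
Qed.

End HilbertSpaceTopology.

Section HilbertSchmidtGeometry.
Context {R : realType} {E : sepHilbert R}.
Local Notation d := (hil_dot E).
Local Notation e := (@hil_basis R E).
Local Notation idx := (hil_idx E).
Implicit Types (S T U : hs_op E) (x y : E).

Lemma hs_sum_fset (T : E -> E) (F : {fset idx}) :
  ((\sum_(i <- F) hil_norm (T (e i)) ^+ 2)%:E <= hs_sum T)%E.
Proof.
apply: esum_ge; exists [set` F]; first by split => //; exact: finite_fset.
rewrite fsbig_finite ?set_fsetK; last exact: finite_fset.
by rewrite sumEFin.
Qed.

Lemma hs_sum_ub (T : E -> E) (M : R) :
  (forall F : {fset idx}, \sum_(i <- F) hil_norm (T (e i)) ^+ 2 <= M) ->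
  (hs_sum T <= M%:E)%E.
Proof.
move=> H; apply: ge_ereal_sup => _ [X [finX _] <-].
by rewrite fsbig_finite// sumEFin lee_fin.
Qed.

Lemma hs_norm_fset T (F : {fset idx}) :
  \sum_(i <- F) hil_norm (T (e i)) ^+ 2 <= hs_norm T ^+ 2.
Proof. by rewrite -lee_fin hs_norm_sqr; exact: hs_sum_fset. Qed.

Lemma hs_norm_sqr_ub T (M : R) :
  (forall F : {fset idx}, \sum_(i <- F) hil_norm (T (e i)) ^+ 2 <= M) ->
  hs_norm T ^+ 2 <= M.
Proof. by move=> H; rewrite -lee_fin hs_norm_sqr; exact: hs_sum_ub. Qed.

Lemma hs_norm_ub T (M : R) : 0 <= M ->
  (forall F : {fset idx}, \sum_(i <- F) hil_norm (T (e i)) ^+ 2 <= M ^+ 2) ->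
  hs_norm T <= M.
Proof.
by move=> M0 /hs_norm_sqr_ub; rewrite ler_sqr ?nnegrE ?hs_norm_ge0.
Qed.

Lemma hs_norm0 : hs_norm (0 : hs_op E) = 0.
Proof. by apply/complexI; rewrite -hs_normE normr0. Qed.

Lemma hs_normN T : hs_norm (- T) = hs_norm T.
Proof. by apply/complexI; rewrite -!hs_normE normrN. Qed.

Lemma hs_normZc (z : R[i]) T : hs_norm (z *: T) = cabs z * hs_norm T.
Proof. exact: hs_normZ. Qed.

Lemma hs_normBC S T : hs_norm (S - T) = hs_norm (T - S).
Proof. by rewrite -opprB hs_normN. Qed.

Lemma hs_normB_triangle S T U : hs_norm (S - U) <= hs_norm (S - T) + hs_norm (T - U).
Proof. by have -> : S - U = (S - T) + (T - U); [rewrite addrA subrK|exact: hs_normD]. Qed.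

(** The operator norm is at most the Hilbert--Schmidt norm: on finite
    combinations of basis vectors this is the Cauchy--Schwarz inequality, and
    these are dense. *)
Lemma hs_op_bound T x : hil_norm (T x) <= hs_norm T * hil_norm x.
Proof.
have fin (F : {fset idx}) (c : idx -> R[i]) :
    hil_norm (T (\sum_(i <- F) c i *: e i)) <= hs_norm T * hil_norm (\sum_(i <- F) c i *: e i).
  rewrite linear_sum/=.
  apply: (@le_trans _ _ (\sum_(i <- F) cabs (c i) * hil_norm (T (e i)))).
    elim/big_rec2 : _ => [|i u v _ h]; first by rewrite hil_norm0.
    by apply: le_trans (hil_normD _ _) _; rewrite linearZ/= hil_normZc lerD2l.
  apply: le_trans (sum_cauchy_schwarz _ _ _) _.
  - by move=> i; exact: cabs_ge0.
  - by move=> i; exact: hil_norm_ge0.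
  rewrite mulrC -hil_norm_sum ?fset_uniq// sqrtr_sqr ger0_norm ?hil_norm_ge0//.
  apply: ler_wpM2r; first exact: hil_norm_ge0.
  rewrite -[leRHS]ger0_norm ?hs_norm_ge0// -sqrtr_sqr ler_sqrt ?sqr_ge0//.
  exact: hs_norm_fset.
apply/ler_addgt0Pr => eps e0.
have n0 := hs_norm_ge0 T.
pose r := eps / (hs_norm T + 1).
have r0 : 0 < r by rewrite divr_gt0// ltr_wpDl.
have := @hil_total R E (ball x r%:C `&` T @^-1` ball (T x) r%:C).
case.
- by exists x; split; apply: ballxx; rewrite ltcR.
- apply: openI; first by apply: ball_open; rewrite ltcR.
  apply: open_comp; first by move=> y _; exact: hs_continuous.
  by apply: ball_open; rewrite ltcR.
move=> y [[]]; rewrite -ball_normE /ball_ /= -!hil_norm_complex !ltcR => h1 h2 [F [c yE]].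
have h3 := fin F c; rewrite -yE in h3.
have h4 : hil_norm (T x) <= hil_norm (T x - T y) + hil_norm (T y).
  by rewrite -[X in hil_norm X <= _](subrK (T y)) hil_normD.
have h5 : hil_norm y <= hil_norm (x - y) + hil_norm x.
  by rewrite -[X in hil_norm X <= _](subrK x) -[X in _ <= X + _]hil_normN opprB hil_normD.
have rE : hs_norm T * r + r = eps.
  by rewrite -[X in _ + X]mul1r -mulrDl /r mulrC divfK// gt_eqF// ltr_wpDl.
have := ler_wpM2l n0 h5; have := ler_wpM2l n0 (ltW h1); rewrite mulrDr; lra.
Qed.

(** Summing the parallelogram identity of the Hilbert space over the basis; the
    two-point inequality below rests on it. *)
Lemma hs_parallelogram S T :
  hs_norm (S + T) ^+ 2 + hs_norm (S - T) ^+ 2 = 2 * hs_norm S ^+ 2 + 2 * hs_norm T ^+ 2.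
Proof.
rewrite !(mulr_natl _ 2) !mulr2n.
apply: EFin_inj; rewrite !EFinD !hs_norm_sqr /hs_sum.
have ge0 (U : hs_op E) i : (0 <= (hil_norm (U (e i)) ^+ 2)%:E)%E by rewrite lee_fin sqr_ge0.
rewrite -!esumD//.
- apply: eq_esum => i _; rewrite -!EFinD; congr EFin.
  have := hil_parallelogram (S (e i)) (T (e i)).
  by rewrite !(mulr_natl _ 2) !mulr2n.
- by move=> i _; rewrite adde_ge0.
- by move=> i _; rewrite adde_ge0.
Qed.

Lemma hs_pred_of_bounds (S : E -> E) (M K : R) : linear S ->
  (forall x, hil_norm (S x) <= M * hil_norm x) ->
  (forall F : {fset idx}, \sum_(i <- F) hil_norm (S (e i)) ^+ 2 <= K) ->
  S \in @hs_pred R E.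
Proof.
move=> linS bS hS; apply: mem_set; split => //.
- pose S' : {linear E -> E} := HB.pack S (GRing.isLinear.Build _ _ _ _ S linS).
  exact: (@hil_bounded_continuous _ _ S' M).
- by apply: le_lt_trans (hs_sum_ub hS) _; rewrite ltry.
Qed.

(** A Cauchy sequence converges pointwise, since the operator norm is controlled.
    The limit is bounded and Hilbert--Schmidt, and it is the limit in
    Hilbert--Schmidt norm, because finite sums over the basis pass to the limit. *)
Lemma hs_complete (u : nat -> hs_op E) :
  (forall eps : R, 0 < eps -> exists N, forall m n, (N <= m)%N -> (N <= n)%N ->
     hs_norm (u m - u n) <= eps) ->
  exists T, hs_norm (u n - T) @[n --> \oo] --> (0 : R).
Proof.
move=> H.
have subE m n x : (u m - u n) x = u m x - u n x by [].
have pt x : exists y, hil_norm (u n x - y) @[n --> \oo] --> (0 : R).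
  apply: hil_complete => eps e0.
  have [|N HN] := H (eps / (hil_norm x + 1)).
    by rewrite divr_gt0// ltr_wpDl// hil_norm_ge0.
  exists N => m n Nm Nn; rewrite -subE; apply: le_trans (hs_op_bound _ _) _.
  apply: le_trans (ler_wpM2r (hil_norm_ge0 _) (HN _ _ Nm Nn)) _.
  rewrite -mulrA ler_piMr ?(ltW e0)// ler_pdivrMl ?ltr_wpDl ?hil_norm_ge0//.
  by rewrite mulr1 lerDl.
have [S HS] := choice pt.
have uS x : u n x @[n --> \oo] --> S x by apply/hil_cvgP; exact: HS.
have linS : linear S.
  move=> a x y.
  have h1 := uS (a *: x + y).
  have h2 : u n (a *: x + y) @[n --> \oo] --> a *: S x + S y.
    under eq_cvg => n do rewrite linearP.
    by apply: cvgD; [apply: cvgZr; exact: uS|exact: uS].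
  exact: (cvg_unique _ h1 h2).
(* lower semicontinuity of finite Hilbert--Schmidt sums *)
have lsc (V : hs_op E) (K : R) N (F : {fset idx}) : 0 <= K ->
    (forall n, (N <= n)%N -> hs_norm (V - u n) <= K) ->
    \sum_(i <- F) hil_norm (V (e i) - S (e i)) ^+ 2 <= K ^+ 2.
  move=> K0 HV.
  have cv : \sum_(i <- F) hil_norm (V (e i) - u n (e i)) ^+ 2 @[n --> \oo] -->
     \sum_(i <- F) hil_norm (V (e i) - S (e i)) ^+ 2.
    apply: cvg_big => [|i _]; first exact: add_continuous.
    have h : hil_norm (V (e i) - u n (e i)) @[n --> \oo]
        --> hil_norm (V (e i) - S (e i)).
      by apply: hil_norm_cvg; apply: cvgB; [exact: cvg_cst|exact: uS].
    by rewrite expr2; under eq_cvg => n do rewrite expr2; exact: cvgM.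
  apply: (cvgr_to_le cv); exists N => // n /= Nn.
  apply: le_trans (hs_norm_fset (V - u n) F) _.
  by rewrite ler_sqr ?nnegrE ?hs_norm_ge0 ?HV.
have lsn (V : hs_op E) (K : R) N x : 0 <= K ->
    (forall n, (N <= n)%N -> hs_norm (V - u n) <= K) ->
    hil_norm (V x - S x) <= K * hil_norm x.
  move=> K0 HV.
  have h : hil_norm (V x - u n x) @[n --> \oo] --> hil_norm (V x - S x).
    by apply: hil_norm_cvg; apply: cvgB; [exact: cvg_cst|exact: uS].
  apply: (cvgr_to_le h); exists N => // n /= Nn.
  apply: le_trans (hs_op_bound (V - u n) x) _.
  by apply: ler_wpM2r; [exact: hil_norm_ge0|exact: HV].
have [//|N0 HN0] := H 1.
have hsS : S \in @hs_pred R E.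
  have V1 n : (N0 <= n)%N -> hs_norm (u N0 - u n) <= 1 by move=> h; exact: HN0.
  apply: (@hs_pred_of_bounds S (hs_norm (u N0) + 1) (2 * hs_norm (u N0) ^+ 2 + 2)) => //.
    move=> x; have h1 := lsn _ 1 N0 x ler01 V1.
    have h2 := hs_op_bound (u N0) x.
    have h3 : hil_norm (S x) <= hil_norm (u N0 x - S x) + hil_norm (u N0 x).
      by rewrite -[X in hil_norm X <= _](subrK (u N0 x)) -(opprB (S x)) hil_normN hil_normD.
    by rewrite mulrDl; lra.
  move=> F; have h1 := lsc _ 1 N0 F ler01 V1.
  have h2 := hs_norm_fset (u N0) F.
  apply: (@le_trans _ _ (2 * \sum_(i <- F) hil_norm (u N0 (e i)) ^+ 2 + 2 * \sum_(i <- F) hil_norm (u N0 (e i) - S (e i)) ^+ 2)); last first.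
    by rewrite expr1n in h1; lra.
  rewrite !big_distrr/= -big_split/=; apply: ler_sum => i _.
  have h3 : hil_norm (S (e i)) <= hil_norm (u N0 (e i) - S (e i)) + hil_norm (u N0 (e i)).
    by rewrite -[X in hil_norm X <= _](subrK (u N0 (e i))) -(opprB (S (e i))) hil_normN hil_normD.
  have := hil_norm_ge0 (S (e i)); move: h3.
  set a := hil_norm _; set b := hil_norm _; set c := hil_norm _ => h3 a0.
  have : a ^+ 2 <= (b + c) ^+ 2 by rewrite ler_sqr ?nnegrE// (le_trans a0).
  by have := sqr_ge0 (b - c); nra.
exists (HsOp hsS); apply/cvgrPdist_le => eps e0.
have [N HN] := H eps e0; exists N => // n /= Nn.
rewrite sub0r normrN ger0_norm ?hs_norm_ge0//.
apply: hs_norm_ub; first exact: ltW.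
move=> F; apply: (lsc _ eps N F (ltW e0)) => m Nm.
exact: HN.
Qed.

End HilbertSchmidtGeometry.

(** * Finite rank operators, adjoints and separability *)

Section FiniteRank.
Context {R : realType} {E : sepHilbert R}.
Local Notation d := (hil_dot E).
Local Notation e := (@hil_basis R E).
Local Notation idx := (hil_idx E).
Implicit Types (S T U : hs_op E) (x y : E).

Lemma rank1_sum (i : idx) (v : E) (F : {fset idx}) :
  \sum_(k <- F) hil_norm (d (e k) (e i) *: v) ^+ 2 <= hil_norm v ^+ 2.
Proof.
under eq_bigr => k _ do rewrite hil_normZc exprMn.
rewrite -mulr_suml ler_piMl ?sqr_ge0//.
have n1 : hil_norm (e i) ^+ 2 = 1 by apply/complexI; rewrite hil_sqr dot_basis eqxx.
rewrite -[leRHS]n1.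
under eq_bigr => k _ do rewrite dotC cabs_conj.
exact: bessel (fset_uniq F).
Qed.

Lemma rank1P (i : idx) (v : E) : (fun x => d x (e i) *: v) \in @hs_pred R E.
Proof.
apply: (@hs_pred_of_bounds _ _ _ (hil_norm (e i) * hil_norm v) (hil_norm v ^+ 2)).
- by move=> a x y; rewrite linearPl/= scalerDl scalerA.
- move=> x; rewrite hil_normZc mulrAC; apply: ler_wpM2r; first exact: hil_norm_ge0.
  by rewrite mulrC; exact: cauchy_schwarz.
- exact: rank1_sum.
Qed.

Definition rank1 (i : idx) (v : E) : hs_op E := HsOp (rank1P i v).

Lemma rank1_norm i v : hs_norm (rank1 i v) <= hil_norm v.
Proof. by apply: hs_norm_ub => [|F]; [exact: hil_norm_ge0|exact: rank1_sum]. Qed.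

Definition finite_rank (l : seq (idx * idx * R[i])) : hs_op E :=
  \sum_(t <- l) t.2 *: rank1 t.1.1 (e t.1.2).

Lemma hs_opsum_apply (I : Type) (s : seq I) (F : I -> hs_op E) x :
  (\sum_(i <- s) F i) x = \sum_(i <- s) F i x.
Proof. by elim/big_rec2: _ => // i y1 y2 _ <-. Qed.

Lemma hs_norm_sum (I : Type) (s : seq I) (F : I -> hs_op E) :
  hs_norm (\sum_(i <- s) F i) <= \sum_(i <- s) hs_norm (F i).
Proof.
elim/big_rec2: _ => [|i y1 y2 _ h]; first by rewrite hs_norm0.
by apply: le_trans (hs_normD _ _) _; rewrite lerD2l.
Qed.

Lemma hs_norm_fset_approx T (eps : R) : 0 < eps -> exists F : {fset idx},
  hs_norm T ^+ 2 <= \sum_(i <- F) hil_norm (T (e i)) ^+ 2 + eps.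
Proof.
move=> e0; apply: contrapT => /forallNP H.
have : hs_norm T ^+ 2 <= hs_norm T ^+ 2 - eps.
  apply: hs_norm_sqr_ub => F; have /negP := H F.
  by rewrite -ltNge; lra.
lra.
Qed.

Lemma div_succ_mulrn_le (c : R) (n : nat) : 0 <= c -> c / n.+1%:R *+ n <= c.
Proof.
move=> c0; have -> : c / n.+1%:R *+ n = c * (n%:R / n.+1%:R) by rewrite -mulrnAr mulr_natl.
by rewrite ler_piMr// ler_pdivrMr// mul1r ler_nat.
Qed.

Lemma fset_cut (F G : {fset idx}) (a : idx -> R) : (forall i, 0 <= a i) ->
  \sum_(i <- G) (if i \in F then 0 else a i) + \sum_(i <- F) a i <= \sum_(i <- (F `|` G)%fset) a i.
Proof.
move=> a0; rewrite [leRHS](big_fsetID _ (mem F))/= addrC.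
have -> : [fset x in F `|` G | x \in F]%fset = F.
  by apply/fsetP => i; rewrite !inE/=; case: (i \in F); rewrite ?andbF.
apply: lerD => //; rewrite [leLHS](big_fsetID _ (mem F))/= [X in X + _ <= _]big1_seq ?add0r; last first.
  by move=> i /=; rewrite !inE => /andP[_ ->].
have -> : [fset x in F `|` G | x \notin F]%fset = [fset x in G | x \notin F]%fset.
  by apply/fsetP => i; rewrite !inE/=; case: (i \in F); rewrite ?andbF ?andbT.
rewrite big_seq [leRHS]big_seq; apply: ler_sum => i.
by rewrite !inE => /andP[_ /negPf ->].
Qed.

(** Truncate [T] to finitely many basis vectors, then approximate each of the
    finitely many columns by a combination of basis vectors. *)
Lemma finite_rank_dense T (eps : R) : 0 < eps -> exists l, hs_norm (T - finite_rank l) < eps.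
Proof.
move=> e0.
have e40 : 0 < eps / 4 by rewrite divr_gt0.
have [F HF] := hs_norm_fset_approx T (exprn_gt0 2 e40).
pose TF := \sum_(i <- F) rank1 i (T (e i)).
have TFe k : TF (e k) = if k \in F then T (e k) else 0.
  rewrite /TF hs_opsum_apply; case: ifP => kF.
    rewrite (big_fsetD1 k)//= dot_basis eqxx scale1r big1_seq ?addr0// => i /=.
    by rewrite !inE => /andP[ik _]; rewrite dot_basis eq_sym (negPf ik) scale0r.
  rewrite big1_seq// => i /= iF; rewrite dot_basis; case: eqP => [ki|_]; last by rewrite scale0r.
  by rewrite ki iF in kF.
have h1 : hs_norm (T - TF) <= eps / 4.
  apply: hs_norm_ub; first exact: ltW.
  move=> G.
  rewrite (eq_bigr (fun i => if i \in F then 0 else hil_norm (T (e i)) ^+ 2)); last first.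
    move=> i _; rewrite (_ : (T - TF) (e i) = T (e i) - TF (e i))// TFe.
    by case: ifP => _; rewrite ?subrr ?hil_norm0 ?expr0n// subr0.
  have := @fset_cut F G (fun i => hil_norm (T (e i)) ^+ 2) (fun i => sqr_ge0 _).
  have := hs_norm_fset T (F `|` G)%fset; lra.
(* approximate each column *)
have col (i : idx) : exists l : seq (idx * R[i]),
    hil_norm (T (e i) - \sum_(t <- l) t.2 *: e t.1) <= eps / 4 / (size F).+1%:R.
  set r := _ / _; have r0 : 0 < r by rewrite divr_gt0.
  have := @hil_total R E (ball (T (e i)) r%:C); case.
  - by exists (T (e i)); apply: ballxx; rewrite ltcR.
  - by apply: ball_open; rewrite ltcR.
  move=> y [+ [G [c yE]]]; rewrite -ball_normE /ball_ /= -hil_norm_complex ltcR => h.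
  exists [seq (k, c k) | k <- G]; rewrite big_map/= -yE; exact: ltW.
have [L HL] := choice col.
pose l := [seq ((i, t.1), t.2) | i <- (F : seq idx), t <- L i].
exists l.
have lE : finite_rank l = \sum_(i <- F) rank1 i (\sum_(t <- L i) t.2 *: e t.1).
  rewrite /finite_rank /l big_allpairs_dep/=; apply: eq_bigr => i _.
  apply: val_inj; apply/funext => x /=.
  rewrite hs_opsum_apply/= scaler_sumr; apply: eq_bigr => t _ /=.
  by rewrite -[LHS]/(t.2 *: (d x (e i) *: e t.1)) !scalerA mulrC.
have h2 : hs_norm (TF - finite_rank l) <= eps / 4.
  rewrite lE /TF -sumrB; apply: le_trans (hs_norm_sum _ _) _.
  apply: (@le_trans _ _ (\sum_(i <- F) eps / 4 / (size F).+1%:R)).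
    apply: ler_sum => i _.
    have -> : rank1 i (T (e i)) - rank1 i (\sum_(t <- L i) t.2 *: e t.1) =
        rank1 i (T (e i) - \sum_(t <- L i) t.2 *: e t.1).
      by apply: val_inj; apply/funext => x /=; rewrite scalerBr.
    exact: le_trans (rank1_norm _ _) (HL i).
  by rewrite big_const_seq count_predT iter_addr addr0 div_succ_mulrn_le// ltW.
apply: le_lt_trans (hs_normB_triangle T TF _) _; apply: le_lt_trans (lerD h1 h2) _.
by clear -e0; lra.
Qed.

Definition is_adj T S : Prop := forall x y, d (T x) y = d x (S y).

Lemma is_adjB T T' S S' : is_adj T S -> is_adj T' S' -> is_adj (T - T') (S - S').
Proof. by move=> h h' x y; rewrite /= linearBl/= linearBr/= h h'. Qed.

Lemma is_adj_sym T S : is_adj T S -> is_adj S T.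
Proof. by move=> h x y; rewrite dotC -h -dotC. Qed.

(** Exchanging the sums over the two bases in the Parseval identity; finite
    approximations of Parseval on one side and Bessel on the other suffice. *)
Lemma is_adj_norm_le T S : is_adj T S -> hs_norm S <= hs_norm T.
Proof.
move=> h; apply: hs_norm_ub => [|G]; first exact: hs_norm_ge0.
apply/ler_addgt0Pr => eps e0.
pose r := eps / (size G).+1%:R.
have r0 : 0 < r by rewrite divr_gt0.
have /choice[Fj HF] : forall j : idx, exists F : {fset idx}, forall G' : {fset idx}, (F `<=` G')%fset ->
    hil_norm (S (e j)) ^+ 2 <= \sum_(i <- G') cabs (d (S (e j)) (e i)) ^+ 2 + r.
  by move=> j; exact: parseval_approx.
pose F := (\bigcup_(j <- G) Fj j)%fset.
have FjF j : j \in G -> (Fj j `<=` F)%fset by move=> jG; exact: bigfcup_sup.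
apply: (@le_trans _ _ (\sum_(j <- G) (\sum_(i <- F) cabs (d (S (e j)) (e i)) ^+ 2 + r))).
  rewrite big_seq [leRHS]big_seq; apply: ler_sum => j jG; apply: HF; exact: FjF.
rewrite big_split/=; apply: lerD; last first.
  by rewrite big_const_seq count_predT iter_addr addr0 div_succ_mulrn_le// ltW.
rewrite exchange_big/=; apply: (@le_trans _ _ (\sum_(i <- F) hil_norm (T (e i)) ^+ 2)).
  apply: ler_sum => i _; apply: le_trans (bessel _ (fset_uniq G)).
  by apply: ler_sum => j _; rewrite dotC -h cabs_conj.
exact: hs_norm_fset.
Qed.

Lemma is_adj_norm T S : is_adj T S -> hs_norm S = hs_norm T.
Proof.
by move=> h; apply/le_anti; rewrite !is_adj_norm_le//; exact: is_adj_sym.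
Qed.

Lemma finite_rank_adj l : is_adj (finite_rank l) (finite_rank [seq ((t.1.2, t.1.1), Num.conj t.2) | t <- l]).
Proof.
move=> x y; rewrite /finite_rank !hs_opsum_apply linear_sumlz linear_sumr big_map/=.
apply: eq_bigr => t _ /=.
have dZl (a : R[i]) u v : d (a *: u) v = a * d u v by rewrite linearZl_LR.
have dZr (a : R[i]) u v : d u (a *: v) = Num.conj a * d u v by rewrite linearZr_LR.
rewrite -[LHS]/(d (t.2 *: (d x (e t.1.1) *: e t.1.2)) y).
rewrite -[RHS]/(d x (Num.conj t.2 *: (d y (e t.1.2) *: e t.1.1))).
by rewrite !dZl !dZr conjCK -dotC mulrA mulrAC mulrA.
Qed.

(** Finite rank operators have explicit adjoints, and passing to the adjoint is
    an isometry on them, so approximations of [T] have Cauchy adjoints. *)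
Lemma adj_exists T : exists S, is_adj T S.
Proof.
have /choice[l Hl] : forall n : nat, exists l, hs_norm (T - finite_rank l) < n.+1%:R^-1.
  by move=> n; apply: finite_rank_dense; rewrite invr_gt0.
pose l' n := [seq ((t.1.2, t.1.1), Num.conj t.2) | t <- l n].
have [S HS] : exists S, hs_norm (finite_rank (l' n) - S) @[n --> \oo] --> (0 : R).
  apply: hs_complete => eps e0.
  have [N _ HN] : \forall N \near \oo, 2 / eps < N%:R by exact: nbhs_infty_gtr.
  exists N => m n Nm Nn.
  rewrite (is_adj_norm (is_adjB (finite_rank_adj (l m)) (finite_rank_adj (l n)))).
  have h k : (N <= k)%N -> hs_norm (T - finite_rank (l k)) <= eps / 2.
    move=> Nk; apply: le_trans (ltW (Hl k)) _.
    rewrite -[leRHS]invrK lef_pV2 ?posrE ?invr_gt0 ?divr_gt0// invf_div.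
    apply: le_trans (ltW (HN N (leqnn N))) _; rewrite ler_nat; exact: leqW.
  apply: le_trans (hs_normB_triangle _ T _) _; rewrite hs_normBC.
  by rewrite [leRHS](splitr eps) lerD// h.
exists S => x y; apply/eqP; rewrite -subr_eq0; apply/eqP; apply: cabs_eq0.
have H0 : (n.+1%:R^-1 + hs_norm (finite_rank (l' n) - S)) * (hil_norm x * hil_norm y) @[n --> \oo] --> (0 : R).
  rewrite -[X in _ --> X](mul0r (hil_norm x * hil_norm y)); apply: cvgMr_tmp.
  rewrite -[X in _ --> X](addr0 0); apply: cvgD; last exact: HS.
  exact: cvg_harmonic.
apply/le_anti; rewrite cabs_ge0 andbT; apply: (cvgr_to_ge H0); near=> n.
have -> : d (T x) y - d x (S y) = d ((T - finite_rank (l n)) x) y + d x ((finite_rank (l' n) - S) y).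
  by rewrite /= linearBl/= linearBr/= finite_rank_adj addrA subrK.
apply: le_trans (cabsD _ _) _; rewrite mulrDl; apply: lerD.
  apply: le_trans (cauchy_schwarz _ _) _; rewrite mulrA.
  apply: ler_wpM2r; first exact: hil_norm_ge0.
  apply: le_trans (hs_op_bound _ _) _; apply: ler_wpM2r; first exact: hil_norm_ge0.
  exact: ltW.
apply: le_trans (cauchy_schwarz _ _) _; rewrite mulrCA.
apply: ler_wpM2l; first exact: hil_norm_ge0.
exact: hs_op_bound.
Unshelve. all: by end_near. Qed.

Lemma hs_adjP T : is_adj T (hs_adj T).
Proof. by have [S HS] := adj_exists T; exact: (@xgetPex _ 0 _ (ex_intro _ S HS)). Qed.

Lemma hs_adjB S T : hs_norm (hs_adj S - hs_adj T) = hs_norm (S - T).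
Proof. by apply: is_adj_norm; apply: is_adjB; exact: hs_adjP. Qed.

Lemma hs_adj_norm T : hs_norm (hs_adj T) = hs_norm T.
Proof. by apply: is_adj_norm; exact: hs_adjP. Qed.

Lemma hs_comp_norm S T : hs_norm (hs_comp S T) <= hs_norm S * hs_norm T.
Proof.
apply: hs_norm_ub => [|F]; first by rewrite mulr_ge0 ?hs_norm_ge0.
rewrite exprMn; apply: le_trans (ler_wpM2l (sqr_ge0 _) (hs_norm_fset T F)).
rewrite mulr_sumr; apply: ler_sum => i _; rewrite -exprMn.
rewrite ler_sqr ?nnegrE ?mulr_ge0 ?hs_norm_ge0 ?hil_norm_ge0//.
exact: (hs_op_bound S (T (e i))).
Qed.

Lemma hs_compB S T S' T' :
  hs_norm (hs_comp S T - hs_comp S' T') <=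
  hs_norm (S - S') * hs_norm T + hs_norm S' * hs_norm (T - T').
Proof.
have -> : hs_comp S T - hs_comp S' T' = hs_comp (S - S') T + hs_comp S' (T - T').
  apply: val_inj; apply/funext => x /=.
  rewrite -[LHS]/(S (T x) - S' (T' x)) -[RHS]/(S (T x) - S' (T x) + S' (T x - T' x)).
  by rewrite linearB/= addrA subrK.
by apply: le_trans (hs_normD _ _) _; apply: lerD; exact: hs_comp_norm.
Qed.

(** Countably many operators, dense in the whole space: the separability of the
    Hilbert--Schmidt class. *)
Definition rat_finite_rank (l : seq (idx * idx * (rat * rat))) : hs_op E :=
  finite_rank [seq (t.1, (ratr t.2.1 +i* ratr t.2.2)%C) | t <- l].

Lemma cabs_le (z : R[i]) : cabs z <= `|complex.Re z| + `|complex.Im z|.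
Proof.
case: z => a b /=; rewrite (_ : a +i* b = a%:C + 'i%C * b%:C)%C; last first.
  by apply/eqP; rewrite eq_complex /= !(mul0r, mul1r, addr0, add0r, subr0) !eqxx.
apply: le_trans (cabsD _ _) _; rewrite cabsM !cabs_real.
rewrite (_ : cabs 'i%C = 1) ?mul1r//.
by apply/complexI; rewrite cabsE normc_def/= expr0n/= add0r expr1n sqrtr1.
Qed.

Lemma rat_finite_rank_dense T (eps : R) : 0 < eps -> exists l, hs_norm (T - rat_finite_rank l) < eps.
Proof.
move=> e0; have e20 : 0 < eps / 2 by rewrite divr_gt0.
have [l Hl] := finite_rank_dense T e20.
suff [l' Hl'] : exists l', hs_norm (finite_rank l - rat_finite_rank l') < eps / 2.
  exists l'; apply: le_lt_trans (hs_normB_triangle _ (finite_rank l) _) _.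
  by rewrite [ltRHS](splitr eps) ltrD.
elim: l (eps / 2) e20 {Hl} => [|[[i j] [a b]] l IH] r r0.
  by exists [::]; rewrite /rat_finite_rank /= subrr hs_norm0.
have [|l' Hl'] := IH (r / 2); first by rewrite divr_gt0.
have nij : hs_norm (rank1 i (e j)) <= 1.
  apply: le_trans (rank1_norm _ _) _; rewrite -(@ler_sqr R) ?nnegrE ?hil_norm_ge0// expr1n.
  by rewrite le_eqVlt; apply/orP; left; apply/eqP/complexI; rewrite hil_sqr dot_basis eqxx.
have r40 : 0 < r / 4 by rewrite divr_gt0.
have [qa [qa1 qa2]] : exists q : rat, a - r / 4 < ratr q /\ ratr q < a + r / 4.
  by have [|q] := @rat_in_itvoo R (a - r / 4) (a + r / 4); [lra|rewrite in_itv/= => /andP[]; exists q].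
have [qb [qb1 qb2]] : exists q : rat, b - r / 4 < ratr q /\ ratr q < b + r / 4.
  by have [|q] := @rat_in_itvoo R (b - r / 4) (b + r / 4); [lra|rewrite in_itv/= => /andP[]; exists q].
exists (((i, j), (qa, qb)) :: l').
rewrite /rat_finite_rank /finite_rank /= !big_cons/= opprD addrACA -scalerBl.
apply: le_lt_trans (hs_normD _ _) _.
have -> : r = r / 2 + r / 2 by lra.
apply: ler_ltD; last exact: Hl'.
rewrite hs_normZc; apply: le_trans (ler_wpM2l (cabs_ge0 _) nij) _; rewrite mulr1.
apply: le_trans (cabs_le _) _ => /=.
have h1 : `|a - ratr qa| <= r / 4 by rewrite ler_norml; apply/andP; split; lra.
have h2 : `|b - ratr qb| <= r / 4 by rewrite ler_norml; apply/andP; split; lra.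
lra.
Qed.

End FiniteRank.

(** * Borel random operators *)

Section OperatorTopology.
Context {R : realType} {E : sepHilbert R}.
Implicit Types (S T U : hs_op E).

Lemma hs_open_ball T (r : R) : open [set S : hs_op E | hs_norm (S - T) < r].
Proof.
have [r0|r0] := ltP 0 r; last first.
  rewrite (_ : [set _ | _] = set0); first exact: open0.
  apply/seteqP; split => // S /=; rewrite ltNge => /negP; apply.
  exact: le_trans r0 (hs_norm_ge0 _).
have -> : [set S | hs_norm (S - T) < r] = ball T r%:C.
  rewrite -ball_normE; apply/seteqP; split => S /=; rewrite hs_normE ltcR hs_normBC//.
by apply: ball_open; rewrite ltcR.
Qed.

Lemma hs_nbhs (U : set (hs_op E)) T : nbhs T U ->
  exists2 r : R, 0 < r & forall S, hs_norm (S - T) < r -> U S.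
Proof.
move=> /nbhs_ballP[_ /= /gt0_complex[r r0 ->] H]; exists r => // S ST.
by apply: H; rewrite -ball_normE /ball_ /= hs_normE ltcR hs_normBC.
Qed.

Lemma hs_cvgP (u : nat -> hs_op E) T :
  u n @[n --> \oo] --> T <-> hs_norm (u n - T) @[n --> \oo] --> (0 : R).
Proof.
split=> [/cvgrPdist_lt h|/cvgrPdist_lt h].
  apply/cvgrPdist_lt => eps e0.
  have := h eps%:C; rewrite ltcR => /(_ e0); apply: filterS => n.
  by rewrite hs_normE ltcR sub0r normrN ger0_norm ?hs_norm_ge0// hs_normBC.
apply/cvgrPdist_lt => _ /gt0_complex[eps e0 ->].
apply: filterS (h eps e0) => n.
by rewrite hs_normE ltcR sub0r normrN ger0_norm ?hs_norm_ge0// hs_normBC.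
Qed.

Lemma hs_norm_dist S T : `|hs_norm S - hs_norm T| <= hs_norm (S - T).
Proof.
rewrite ler_norml lerNl opprB !lerBlDr; apply/andP; split.
  by rewrite hs_normBC -[X in hs_norm X <= _](subrK S) hs_normD.
by rewrite -[X in hs_norm X <= _](subrK T) hs_normD.
Qed.

End OperatorTopology.

Section BorelOperators.
Context {R : realType} {E : sepHilbert R}.
Context {d : measure_display} {W : measurableType d}.
Implicit Types (S T U : hs_op E) (X : W -> hs_op E).

Lemma borel_open X : borel_rv X -> forall U : set (hs_op E), open U -> measurable (X @^-1` U).
Proof.
move=> mX U oU; rewrite -[X in measurable X]setTI; apply: mX => //.
exact: sub_sigma_algebra.
Qed.

Lemma open_borel X :
  (forall U : set (hs_op E), open U -> measurable (X @^-1` U)) -> borel_rv X.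
Proof.
move=> H; rewrite /borel_rv.
apply: (@measurability _ _ W (g_sigma_algebraType (@open (hs_op E))) setT X (@open (hs_op E))) => //.
by move=> _ [U oU <-]; rewrite setTI; exact: H.
Qed.

Lemma measurable_rays (f : W -> R) :
  (forall r, measurable [set w | f w < r]) -> measurable_fun setT f.
Proof.
move=> H; apply: (measurability (@RGenInftyO.G R)); first exact: RGenInftyO.measurableE.
move=> _ [_ [r ->] <-]; rewrite setTI.
rewrite (_ : _ @^-1` _ = [set w | f w < r])//.
Qed.

Lemma rays_measurable (f : W -> R) r :
  measurable_fun setT f -> measurable [set w | f w < r].
Proof.
move=> mf; rewrite (_ : [set _ | _] = setT `&` f @^-1` `]-oo, r[); first exact: mf.
by rewrite setTI; apply/seteqP; split => w /=; rewrite in_itv.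
Qed.

Lemma borel_dist X T : borel_rv X -> measurable_fun setT (fun w => hs_norm (X w - T)).
Proof.
move=> mX; apply: measurable_rays => r.
exact: (borel_open mX (@hs_open_ball _ _ T r)).
Qed.

Lemma borel_norm X : borel_rv X -> measurable_fun setT (fun w => hs_norm (X w)).
Proof.
move=> mX; apply: (eq_measurable_fun (fun w => hs_norm (X w - 0))).
  by move=> w _; rewrite subr0.
exact: borel_dist.
Qed.

Lemma exists_rat (a b : R) : a < b -> exists q : rat, a < ratr q /\ ratr q < b.
Proof.
by move=> ab; have [q] := rat_in_itvoo ab; rewrite in_itv/= => /andP[]; exists q.
Qed.

(** By separability every open set is a countable union of balls with centres in
    the countable dense set, so that distances to points decide measurability. *)
Lemma borel_rvP X : borel_rv X <-> forall T, measurable_fun setT (fun w => hs_norm (X w - T)).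
Proof.
split=> [mX T|H]; first exact: borel_dist.
apply: open_borel => U oU.
pose good (c : seq (hil_idx E * hil_idx E * (rat * rat)) * rat) : Prop :=
  forall S, hs_norm (S - rat_finite_rank c.1) < ratr c.2 -> U S.
pose B c := [set w | good c /\ hs_norm (X w - rat_finite_rank c.1) < ratr c.2].
have -> : X @^-1` U = \bigcup_c B c.
  apply/seteqP; split => [w Uw|w [c _ [gc]]]; last exact: gc.
  have [r r0 Hr] := hs_nbhs (open_nbhs_nbhs (conj oU Uw)).
  have [|q [q0 qr]] := @exists_rat 0 (r / 2); first by rewrite divr_gt0.
  have [l Hl] := rat_finite_rank_dense (X w) q0.
  exists (l, q) => //; split => //= S hS; apply: Hr.
  apply: le_lt_trans (hs_normB_triangle _ (rat_finite_rank l) _) _.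
  rewrite [ltRHS](splitr r); apply: ltrD; first exact: (lt_trans hS qr).
  by rewrite hs_normBC; exact: (lt_trans Hl qr).
apply: countable_bigcupT_measurable => // c; rewrite /B.
have [gc|ngc] := pselect (good c).
  rewrite (_ : [set _ | _] = [set w | hs_norm (X w - rat_finite_rank c.1) < ratr c.2]).
    exact: rays_measurable.
  by apply/seteqP; split => w // [].
rewrite (_ : [set _ | _] = set0)//.
by apply/seteqP; split => w // [].
Qed.

(** Continuity in finitely many operator variables in its sequential form, which
    is the one that limits of random operators call for. *)
Definition seq_cont (k : nat) (T : topologicalType) (G : ('I_k -> hs_op E) -> T) : Prop :=
  forall (f_ : nat -> 'I_k -> hs_op E) f,
    (forall i, hs_norm (f_ n i - f i) @[n --> \oo] --> (0 : R)) ->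
    G (f_ n) @[n --> \oo] --> G f.

(** The preimage of an open set is a countable union of products of balls
    with centres in the countable dense set: this is where separability is
    used. *)
Lemma seq_cont_measurable (k : nat) (T : topologicalType) (G : ('I_k -> hs_op E) -> T)
    (X : 'I_k -> W -> hs_op E) (U : set T) :
  seq_cont G -> (forall i, borel_rv (X i)) -> open U ->
  measurable [set w | U (G (X ^~ w))].
Proof.
move=> cG mX oU.
have nb f : U (G f) -> exists2 r : R, 0 < r &
    forall f', (forall i, hs_norm (f' i - f i) < r) -> U (G f').
  move=> Uf; apply: contrapT => H.
  have /choice[f_ Hf] : forall n : nat, exists f' : 'I_k -> hs_op E,
      (forall i, hs_norm (f' i - f i) < n.+1%:R^-1) /\ ~ U (G f').
    move=> n; apply: contrapT => /forallNP H'; apply: H; exists n.+1%:R^-1; first by rewrite invr_gt0.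
    by move=> f' hf'; apply: contrapT => nU; apply: (H' f').
  have cf : G (f_ n) @[n --> \oo] --> G f.
    apply: cG => i; apply/cvgrPdist_lt => e e0; near=> n.
    rewrite sub0r normrN ger0_norm ?hs_norm_ge0//; apply: lt_trans ((Hf n).1 i) _.
    by near: n; exact: near_infty_natSinv_lt (PosNum e0).
  have := cf U (open_nbhs_nbhs (conj oU Uf)) => -[N _ /(_ N (leqnn N))].
  by have [_] := Hf N.
pose good (c : {ffun 'I_k -> seq (hil_idx E * hil_idx E * (rat * rat))} * rat) : Prop :=
  forall f', (forall i, hs_norm (f' i - rat_finite_rank (c.1 i)) < ratr c.2) -> U (G f').
pose B c := [set w | good c /\ forall i, hs_norm (X i w - rat_finite_rank (c.1 i)) < ratr c.2].
have -> : [set w | U (G (X ^~ w))] = \bigcup_c B c.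
  apply/seteqP; split => [w /= Uw|w [c _ [gc]]]; last exact: gc.
  have [r r0 Hr] := nb _ Uw.
  have [|q [q0 qr]] := @exists_rat 0 (r / 2); first by rewrite divr_gt0.
  have /choice[l Hl] := fun i => rat_finite_rank_dense (X i w) q0.
  exists ([ffun i => l i], q) => //; split => /= [f' hf'|i]; last by rewrite ffunE.
  apply: Hr => i; apply: le_lt_trans (hs_normB_triangle _ (rat_finite_rank (l i)) _) _.
  rewrite [ltRHS](splitr r); apply: ltrD.
    by have := hf' i; rewrite /= ffunE => h; exact: (lt_trans h qr).
  by rewrite hs_normBC; exact: (lt_trans (Hl i) qr).
apply: countable_bigcupT_measurable => // c; rewrite /B.
have [gc|ngc] := pselect (good c).
  rewrite (_ : [set _ | _] = \bigcap_(i in [set: 'I_k]) [set w | hs_norm (X i w - rat_finite_rank (c.1 i)) < ratr c.2]).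
    apply: fin_bigcap_measurable => // i _.
    by apply: rays_measurable; exact: borel_dist.
  by apply/seteqP; split => [w [_ h] i _|w h]; [exact: h|split => // i; exact: h].
rewrite (_ : [set _ | _] = set0)//.
by apply/seteqP; split => w // [].
Unshelve. all: by end_near. Qed.

Lemma seq_cont_borel (k : nat) (G : ('I_k -> hs_op E) -> hs_op E)
    (X : 'I_k -> W -> hs_op E) :
  seq_cont G -> (forall i, borel_rv (X i)) -> borel_rv (fun w => G (X ^~ w)).
Proof.
by move=> cG mX; apply: open_borel => U oU; exact: (seq_cont_measurable cG mX oU).
Qed.

Lemma seq_cont_measurable_fun (k : nat) (G : ('I_k -> hs_op E) -> R)
    (X : 'I_k -> W -> hs_op E) :
  seq_cont G -> (forall i, borel_rv (X i)) -> measurable_fun setT (fun w => G (X ^~ w)).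
Proof.
move=> cG mX; apply: measurable_rays => r.
rewrite (_ : [set _ | _] = [set w | `]-oo, r[%classic (G (X ^~ w))]).
  exact: (seq_cont_measurable cG mX).
by apply/seteqP; split => w /=; rewrite in_itv.
Qed.

End BorelOperators.

(** * Operations on random operators and their limits *)

Section SeqContinuity.
Context {R : realType} {E : sepHilbert R} {k : nat}.
Implicit Types (G H : ('I_k -> hs_op E) -> hs_op E).

Lemma squeeze_cvg0 (a b : nat -> R) : (forall n, 0 <= a n <= b n) ->
  b n @[n --> \oo] --> (0 : R) -> a n @[n --> \oo] --> (0 : R).
Proof.
move=> h hb; apply: (squeeze_cvgr _ _ hb); last exact: cvg_cst.
by apply: nearW => n.
Qed.

Lemma seq_cont_proj i : seq_cont (fun f : 'I_k -> hs_op E => f i).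
Proof. by move=> f_ f /(_ i) h; apply/hs_cvgP. Qed.

Lemma seq_cont_adj G : seq_cont G -> seq_cont (fun f => hs_adj (G f)).
Proof.
move=> cG f_ f hf; apply/hs_cvgP; have /hs_cvgP := cG f_ f hf.
by under [X in _ -> X]eq_cvg => n do rewrite hs_adjB.
Qed.

Lemma seq_contD G H : seq_cont G -> seq_cont H -> seq_cont (fun f => G f + H f).
Proof. by move=> cG cH f_ f hf; apply: cvgD; [exact: cG|exact: cH]. Qed.

Lemma seq_contZ (a : R[i]) G : seq_cont G -> seq_cont (fun f => a *: G f).
Proof. by move=> cG f_ f hf; apply: cvgZr; exact: cG. Qed.

Lemma seq_cont_comp G H : seq_cont G -> seq_cont H -> seq_cont (fun f => hs_comp (G f) (H f)).
Proof.
move=> cG cH f_ f hf; apply/hs_cvgP.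
have /hs_cvgP hG := cG f_ f hf; have /hs_cvgP hH := cH f_ f hf.
apply: (@squeeze_cvg0 _ (fun n => hs_norm (G (f_ n) - G f) * (hs_norm (H (f_ n) - H f) + hs_norm (H f)) + hs_norm (G f) * hs_norm (H (f_ n) - H f))).
  move=> n; rewrite hs_norm_ge0/=; apply: le_trans (hs_compB _ _ _ _) _.
  rewrite lerD2r; apply: ler_wpM2l; first exact: hs_norm_ge0.
  by rewrite -[X in hs_norm X <= _](subrK (H f)) hs_normD.
rewrite [X in _ --> X](_ : _ = 0 * (0 + hs_norm (H f)) + hs_norm (G f) * 0); last by rewrite mul0r mulr0 addr0.
apply: cvgD; first by apply: cvgM => //; apply: cvgD => //; exact: cvg_cst.
by apply: cvgM => //; exact: cvg_cst.
Qed.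

Lemma seq_cont_letter (l : star_letter k) : seq_cont (fun f : 'I_k -> hs_op E => star_letter_eval f l).
Proof.
rewrite /star_letter_eval; case: l => i [] /=; last exact: seq_cont_proj.
by apply: seq_cont_adj; exact: seq_cont_proj.
Qed.

Lemma seq_cont_star_poly (q : star_poly R k) :
  seq_cont (fun f : 'I_k -> hs_op E => star_poly_eval q f).
Proof.
rewrite /star_poly_eval; elim: q => [|[a [l w]] q IH].
  by move=> f_ f _; under eq_cvg => n do rewrite big_nil; rewrite big_nil; exact: cvg_cst.
move=> f_ f hf; under eq_cvg => n do rewrite big_cons; rewrite big_cons.
apply: (seq_contD (G := fun f => a *: foldl (fun S l => hs_comp S (star_letter_eval f l))
                             (star_letter_eval f l) w) _ IH hf).
apply: seq_contZ => /=.
suff word v G : seq_cont G -> seq_cont (fun f =>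
    foldl (fun S l => hs_comp S (star_letter_eval f l)) (G f) v).
  by apply: word; exact: seq_cont_letter.
elim: v G => [//|l' v IHv] G cG /=.
apply: (IHv (fun f => hs_comp (G f) (star_letter_eval f l'))).
by apply: seq_cont_comp => //; exact: seq_cont_letter.
Qed.

End SeqContinuity.

Section BorelOperations.
Context {R : realType} {E : sepHilbert R}.
Context {d : measure_display} {W : measurableType d}.
Implicit Types (X Y : W -> hs_op E).

Lemma borel_cst (T : hs_op E) : borel_rv (fun _ : W => T).
Proof. by apply/borel_rvP => S; exact: measurable_cst. Qed.

Lemma borelD X Y : borel_rv X -> borel_rv Y -> borel_rv (fun w => X w + Y w).
Proof.
move=> mX mY; pose Z (i : 'I_2) := if i == ord0 then X else Y.
pose G (f : 'I_2 -> hs_op E) := f ord0 + f ord_max.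
apply: (@seq_cont_borel _ _ _ _ 2 G Z).
  by apply: seq_contD; exact: seq_cont_proj.
by move=> i; rewrite /Z; case: ifP.
Qed.

Lemma borel_comp X Y : borel_rv X -> borel_rv Y -> borel_rv (fun w => hs_comp (X w) (Y w)).
Proof.
move=> mX mY; pose Z (i : 'I_2) := if i == ord0 then X else Y.
pose G (f : 'I_2 -> hs_op E) := hs_comp (f ord0) (f ord_max).
apply: (@seq_cont_borel _ _ _ _ 2 G Z).
  by apply: seq_cont_comp; exact: seq_cont_proj.
by move=> i; rewrite /Z; case: ifP.
Qed.

Lemma borelZ (a : R[i]) X : borel_rv X -> borel_rv (fun w => a *: X w).
Proof.
move=> mX; apply: (@seq_cont_borel _ _ _ _ 1 (fun f => a *: f ord0) (fun _ => X)) => //.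
by apply: seq_contZ; exact: seq_cont_proj.
Qed.

Lemma borel_adj X : borel_rv X -> borel_rv (fun w => hs_adj (X w)).
Proof.
move=> mX; apply: (@seq_cont_borel _ _ _ _ 1 (fun f => hs_adj (f ord0)) (fun _ => X)) => //.
by apply: seq_cont_adj; exact: seq_cont_proj.
Qed.

Lemma borelB X Y : borel_rv X -> borel_rv Y -> borel_rv (fun w => X w - Y w).
Proof.
move=> mX mY; have -> : (fun w => X w - Y w) = (fun w => X w + (-1) *: Y w).
  by apply/funext => w; rewrite scaleN1r.
by apply: borelD => //; exact: borelZ.
Qed.

Lemma borel_scale (c : W -> R) (T : hs_op E) :
  measurable_fun setT c -> borel_rv (fun w => (c w)%:C *: T).
Proof.
move=> mc; apply/borel_rvP => S.
have n0 := hs_norm_ge0 T; have np : 0 < hs_norm T + 1 by rewrite ltr_wpDl.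
have cf : continuous (fun t : R => hs_norm (t%:C *: T - S)).
  move=> t; apply/cvgrPdist_le => e e0; near=> u.
  apply: le_trans (hs_norm_dist _ _) _.
  rewrite opprB addrA subrK -scalerBl -rmorphB/= hs_normZc cabs_real.
  apply: (@le_trans _ _ (`|t - u| * (hs_norm T + 1))).
    by apply: ler_wpM2l => //; rewrite lerDl.
  rewrite -(ler_pdivlMr _ _ np); near: u; apply: cvgr_dist_le; first exact: cvg_id.
  exact: divr_gt0.
by apply: (measurableT_comp (continuous_measurable_fun cf)).
Unshelve. all: by end_near. Qed.

Lemma borel_sum (I : Type) (s : seq I) (F : I -> W -> hs_op E) :
  (forall i, borel_rv (F i)) -> borel_rv (fun w => \sum_(i <- s) F i w).
Proof.
move=> mF; elim: s => [|i s IH].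
  under eq_fun do rewrite big_nil; exact: borel_cst.
by under eq_fun do rewrite big_cons; exact: borelD.
Qed.

Lemma borel_finite_sum (I : Type) (s : seq I) (c : I -> W -> R) (A : I -> hs_op E) :
  (forall i, measurable_fun setT (c i)) ->
  borel_rv (fun w => \sum_(i <- s) (c i w)%:C *: A i).
Proof. by move=> mc; apply: borel_sum => i; exact: borel_scale. Qed.

Lemma borel_lim (u : nat -> W -> hs_op E) X :
  (forall n, borel_rv (u n)) -> (forall w, hs_norm (u n w - X w) @[n --> \oo] --> (0 : R)) ->
  borel_rv X.
Proof.
move=> mu h; apply/borel_rvP => T.
apply: (@measurable_fun_cvg _ _ R setT (fun n w => hs_norm (u n w - T))).
  by move=> n; exact: borel_dist.
move=> w _; apply/cvgrPdist_le => e e0; near=> n.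
apply: le_trans (hs_norm_dist _ _) _; rewrite opprB addrA subrK hs_normBC.
by near: n; move/cvgrPdist_le : (h w) => /(_ e e0); apply: filterS => n;
  rewrite sub0r normrN ger0_norm ?hs_norm_ge0.
Unshelve. all: by end_near. Qed.

(** By completeness this is the set where the sequence converges. *)
Lemma measurable_cauchy_set (u : nat -> W -> hs_op E) : (forall n, borel_rv (u n)) ->
  measurable [set w | forall p : nat, exists N : nat, forall m n : nat, (N <= m)%N -> (N <= n)%N ->
     hs_norm (u m w - u n w) <= p.+1%:R^-1].
Proof.
move=> mu.
pose B p N m n := [set w | (N <= m)%N -> (N <= n)%N -> hs_norm (u m w - u n w) <= p.+1%:R^-1].
have -> : [set w | forall p : nat, exists N : nat, forall m n : nat, (N <= m)%N -> (N <= n)%N ->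
     hs_norm (u m w - u n w) <= p.+1%:R^-1] =
  \bigcap_p \bigcup_N \bigcap_m \bigcap_n B p N m n.
  apply/seteqP; split => [w h p _|w h p].
    by have [N HN] := h p; exists N => // m _ n _; exact: HN.
  by have [N _ HN] := h p I; exists N => m n; exact: (HN m I n I).
apply: bigcapT_measurable => p; apply: bigcupT_measurable => N.
apply: bigcapT_measurable => m; apply: bigcapT_measurable => n; rewrite /B.
have [Nm|Nm] := boolP (N <= m)%N; last first.
  by rewrite (_ : [set _ | _] = setT)//; apply/seteqP; split.
have [Nn|Nn] := boolP (N <= n)%N; last first.
  by rewrite (_ : [set _ | _] = setT)//; apply/seteqP; split.
rewrite (_ : [set _ | _] = ~` [set w | p.+1%:R^-1 < hs_norm (u m w - u n w)]); last first.
  apply/seteqP; split => w /=; first by move=> /(_ isT isT); rewrite leNgt => /negP.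
  by move=> /negP; rewrite -leNgt.
apply: measurableC.
rewrite (_ : [set _ | _] = [set w | - hs_norm (u m w - u n w) < - p.+1%:R^-1]); last first.
  by apply/seteqP; split => w /=; rewrite ltrN2.
apply: rays_measurable; apply: measurable_funN.
by apply: borel_norm; exact: borelB.
Qed.

(** The value [0] in the absence of a limit makes the limit of Borel random
    operators Borel on the whole space. *)
Definition hs_lim (u : nat -> hs_op E) : hs_op E :=
  xget 0 [set T | hs_norm (u n - T) @[n --> \oo] --> (0 : R)].

Lemma hs_limP (u : nat -> hs_op E) T :
  hs_norm (u n - T) @[n --> \oo] --> (0 : R) -> hs_lim u = T.
Proof.
move=> h; have : [set T | hs_norm (u n - T) @[n --> \oo] --> (0 : R)] (hs_lim u).
  exact: (@xgetPex _ 0 _ (ex_intro _ T h)).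
move=> /= /hs_cvgP h1; move: h => /hs_cvgP h; exact: (cvg_unique _ h1 h).
Qed.

(** Multiplying by the indicator of the Cauchy set turns the sequence into one
    that converges everywhere and has the same limit. *)
Lemma borel_hs_lim (u : nat -> W -> hs_op E) : (forall n, borel_rv (u n)) ->
  borel_rv (fun w => hs_lim (u ^~ w)).
Proof.
move=> mu; have mC := measurable_cauchy_set mu.
set C := [set w | _] in mC.
have -> : (fun w => hs_lim (u ^~ w)) =
    (fun w => hs_lim (fun n => (\1_C w : R)%:C *: u n w)).
  apply/funext => w; rewrite indicE; have [wC|wC] := boolP (w \in C).
    by congr hs_lim; apply/funext => n; rewrite scale1r.
  have -> : (fun n => (false%:R : R)%:C *: u n w) = fun=> 0.
    by apply/funext => n; rewrite scale0r.
  have -> : hs_lim (fun=> 0) = 0.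
    by apply: hs_limP; rewrite subrr hs_norm0; exact: cvg_cst.
  rewrite /hs_lim; apply: xgetPN => T /= h; move/negP: wC; apply; apply/mem_set => p.
  have p0 : 0 < p.+1%:R^-1 / 2 :> R by rewrite divr_gt0.
  move/cvgrPdist_le: h => /(_ _ p0) [N _ HN]; exists N => m n Nm Nn.
  apply: le_trans (hs_normB_triangle _ T _) _; rewrite [leRHS]splitr; apply: lerD.
    by have := HN m Nm; rewrite /= sub0r normrN ger0_norm ?hs_norm_ge0.
  by rewrite hs_normBC; have := HN n Nn; rewrite /= sub0r normrN ger0_norm ?hs_norm_ge0.
have mv n : borel_rv (fun w => (\1_C w : R)%:C *: u n w).
  apply: open_borel => U oU.
  rewrite (_ : _ @^-1` U = (C `&` u n @^-1` U) `|` (~` C `&` [set w | U 0])); last first.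
    apply/seteqP; split => w /=; rewrite indicE.
      have [wC|wC] := boolP (w \in C); rewrite ?scale1r ?scale0r => h; [left|right]; split => //.
        exact: set_mem.
      by move=> /mem_set; apply/negP.
    by case=> -[wC h]; [rewrite (mem_set wC) scale1r|rewrite memNset// scale0r].
  apply: measurableU; apply: measurableI => //; first exact: borel_open.
    exact: measurableC.
  have [U0|U0] := pselect (U 0).
    by rewrite (_ : [set _ | _] = setT)//; apply/seteqP; split.
  by rewrite (_ : [set _ | _] = set0)//; apply/seteqP; split.
apply: (borel_lim mv) => w.
suff [T hT] : exists T, hs_norm ((\1_C w : R)%:C *: u n w - T) @[n --> \oo] --> (0 : R).
  by rewrite (hs_limP hT).
apply: hs_complete => e e0; rewrite indicE.
have [/set_mem wC|wC] := boolP (w \in C); last first.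
  by exists 0%N => m n _ _; rewrite !scale0r subrr hs_norm0 ltW.
have [p hp] : exists p : nat, p.+1%:R^-1 <= e.
  near \oo => p; exists p; near: p; apply: filterS (near_infty_natSinv_lt (PosNum e0)) => p.
  exact: ltW.
have [N HN] := wC p; exists N => m n Nm Nn; rewrite !scale1r.
exact: le_trans (HN _ _ Nm Nn) hp.
Unshelve. all: by end_near. Qed.

End BorelOperations.

(** * Moments of random operators *)

Section IntegralBounds.
Context {R : realType} {d : measure_display} {W : measurableType d}.
Variable P : probability W R.
Implicit Types (f g : W -> R) (a b c K : R).

Definition int_le f K : Prop := (\int[P]_w (f w)%:E <= K%:E)%E.

Lemma int_le_mono f g K : measurable_fun setT f -> measurable_fun setT g ->
  (forall w, 0 <= f w) -> (forall w, f w <= g w) -> int_le g K -> int_le f K.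
Proof.
move=> mf mg f0 fg; apply: le_trans; apply: ge0_le_integral => //.
- by move=> w _; rewrite lee_fin.
- exact/measurable_EFinP.
- exact/measurable_EFinP.
- by move=> w _; rewrite lee_fin.
Qed.

Lemma int_leK f K K' : K <= K' -> int_le f K -> int_le f K'.
Proof. by move=> KK /le_trans; apply; rewrite lee_fin. Qed.

Lemma int_leD f g a b : measurable_fun setT f -> measurable_fun setT g ->
  (forall w, 0 <= f w) -> (forall w, 0 <= g w) ->
  int_le f a -> int_le g b -> int_le (fun w => f w + g w) (a + b).
Proof.
move=> mf mg f0 g0 fa gb; rewrite /int_le.
under eq_integral do rewrite EFinD.
rewrite ge0_integralD//; [|by move=> w _; rewrite lee_fin|exact/measurable_EFinP
  |by move=> w _; rewrite lee_fin|exact/measurable_EFinP].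
by rewrite EFinD; exact: leeD.
Qed.

Lemma int_leZ f a c : measurable_fun setT f -> (forall w, 0 <= f w) -> 0 <= c ->
  int_le f a -> int_le (fun w => c * f w) (c * a).
Proof.
move=> mf f0 c0 fa; rewrite /int_le.
under eq_integral do rewrite EFinM.
rewrite ge0_integralZl//; [|exact/measurable_EFinP|by move=> w _; rewrite lee_fin].
by rewrite EFinM; apply: lee_wpmul2l => //; rewrite lee_fin.
Qed.

Lemma int_le_cst c : int_le (fun=> c) c.
Proof. by rewrite /int_le integral_cst//= probability_setT mule1. Qed.

End IntegralBounds.

Section RandomOperators.
Context {R : realType} {E : sepHilbert R} {d : measure_display} {W : measurableType d}.
Implicit Types (X Y : W -> hs_op E).

(** Pointwise operations are named, so that moment bounds can be rewritten along
    the algebraic identities below. *)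
Definition rvD X Y : W -> hs_op E := fun w => X w + Y w.
Definition rvB X Y : W -> hs_op E := fun w => X w - Y w.
Definition rvZ (z : R[i]) X : W -> hs_op E := fun w => z *: X w.
Definition rvM X Y : W -> hs_op E := fun w => hs_comp (X w) (Y w).
Definition rvA X : W -> hs_op E := fun w => hs_adj (X w).

Lemma borel_rvD X Y : borel_rv X -> borel_rv Y -> borel_rv (rvD X Y).
Proof. exact: borelD. Qed.
Lemma borel_rvB X Y : borel_rv X -> borel_rv Y -> borel_rv (rvB X Y).
Proof. exact: borelB. Qed.
Lemma borel_rvZ z X : borel_rv X -> borel_rv (rvZ z X).
Proof. exact: borelZ. Qed.
Lemma borel_rvM X Y : borel_rv X -> borel_rv Y -> borel_rv (rvM X Y).
Proof. exact: borel_comp. Qed.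
Lemma borel_rvA X : borel_rv X -> borel_rv (rvA X).
Proof. exact: borel_adj. Qed.

Lemma rvBK X Y : rvD (rvB X Y) Y = X.
Proof. by apply/funext => w; rewrite /rvD /rvB subrK. Qed.
Lemma rvZB z X Y : rvB (rvZ z X) (rvZ z Y) = rvZ z (rvB X Y).
Proof. by apply/funext => w; rewrite /rvB /rvZ scalerBr. Qed.
Lemma rvBD X Y X' Y' : rvB (rvD X Y) (rvD X' Y') = rvD (rvB X X') (rvB Y Y').
Proof. by apply/funext => w; rewrite /rvB /rvD opprD addrACA. Qed.
Lemma rvBM X Y X' Y' : rvB (rvM X Y) (rvM X' Y') = rvD (rvM (rvB X X') Y) (rvM X' (rvB Y Y')).
Proof.
apply/funext => w; apply: val_inj; apply/funext => x /=.
rewrite -[LHS]/(X w (Y w x) - X' w (Y' w x)).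
rewrite -[RHS]/(X w (Y w x) - X' w (Y w x) + X' w (Y w x - Y' w x)).
by rewrite linearB/= addrA subrK.
Qed.
Lemma rvB_triangle X Y Z : rvB X Z = rvD (rvB X Y) (rvB Y Z).
Proof. by apply/funext => w; rewrite /rvB /rvD addrA subrK. Qed.
Lemma rvBN X Y : rvB X Y = rvD X (rvZ (-1) Y).
Proof. by apply/funext => w; rewrite /rvB /rvD /rvZ scaleN1r. Qed.

End RandomOperators.

Section Moments.
Context {R : realType} {E : sepHilbert R} {d : measure_display} {W : measurableType d}.
Variable P : probability W R.
Implicit Types (X Y : W -> hs_op E) (a b c K : R) (n : nat).

Definition mom_le n X K : Prop := int_le P (fun w => hs_norm (X w) ^+ n) K.

Lemma measurable_mom n X : borel_rv X -> measurable_fun setT (fun w => hs_norm (X w) ^+ n).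
Proof. by move=> mX; apply: measurable_funX; exact: borel_norm. Qed.

Lemma mom_ge0 n X w : 0 <= hs_norm (X w) ^+ n.
Proof. by rewrite exprn_ge0 ?hs_norm_ge0. Qed.

(** The larger of the two terms bounds half the sum. *)
Lemma exprD_le (a b : R) n : 0 <= a -> 0 <= b -> (a + b) ^+ n <= 2 ^+ n * (a ^+ n + b ^+ n).
Proof.
move=> a0 b0; wlog ab : a b a0 b0 / a <= b => [hw|].
  by have [/hw|/ltW/hw] := leP a b; [apply|rewrite addrC (addrC (a ^+ n)); apply].
apply: (@le_trans _ _ ((2 * b) ^+ n)).
  by rewrite lerXn2r ?nnegrE ?addr_ge0 ?mulr_ge0//; lra.
rewrite exprMn; apply: ler_wpM2l; first by rewrite exprn_ge0.
by rewrite lerDr exprn_ge0.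
Qed.

Lemma mom_le_mono n X Y K : borel_rv X -> borel_rv Y ->
  (forall w, hs_norm (X w) <= hs_norm (Y w)) -> mom_le n Y K -> mom_le n X K.
Proof.
move=> mX mY h; apply: int_le_mono; [exact: measurable_mom|exact: measurable_mom|exact: mom_ge0|].
by move=> w; rewrite lerXn2r// nnegrE hs_norm_ge0.
Qed.

Lemma mom_leD n X Y a b : borel_rv X -> borel_rv Y -> mom_le n X a -> mom_le n Y b ->
  mom_le n (rvD X Y) (2 ^+ n * (a + b)).
Proof.
move=> mX mY hX hY.
have mXn := measurable_mom n mX; have mYn := measurable_mom n mY.
apply: (@int_le_mono _ _ _ _ _ (fun w => 2 ^+ n * (hs_norm (X w) ^+ n + hs_norm (Y w) ^+ n))).
- by apply: measurable_mom; exact: borelD.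
- by apply: measurable_funM => //; exact: measurable_funD.
- by move=> w; rewrite exprn_ge0 ?hs_norm_ge0.
- move=> w; apply: le_trans (exprD_le _ (hs_norm_ge0 _) (hs_norm_ge0 _)).
  by rewrite lerXn2r ?nnegrE ?addr_ge0 ?hs_norm_ge0 ?hs_normD.
apply: int_leZ.
- exact: measurable_funD.
- by move=> w; rewrite addr_ge0 ?mom_ge0.
- by rewrite exprn_ge0.
- by apply: int_leD => // w; exact: mom_ge0.
Qed.

Lemma mom_leB n X Y a b : borel_rv X -> borel_rv Y -> mom_le n X a -> mom_le n Y b ->
  mom_le n (rvB X Y) (2 ^+ n * (a + b)).
Proof.
move=> mX mY hX hY.
rewrite rvBN; have mZ := borel_rvZ (-1) mY.
apply: (mom_leD mX mZ hX); apply: (mom_le_mono mZ mY _ hY) => w.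
by rewrite /rvZ scaleN1r hs_normN.
Qed.

Lemma mom_leZ n (z : R[i]) X a : borel_rv X -> mom_le n X a ->
  mom_le n (rvZ z X) (cabs z ^+ n * a).
Proof.
move=> mX hX; rewrite /mom_le /rvZ.
have -> : (fun w => hs_norm (z *: X w) ^+ n) = (fun w => cabs z ^+ n * hs_norm (X w) ^+ n).
  by apply/funext => w; rewrite hs_normZc exprMn.
apply: int_leZ => //; [exact: measurable_mom|by move=> w; exact: mom_ge0|].
by rewrite exprn_ge0 ?cabs_ge0.
Qed.

(** Cauchy--Schwarz in the form [x y <= t x^2 + y^2/t], where [t] is chosen later
    to make a product of a small and a bounded factor small. *)
Lemma mom_le_comp n X Y a b t : borel_rv X -> borel_rv Y -> 0 < t ->
  mom_le (n + n) X a -> mom_le (n + n) Y b ->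
  mom_le n (rvM X Y) (t * a + t^-1 * b).
Proof.
move=> mX mY t0 hX hY.
have mXn := measurable_mom (n + n) mX; have mYn := measurable_mom (n + n) mY.
have t0' := ltW t0; have ti0 : 0 <= t^-1 by rewrite invr_ge0.
apply: (@int_le_mono _ _ _ _ _ (fun w => t * hs_norm (X w) ^+ (n + n) + t^-1 * hs_norm (Y w) ^+ (n + n))).
- by apply: measurable_mom; exact: borel_comp.
- by apply: measurable_funD; apply: measurable_funM.
- by move=> w; rewrite exprn_ge0 ?hs_norm_ge0.
- move=> w; apply: (@le_trans _ _ ((hs_norm (X w) * hs_norm (Y w)) ^+ n)).
    by rewrite lerXn2r ?nnegrE ?mulr_ge0 ?hs_norm_ge0 ?hs_comp_norm.
  rewrite exprMn !exprD.
  set x := hs_norm (X w) ^+ n; set y := hs_norm (Y w) ^+ n.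
  have x0 : 0 <= x by exact: mom_ge0.
  have y0 : 0 <= y by exact: mom_ge0.
  clearbody x y.
  rewrite -subr_ge0.
  have -> : t * (x * x) + t^-1 * (y * y) - x * y = (t * x - y) ^+ 2 / t + x * y.
    by field; rewrite gt_eqF.
  by apply: addr_ge0; apply: mulr_ge0 => //; exact: sqr_ge0.
by apply: int_leD; [exact: measurable_funM|exact: measurable_funM
  |by move=> w; rewrite mulr_ge0 ?mom_ge0|by move=> w; rewrite mulr_ge0 ?mom_ge0
  |apply: int_leZ => // w; exact: mom_ge0|apply: int_leZ => // w; exact: mom_ge0].
Qed.

(** The [p]-th power of the norm is bounded by [eps^p] where the norm is at most
    [eps], and by a multiple of its [n]-th power elsewhere. *)
Lemma Lnorm_mom_le n X (p eps : R) : borel_rv X -> 1 <= p -> p <= n%:R -> 0 < eps ->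
  mom_le n X (eps ^+ n) -> (hs_Lnorm P p X <= (2 * eps)%:E)%E.
Proof.
move=> mX p1 pn e0 hX.
have p0 : 0 < p by exact: lt_le_trans p1.
have e0' := ltW e0.
have mXn := measurable_mom n mX.
rewrite /hs_Lnorm Lnorm.unlock.
have -> : (\int[P]_x `|(hs_norm (X x))%:E| `^ p = \int[P]_x (powR (hs_norm (X x)) p)%:E)%E.
  apply: eq_integral => w _.
  by rewrite /= ger0_norm ?hs_norm_ge0// poweR_EFin.
have key : int_le P (fun w => powR (hs_norm (X w)) p) (powR eps p + powR eps p).
  have -> : powR eps p + powR eps p = powR eps p + powR eps p / eps ^+ n * eps ^+ n.
    by rewrite divfK// gt_eqF// exprn_gt0.
  apply: (@int_le_mono _ _ _ _ _ (fun w => powR eps p + powR eps p / eps ^+ n * hs_norm (X w) ^+ n)).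
  - by apply: (measurableT_comp (measurable_powR p)); exact: borel_norm.
  - by apply: measurable_funD => //; apply: measurable_funM.
  - by move=> w; rewrite powR_ge0.
  - move=> w; have [xe|ex] := leP (hs_norm (X w)) eps.
      apply: (@le_trans _ _ (powR eps p)).
        by apply: ge0_ler_powR; rewrite ?nnegrE ?hs_norm_ge0 ?(ltW p0).
      by rewrite lerDl mulr_ge0 ?mom_ge0// divr_ge0 ?powR_ge0 ?exprn_ge0.
    have x0 : 0 < hs_norm (X w) by exact: lt_trans ex.
    apply: (@le_trans _ _ (powR eps p / eps ^+ n * hs_norm (X w) ^+ n)); last by rewrite lerDr powR_ge0.
    set y := hs_norm (X w) / eps.
    have y1 : 1 <= y by rewrite /y ler_pdivlMr// mul1r ltW.
    have xE : hs_norm (X w) = eps * y by rewrite /y mulrC divfK// gt_eqF.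
    rewrite xE powRM//; last by rewrite (le_trans _ y1).
    rewrite -mulrA; apply: ler_wpM2l; first exact: powR_ge0.
    rewrite exprMn mulKf; last by rewrite gt_eqF// exprn_gt0.
    by rewrite -powR_mulrn ?(le_trans _ y1)//; exact: ler_powR.
  apply: int_leD => //.
  - exact: measurable_funM.
  - by move=> w; rewrite powR_ge0.
  - by move=> w; rewrite mulr_ge0 ?mom_ge0// divr_ge0 ?powR_ge0 ?exprn_ge0.
  - exact: int_le_cst.
  - by apply: int_leZ => //; [move=> w; exact: mom_ge0|rewrite divr_ge0 ?powR_ge0 ?exprn_ge0].
apply: (@le_trans _ _ ((powR eps p + powR eps p)%:E `^ p^-1)%E).
  apply: gt0_ler_poweR.
  - by rewrite invr_ge0 ltW.
  - by rewrite in_itv/= leey andbT; apply: integral_ge0 => w _; rewrite lee_fin powR_ge0.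
  - by rewrite in_itv/= leey andbT lee_fin addr_ge0 ?powR_ge0.
  - exact: key.
rewrite poweR_EFin lee_fin -mulr2n -[_ *+ 2]mulr_natl powRM ?powR_ge0// -powRrM divff ?gt_eqF// powRr1//.
apply: ler_wpM2r => //; rewrite -[leRHS]powRr1//; apply: ler_powR; first by rewrite ler1n.
by rewrite invf_le1.
Qed.

Lemma mom_le_Lnorm2 X (eps : R) : borel_rv X -> 0 <= eps ->
  (hs_Lnorm P 2 X <= eps%:E)%E -> mom_le 2 X (eps ^+ 2).
Proof.
move=> mX e0 h; rewrite /mom_le /int_le.
have -> : (\int[P]_w (hs_norm (X w) ^+ 2)%:E = (hs_Lnorm P 2 X) `^ 2)%E.
  rewrite /hs_Lnorm powR_Lnorm//; apply: eq_integral => w _.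
  by rewrite /= ger0_norm ?hs_norm_ge0// powR_mulrn ?hs_norm_ge0.
have -> : (eps ^+ 2)%:E = (eps%:E `^ 2)%E :> \bar R by rewrite poweR_EFin powR_mulrn.
apply: gt0_ler_poweR => //.
- by rewrite in_itv/= leey andbT Lnorm_ge0.
- by rewrite in_itv/= leey andbT lee_fin.
Qed.

End Moments.

Section MomentConvergence.
Context {R : realType} {E : sepHilbert R} {d : measure_display} {W : measurableType d}.
Variable P : probability W R.
Implicit Types (U V : nat -> W -> hs_op E) (X Y : W -> hs_op E).

(** Convergence in all [L^n] at once: unlike convergence in one [L^p], it is
    stable under products. The responses are defined for positive block sizes
    only, so nothing is asked of index [0]. *)
Definition cvg_moments U X : Prop :=
  [/\ (forall N, (0 < N)%N -> borel_rv (U N)), borel_rv X,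
      (forall n N, (0 < N)%N -> exists K, mom_le P n (U N) K),
      (forall n, exists K, mom_le P n X K)
    & forall n (eps : R), (0 < n)%N -> 0 < eps ->
        \forall N \near \oo, mom_le P n (rvB (U N) X) eps].

Lemma mom_le_ge0 n X K : mom_le P n X K -> 0 <= K.
Proof.
move=> h; rewrite -lee_fin; apply: le_trans h; apply: integral_ge0 => w _.
by rewrite lee_fin mom_ge0.
Qed.

Lemma cvg_momentsZ (z : R[i]) U X : cvg_moments U X ->
  cvg_moments (fun N => rvZ z (U N)) (rvZ z X).
Proof.
move=> [mU mX bU bX cU]; split.
- by move=> N N0; apply: borel_rvZ; exact: mU.
- exact: borel_rvZ.
- move=> n N N0; have [K HK] := bU n N N0; exists (cabs z ^+ n * K).
  by apply: mom_leZ => //; exact: mU.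
- by move=> n; have [K HK] := bX n; exists (cabs z ^+ n * K); exact: mom_leZ.
move=> n eps n0 e0.
pose c := cabs z ^+ n + 1.
have c0 : 0 < c by rewrite ltr_wpDl// exprn_ge0 ?cabs_ge0.
have e'0 : 0 < eps / c by rewrite divr_gt0.
have HU := cU n _ n0 e'0.
near=> N.
have N0 : (0 < N)%N by near: N; exact: nbhs_infty_gt.
rewrite rvZB; apply: (@int_leK _ _ _ _ _ (cabs z ^+ n * (eps / c))).
  by rewrite mulrCA ler_piMr ?(ltW e0)// ler_pdivrMr// mul1r lerDl.
apply: mom_leZ; first by apply: borel_rvB => //; exact: mU.
by near: N; exact: HU.
Unshelve. all: by end_near. Qed.

Lemma cvg_moments_adj U X : cvg_moments U X ->
  cvg_moments (fun N => rvA (U N)) (rvA X).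
Proof.
have adjE n Z K : mom_le P n (rvA Z) K = mom_le P n Z K.
  rewrite /mom_le; suff -> : (fun w => hs_norm (rvA Z w) ^+ n) = (fun w => hs_norm (Z w) ^+ n) by [].
  by apply/funext => w; rewrite /rvA hs_adj_norm.
have adjBE n Z Z' K : mom_le P n (rvB (rvA Z) (rvA Z')) K = mom_le P n (rvB Z Z') K.
  rewrite /mom_le; suff -> : (fun w => hs_norm (rvB (rvA Z) (rvA Z') w) ^+ n) = (fun w => hs_norm (rvB Z Z' w) ^+ n) by [].
  by apply/funext => w; rewrite /rvA /rvB hs_adjB.
move=> [mU mX bU bX cU]; split.
- by move=> N N0; apply: borel_rvA; exact: mU.
- exact: borel_rvA.
- by move=> n N N0; have [K HK] := bU n N N0; exists K; rewrite adjE.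
- by move=> n; have [K HK] := bX n; exists K; rewrite adjE.
by move=> n eps n0 e0; apply: filterS (cU n eps n0 e0) => N; rewrite adjBE.
Qed.

Lemma cvg_momentsD U V X Y : cvg_moments U X -> cvg_moments V Y ->
  cvg_moments (fun N => rvD (U N) (V N)) (rvD X Y).
Proof.
move=> [mU mX bU bX cU] [mV mY bV bY cV]; split.
- by move=> N N0; apply: borel_rvD; [exact: mU|exact: mV].
- exact: borel_rvD.
- move=> n N N0; have [K HK] := bU n N N0; have [L HL] := bV n N N0.
  by exists (2 ^+ n * (K + L)); apply: mom_leD => //; [exact: mU|exact: mV].
- move=> n; have [K HK] := bX n; have [L HL] := bY n.
  by exists (2 ^+ n * (K + L)); exact: mom_leD.
move=> n eps n0 e0.
pose e' := eps / (2 ^+ n * 2).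
have e'0 : 0 < e' by rewrite divr_gt0// mulr_gt0 ?exprn_gt0.
have HUV := filterI (cU n _ n0 e'0) (cV n _ n0 e'0).
near=> N.
have N0 : (0 < N)%N by near: N; exact: nbhs_infty_gt.
have mUX : borel_rv (rvB (U N) X) by apply: borel_rvB => //; exact: mU.
have mVY : borel_rv (rvB (V N) Y) by apply: borel_rvB => //; exact: mV.
have [hUX hVY] : mom_le P n (rvB (U N) X) e' /\ mom_le P n (rvB (V N) Y) e'.
  by near: N; exact: HUV.
rewrite rvBD; apply: int_leK (mom_leD mUX mVY hUX hVY).
by rewrite le_eqVlt /e'; apply/orP; left; apply/eqP; field; rewrite expf_neq0.
Unshelve. all: by end_near. Qed.

Lemma cvg_moments_bound V Y n : cvg_moments V Y -> (0 < n)%N ->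
  exists2 K : R, 0 <= K & \forall N \near \oo, mom_le P n (V N) K.
Proof.
move=> [mV mY bV bY cV] n0; have [L HL] := bY n.
have L0 := mom_le_ge0 HL.
exists (2 ^+ n * (1 + L)); first by rewrite mulr_ge0 ?exprn_ge0// addr_ge0.
have HV := cV n 1 n0 ltr01.
near=> N.
have N0 : (0 < N)%N by near: N; exact: nbhs_infty_gt.
rewrite -(rvBK (V N) Y).
apply: mom_leD => //; first by apply: borel_rvB => //; exact: mV.
by near: N; exact: HV.
Unshelve. all: by end_near. Qed.

(** [U V - X Y = (U - X) V + X (V - Y)]: in each term one factor is small and the
    other has bounded moments of twice the order. *)
Lemma cvg_moments_comp U V X Y : cvg_moments U X -> cvg_moments V Y ->
  cvg_moments (fun N => rvM (U N) (V N)) (rvM X Y).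
Proof.
move=> hU hV; have [mU mX bU bX cU] := hU; have [mV mY bV bY cV] := hV; split.
- by move=> N N0; apply: borel_rvM; [exact: mU|exact: mV].
- exact: borel_rvM.
- move=> n N N0; have [K HK] := bU (n + n)%N N N0; have [L HL] := bV (n + n)%N N N0.
  by exists (1 * K + 1^-1 * L); apply: mom_le_comp => //; [exact: mU|exact: mV].
- move=> n; have [K HK] := bX (n + n)%N; have [L HL] := bY (n + n)%N.
  by exists (1 * K + 1^-1 * L); exact: mom_le_comp.
move=> n eps n0 e0.
have nn0 : (0 < n + n)%N by rewrite addn_gt0 n0.
have [K K0 HK] := cvg_moments_bound hV nn0.
have [L HL] := bX (n + n)%N; have L0 := mom_le_ge0 HL.
pose D := eps / (2 ^+ n * 4).
have D0 : 0 < D by rewrite divr_gt0// mulr_gt0 ?exprn_gt0.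
(* the weights [t] and [s] absorb the bounds [K] and [L] of the other factors *)
pose t := D / (K + 1).
have t0 : 0 < t by rewrite divr_gt0// ltr_wpDl.
have tK : t * K <= D by rewrite /t mulrAC ler_pdivrMr ?ltr_wpDl// ler_pM2l// lerDl.
pose s := D / (L + 1).
have s0 : 0 < s by rewrite divr_gt0// ltr_wpDl.
have sL : s * L <= D by rewrite /s mulrAC ler_pdivrMr ?ltr_wpDl// ler_pM2l// lerDl.
have tD0 : 0 < t * D by rewrite mulr_gt0.
have sD0 : 0 < s * D by rewrite mulr_gt0.
have HU := cU _ _ nn0 tD0; have HV := cV _ _ nn0 sD0.
have ti0 : 0 < t^-1 by rewrite invr_gt0.
near=> N.
have N0 : (0 < N)%N by near: N; exact: nbhs_infty_gt.
have mUX : borel_rv (rvB (U N) X) by apply: borel_rvB => //; exact: mU.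
have mVY : borel_rv (rvB (V N) Y) by apply: borel_rvB => //; exact: mV.
have hVN : mom_le P (n + n) (V N) K by near: N; exact: HK.
have hUX : mom_le P (n + n) (rvB (U N) X) (t * D) by near: N; exact: HU.
have hVY : mom_le P (n + n) (rvB (V N) Y) (s * D) by near: N; exact: HV.
rewrite rvBM.
apply: (@int_leK _ _ _ _ _ (2 ^+ n * ((t^-1 * (t * D) + t^-1^-1 * K) + (s * L + s^-1 * (s * D))))).
  have -> : eps = 2 ^+ n * (D + D + (D + D)).
    by rewrite /D; field; rewrite expf_neq0.
  rewrite ler_pM2l ?exprn_gt0// invrK !mulKf ?gt_eqF//.
  by apply: lerD; [rewrite lerD2l|rewrite lerD2r].
apply: mom_leD.
- by apply: borel_rvM => //; exact: mV.
- exact: borel_rvM.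
- by apply: mom_le_comp => //; exact: mV.
- exact: mom_le_comp.
Unshelve. all: by end_near. Qed.

Lemma mom_le0 n K : (0 < n)%N -> 0 <= K -> mom_le P n (fun _ => 0 : hs_op E) K.
Proof.
move=> n0 K0; apply: (@int_leK _ _ _ _ _ (hs_norm (0 : hs_op E) ^+ n)); last exact: int_le_cst.
by rewrite hs_norm0 expr0n -[n]prednK.
Qed.

Lemma cvg_moments0 : cvg_moments (fun _ _ => 0) (fun _ => 0).
Proof.
have h n : exists K, mom_le P n (fun _ => 0 : hs_op E) K.
  by exists (hs_norm (0 : hs_op E) ^+ n); exact: int_le_cst.
have m0 : borel_rv (fun _ : W => 0 : hs_op E) by exact: borel_cst.
split => //.
move=> n eps n0 e0; apply: nearW => N.
have -> : rvB (fun _ : W => 0 : hs_op E) (fun=> 0) = fun=> 0.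
  by apply/funext => w; rewrite /rvB subrr.
by apply: mom_le0 => //; exact: ltW.
Qed.

(** Words are built letter by letter from the left, following the fold in the
    evaluation of a word. *)
Lemma cvg_moments_star_poly k (q : star_poly R k) (U : nat -> 'I_k -> W -> hs_op E)
    (X : 'I_k -> W -> hs_op E) :
  (forall i, cvg_moments (fun N => U N i) (X i)) ->
  cvg_moments (fun N w => star_poly_eval q (U N ^~ w)) (fun w => star_poly_eval q (X ^~ w)).
Proof.
move=> h.
pose lt N l : W -> hs_op E := fun w => star_letter_eval (U N ^~ w) l.
pose lt' l : W -> hs_op E := fun w => star_letter_eval (X ^~ w) l.
have letter l : cvg_moments (lt ^~ l) (lt' l).
  rewrite /lt /lt' /star_letter_eval; case: l => i [] /=; last exact: h.
  exact: (cvg_moments_adj (h i)).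
pose wd N (G : W -> hs_op E) (v : seq (star_letter k)) : W -> hs_op E :=
  foldl (fun S l => rvM S (lt N l)) G v.
pose wd' (G : W -> hs_op E) (v : seq (star_letter k)) : W -> hs_op E :=
  foldl (fun S l => rvM S (lt' l)) G v.
have wdE N G v w : wd N G v w = foldl (fun S l => hs_comp S (star_letter_eval (U N ^~ w) l)) (G w) v.
  by elim: v G => //= l v IHv G; rewrite IHv.
have wdE' G v w : wd' G v w = foldl (fun S l => hs_comp S (star_letter_eval (X ^~ w) l)) (G w) v.
  by elim: v G => //= l v IHv G; rewrite IHv.
have word v G Z : cvg_moments G Z -> cvg_moments (fun N => wd N (G N) v) (wd' Z v).
  elim: v G Z => [//|l v IHv] G Z cG /=.
  apply: (IHv (fun N => rvM (G N) (lt N l)) (rvM Z (lt' l))).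
  exact: (cvg_moments_comp cG (letter l)).
elim: q => [|[a [l v]] q IH].
  have -> : (fun N w => star_poly_eval [::] (U N ^~ w)) = (fun _ _ => 0).
    by apply/funext => N; apply/funext => w; rewrite /star_poly_eval big_nil.
  have -> : (fun w => star_poly_eval [::] (X ^~ w)) = (fun _ => 0).
    by apply/funext => w; rewrite /star_poly_eval big_nil.
  exact: cvg_moments0.
have -> : (fun N w => star_poly_eval ((a, (l, v)) :: q) (U N ^~ w)) =
    (fun N => rvD (rvZ a (wd N (lt N l) v)) (fun w => star_poly_eval q (U N ^~ w))).
  apply/funext => N; apply/funext => w; rewrite /star_poly_eval big_cons /rvD /rvZ.
  by rewrite wdE.
have -> : (fun w => star_poly_eval ((a, (l, v)) :: q) (X ^~ w)) =
    (rvD (rvZ a (wd' (lt' l) v)) (fun w => star_poly_eval q (X ^~ w))).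
  by apply/funext => w; rewrite /star_poly_eval big_cons /rvD /rvZ wdE'.
apply: (cvg_momentsD _ IH); apply: cvg_momentsZ.
exact: (word v (lt ^~ l) (lt' l) (letter l)).
Qed.

Lemma mom_le_pow n X K : (0 < n)%N -> mom_le P n X K -> exists2 eps : R, 0 < eps & mom_le P n X (eps ^+ n).
Proof.
move=> n0 h; have K0 := mom_le_ge0 h; exists (K + 1); first by rewrite ltr_wpDl.
apply: int_leK h; apply: (@le_trans _ _ (K + 1)); first by rewrite lerDl.
by rewrite ler_eXnr// lerDr.
Qed.

(** Any [p] is below some integer [n], and a small [n]-th moment bounds the [L^p]
    norm on a probability space. *)
Lemma cvg_moments_Lp U X (p : R) : 1 <= p -> cvg_moments U X -> cvg_Lp P p U X.
Proof.
move=> p1 [mU mX bU bX cU].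
pose n := (Num.truncn p).+1.
have pn : p <= n%:R by rewrite ltW// truncnS_gt.
have fin (Z : W -> hs_op E) K : borel_rv Z -> mom_le P n Z K -> (hs_Lnorm P p Z < +oo)%E.
  move=> mZ hZ; have [e e0 h] := mom_le_pow (isT : (0 < n)%N) hZ.
  by apply: le_lt_trans (Lnorm_mom_le mZ p1 pn e0 h) _; rewrite ltry.
split.
- by move=> N N0; have [K HK] := bU n N N0; split; [exact: mU|apply: fin HK; exact: mU].
- by have [K HK] := bX n; split => //; exact: fin HK.
apply/fine_cvgP; split.
  have h1 := cU n 1 isT ltr01.
  near=> N; rewrite ge0_fin_numE ?Lnorm_ge0//; apply: (@fin _ 1).
    apply: borel_rvB => //; apply: mU; near: N; exact: nbhs_infty_gt.
  by near: N.
apply/cvgrPdist_le => eps e0.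
have e20 : 0 < eps / 2 by rewrite divr_gt0.
have h1 := cU n ((eps / 2) ^+ n) isT (exprn_gt0 _ e20).
near=> N.
have mN : borel_rv (rvB (U N) X).
  apply: borel_rvB => //; apply: mU; near: N; exact: nbhs_infty_gt.
have hN : mom_le P n (rvB (U N) X) ((eps / 2) ^+ n) by near: N.
have H := Lnorm_mom_le mN p1 pn e20 hN.
rewrite sub0r normrN ger0_norm ?fine_ge0 ?Lnorm_ge0//=.
rewrite -lee_fin fineK; first by apply: le_trans H _; rewrite lee_fin mulrCA divff// mulr1.
by rewrite ge0_fin_numE ?Lnorm_ge0//; apply: le_lt_trans H _; rewrite ltry.
Unshelve. all: by end_near. Qed.

End MomentConvergence.

(** * Hypercontractivity on the discrete cube *)

Section TwoPoint.
Context {R : realType}.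

(** Here [u] and [v] stand for the squared norms of a function at the two values
    of a sign, [A] and [B] for those of its even and odd parts. The recursion for
    the means of [u^i] and [v^i] shows that each step multiplies the mean by at
    most [A + B + 4 r B], the odd contribution being at most [4 i B] times the
    mean. *)
Lemma two_point (r : nat) (u v A B : R) : 0 <= u -> 0 <= v -> 0 <= A -> 0 <= B ->
  u + v = 2 * (A + B) -> (u - v) ^+ 2 <= 16 * (A * B) ->
  u ^+ r + v ^+ r <= 2 * (A + (4 * r%:R + 1) * B) ^+ r.
Proof.
move=> u0 v0 A0 B0 uv duv.
pose m := A + B; pose dl := (u - v) / 2.
have uE : u = m + dl by rewrite /m /dl; lra.
have vE : v = m - dl by rewrite /m /dl; lra.
have m0 : 0 <= m by rewrite addr_ge0.
have dl2 : dl ^+ 2 <= 4 * (m * B).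
  have : dl ^+ 2 = (u - v) ^+ 2 / 4 by rewrite /dl; field.
  have : 0 <= B * B by rewrite mulr_ge0.
  by rewrite /m mulrDl => h ->; lra.
pose ev i := (u ^+ i + v ^+ i) / 2; pose od i := dl * (u ^+ i - v ^+ i) / 2.
have evS i : ev i.+1 = m * ev i + od i by rewrite /ev /od !exprS uE vE; field.
have odS i : od i.+1 = m * od i + dl ^+ 2 * ev i by rewrite /ev /od !exprS uE vE; field.
have ev0 i : 0 <= ev i by rewrite divr_ge0// addr_ge0// exprn_ge0.
have od0 i : 0 <= od i /\ od i <= 4 * i%:R * B * ev i.
  elim: i => [|i [IH0 IH1]]; first by rewrite /od !expr0 subrr mulr0 mul0r mulr0 !mul0r.
  rewrite odS; split.
    by apply: addr_ge0; apply: mulr_ge0 => //; exact: sqr_ge0.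
  apply: (@le_trans _ _ (4 * i.+1%:R * B * (m * ev i))).
    have h1 := ler_wpM2l m0 IH1; have h2 := ler_wpM2r (ev0 i) dl2.
    apply: le_trans (lerD h1 h2) _; rewrite -natr1 le_eqVlt; apply/orP; left; apply/eqP; ring.
  apply: ler_wpM2l; first by rewrite !mulr_ge0.
  by rewrite evS lerDl.
have key i : (i <= r)%N -> ev i <= (m + 4 * r%:R * B) ^+ i.
  elim: i => [|i IH] ir; first by rewrite /ev !expr0; lra.
  rewrite evS exprS; apply: (@le_trans _ _ ((m + 4 * r%:R * B) * ev i)); last first.
    apply: ler_wpM2l; first by rewrite addr_ge0// !mulr_ge0.
    by apply: IH; exact: ltnW.
  rewrite [leRHS]mulrDl lerD2l; apply: le_trans (od0 i).2 _.
  apply: ler_wpM2r => //; apply: ler_wpM2r => //; apply: ler_wpM2l => //.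
  by rewrite ler_nat ltnW.
have := key r (leqnn r); rewrite /ev ler_pdivrMr// mulrC => h.
apply: le_trans h _; rewrite ler_pM2l// le_eqVlt; apply/orP; left; apply/eqP.
by congr (_ ^+ _); rewrite /m; ring.
Qed.

End TwoPoint.

Section Hypercontractivity.
Context {R : realType} {E : sepHilbert R} {I : eqType}.
Variable c : R.
Local Notation V := (hs_op E).
Implicit Types (f : (I -> R) -> V) (s : seq I).

Lemma savgD s (G H : (I -> R) -> R) x : savg s (fun z => G z + H z) x = savg s G x + savg s H x.
Proof. by elim: s x => //= i s IH x; rewrite !IH; field. Qed.

Lemma updC (x : I -> R) i k a b : i != k -> upd (upd x i a) k b = upd (upd x k b) i a.
Proof.
move=> ik; apply/funext => l; rewrite /upd; case: (eqVneq l k) => [->|//].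
by rewrite eq_sym (negPf ik).
Qed.

Lemma savg_upd s (G : (I -> R) -> R) x t a : t \notin s ->
  savg s G (upd x t a) = savg s (fun z => G (upd z t a)) x.
Proof.
elim: s x => [//|i s IH] x /=; rewrite inE negb_or => /andP[ti ts].
by rewrite !(updC _ _ _ ti) !IH.
Qed.

(** The odd part carries the weight [c], so that after all signs are processed a
    Walsh coefficient of degree [k] has been multiplied by [c^k]. *)
Definition ev_part (t : I) f : (I -> R) -> V :=
  fun z => (2^-1)%:C *: (f (upd z t 1) + f (upd z t (-1))).
Definition od_part (t : I) f : (I -> R) -> V :=
  fun z => (c / 2)%:C *: (f (upd z t 1) - f (upd z t (-1))).

(** The squared norm of [f] with Walsh coefficients of degree [k] weighted by
    [c^(2k)], computed by splitting off one sign at a time. *)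
Fixpoint wsum s f (x : I -> R) : R :=
  if s is t :: s' then wsum s' (ev_part t f) x + wsum s' (od_part t f) x
  else hs_norm (f x) ^+ 2.

Lemma wsum_ge0 s f x : 0 <= wsum s f x.
Proof. by elim: s f => [|t s IH] f /=; [exact: sqr_ge0|rewrite addr_ge0]. Qed.

Lemma hs_sqr_diff (S T : V) :
  `|hs_norm (S + T) ^+ 2 - hs_norm (S - T) ^+ 2| <= 4 * (hs_norm S * hs_norm T).
Proof.
have h1 := hs_normD S T.
have h2 := hs_normD S (- T); rewrite hs_normN in h2.
have h3 : `|hs_norm S - hs_norm T| <= hs_norm (S - T) by exact: hs_norm_dist.
have h4 : `|hs_norm S - hs_norm T| <= hs_norm (S + T).
  by have := hs_norm_dist S (- T); rewrite hs_normN opprK.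
have := hs_norm_ge0 S; have := hs_norm_ge0 T.
have := hs_norm_ge0 (S + T); have := hs_norm_ge0 (S - T).
move: h1 h2 h3 h4.
move: (hs_norm (S + T)) (hs_norm (S - T)) (hs_norm S) (hs_norm T) => p q a b h1 h2 h3 h4 q0 p0 b0 a0.
have p2 : p ^+ 2 <= (a + b) ^+ 2 by rewrite ler_sqr ?nnegrE ?addr_ge0.
have q2 : q ^+ 2 <= (a + b) ^+ 2 by rewrite ler_sqr ?nnegrE ?addr_ge0.
have ab q' : 0 <= q' -> `|a - b| <= q' -> (a - b) ^+ 2 <= q' ^+ 2.
  by move=> q'0 h; rewrite -[(a - b) ^+ 2](real_normK (num_real _)) ler_sqr ?nnegrE.
have := ab _ q0 h3; have := ab _ p0 h4.
have -> : (a - b) ^+ 2 = (a + b) ^+ 2 - 4 * (a * b) by ring.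
by move=> h5 h6; rewrite ler_norml; apply/andP; split; lra.
Qed.

(** The two-point inequality for the sum of the squared norms of a family; the
    parallelogram identity and Cauchy--Schwarz provide its two hypotheses. *)
Lemma two_point_family (r : nat) (t : I) (fs : seq ((I -> R) -> V)) (z : I -> R) :
  c ^+ 2 = 4 * r%:R + 1 ->
  (\sum_(f <- fs) hs_norm (f (upd z t 1)) ^+ 2) ^+ r +
  (\sum_(f <- fs) hs_norm (f (upd z t (-1))) ^+ 2) ^+ r <=
  2 * (\sum_(f <- [seq ev_part t f | f <- fs] ++ [seq od_part t f | f <- fs])
         hs_norm (f z) ^+ 2) ^+ r.
Proof.
move=> c2.
pose Ep f := ev_part t f z.
pose Op f : V := (2^-1)%:C *: (f (upd z t 1) - f (upd z t (-1))).
have two : (2^-1)%:C + (2^-1)%:C = 1 :> R[i].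
  by rewrite -rmorphD/= (_ : 2^-1 + 2^-1 = 1)//; lra.
have halfD (a b : V) : a = (2^-1)%:C *: (a + b) + (2^-1)%:C *: (a - b).
  by rewrite -scalerDr addrACA subrr addr0 scalerDr -scalerDl two scale1r.
have halfB (a b : V) : b = (2^-1)%:C *: (a + b) - (2^-1)%:C *: (a - b).
  rewrite -scalerBr (_ : a + b - (a - b) = b + b); last first.
    by rewrite opprB addrC addrA subrK.
  by rewrite scalerDr -scalerDl two scale1r.
have pE f : f (upd z t 1) = Ep f + Op f by exact: halfD.
have qE f : f (upd z t (-1)) = Ep f - Op f by exact: halfB.
have odE f : hs_norm (od_part t f z) ^+ 2 = (4 * r%:R + 1) * hs_norm (Op f) ^+ 2.
  rewrite (_ : od_part t f z = c%:C *: Op f); last by rewrite /od_part /Op scalerA -rmorphM.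
  by rewrite hs_normZc cabs_real exprMn real_normK ?num_real// c2.
rewrite big_cat/= !big_map/=.
rewrite (eq_bigr _ (fun f _ => odE f)) -mulr_sumr.
apply: two_point.
- by apply: sumr_ge0 => f _; rewrite sqr_ge0.
- by apply: sumr_ge0 => f _; rewrite sqr_ge0.
- by apply: sumr_ge0 => f _; rewrite sqr_ge0.
- by apply: sumr_ge0 => f _; rewrite sqr_ge0.
- rewrite -!big_split/= mulr_sumr; apply: eq_bigr => f _.
  by rewrite pE qE hs_parallelogram mulrDr.
rewrite -sumrB.
set X := \sum_(f <- fs) _.
set A := \sum_(f <- fs) hs_norm (Ep f) ^+ 2; set B := \sum_(f <- fs) hs_norm (Op f) ^+ 2.
have A0 : 0 <= A by apply: sumr_ge0 => f _; rewrite sqr_ge0.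
have B0 : 0 <= B by apply: sumr_ge0 => f _; rewrite sqr_ge0.
have hX : `|X| <= 4 * (Num.sqrt A * Num.sqrt B).
  apply: le_trans (ler_norm_sum _ _ _) _.
  apply: (@le_trans _ _ (4 * \sum_(f <- fs) hs_norm (Ep f) * hs_norm (Op f))).
    rewrite mulr_sumr; apply: ler_sum => f _; rewrite pE qE; exact: hs_sqr_diff.
  rewrite ler_pM2l//; apply: sum_cauchy_schwarz => f; exact: hs_norm_ge0.
have -> : 16 * (A * B) = (4 * (Num.sqrt A * Num.sqrt B)) ^+ 2.
  by rewrite !exprMn !sqr_sqrtr//; ring.
rewrite -[X ^+ 2](real_normK (num_real X)) ler_sqr// nnegrE.
by rewrite !mulr_ge0 ?sqrtr_ge0.
Qed.

(** Bonami's inequality for operator-valued functions on the discrete cube, for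
    even exponents [2 r] and with a constant that is not optimal. It is stated
    for families, because splitting off a sign replaces each function by two:
    this makes the induction close. *)
Lemma hypercontractive (r : nat) s (fs : seq ((I -> R) -> V)) x : uniq s ->
  c ^+ 2 = 4 * r%:R + 1 ->
  savg s (fun z => (\sum_(f <- fs) hs_norm (f z) ^+ 2) ^+ r) x <=
  (\sum_(f <- fs) wsum s f x) ^+ r.
Proof.
move=> + c2; elim: s fs x => [//|t s IH] fs x /= /andP[ts us].
rewrite !savg_upd// -savgD ler_pdivrMr// mulrC.
apply: (@le_trans _ _ (savg s (fun z => 2 * (\sum_(f <- [seq ev_part t f | f <- fs] ++ [seq od_part t f | f <- fs])
         hs_norm (f z) ^+ 2) ^+ r) x)).
  by apply: le_savg => z _; exact: two_point_family.
rewrite savgZ ler_pM2l//; apply: le_trans (IH _ _ us) _.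
by rewrite big_cat/= !big_map/= -big_split.
Qed.

Definition walsh (T : eqType) (e : T -> I) (s : seq T) (L : seq ((T -> bool) * V))
    (z : I -> R) : V :=
  \sum_(a <- L) (\prod_(t <- s) (if a.1 t then z (e t) else 1))%:C *: a.2.

(** Weighted Parseval identity: distinct Walsh monomials do not interfere, since
    each sign sends a monomial either to the even or to the odd part. *)
Lemma wsum_walsh (T : eqType) (e : T -> I) (s : seq T) (L : seq ((T -> bool) * V)) x :
  injective e -> uniq s ->
  pairwise (fun a b => has (fun t => a.1 t != b.1 t) s) L ->
  wsum (map e s) (walsh e s L) x =
  \sum_(a <- L) (c ^+ 2) ^+ count a.1 s * hs_norm a.2 ^+ 2.
Proof.
move=> inje; elim: s L => [|t s IH] L /=.
  case: L => [|a [|b L]] //= _ _.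
    by rewrite /walsh !big_nil hs_norm0 expr0n.
  by rewrite /walsh !big_cons !big_nil !addr0 expr0 mul1r scale1r.
move=> /andP[ts us] pL.
have tail (z : I -> R) b m : \prod_(k <- s) (if m k then upd z (e t) b (e k) else 1) =
    \prod_(k <- s) (if m k then z (e k) else 1).
  rewrite big_seq [RHS]big_seq; apply: eq_bigr => k ks; rewrite /upd.
  by case: eqP => // /inje kt; rewrite kt (negPf ts) in ks.
have atupd (z : I -> R) b : upd z (e t) b (e t) = b by rewrite /upd eqxx.
have evE : ev_part (e t) (walsh e (t :: s) L) = walsh e s [seq a <- L | ~~ a.1 t].
  apply/funext => z; rewrite /ev_part /walsh -big_split/= scaler_sumr big_filter.
  rewrite [RHS]big_mkcond; apply: eq_bigr => a _.
  rewrite !big_cons !tail !atupd -scalerDl scalerA -rmorphD -rmorphM/=.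
  case: (a.1 t) => /=; first by rewrite mul1r mulN1r subrr mulr0 scale0r.
  by congr (_%:C *: _); rewrite mul1r; lra.
have odE : od_part (e t) (walsh e (t :: s) L) =
    walsh e s [seq (a.1, c%:C *: a.2) | a <- [seq a <- L | a.1 t]].
  apply/funext => z; rewrite /od_part /walsh -sumrB scaler_sumr big_map big_filter.
  rewrite [RHS]big_mkcond; apply: eq_bigr => a _.
  rewrite !big_cons !tail !atupd -scalerBl scalerA -rmorphB -rmorphM/=.
  case: (a.1 t) => /=; last by rewrite subrr mulr0 scale0r.
  by rewrite scalerA -rmorphM; congr (_%:C *: _); rewrite mul1r mulN1r; lra.
have sub (Q : pred ((T -> bool) * V)) (b : bool) : (forall a, Q a -> a.1 t = b) ->
    pairwise (fun a b => has (fun t => a.1 t != b.1 t) s) [seq a <- L | Q a].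
  move=> Qb; apply: (@sub_in_pairwise _ Q (fun a b => has (fun t => a.1 t != b.1 t) (t :: s))).
  - by move=> a1 a2 /Qb h1 /Qb h2 /=; rewrite h1 h2 eqxx.
  - exact: filter_all.
  - exact: pairwise_filter.
rewrite evE odE !IH//; last 2 first.
- by rewrite pairwise_map; apply: (sub _ true) => a.
- by apply: (sub _ false) => a /negbTE.
rewrite big_map !big_filter [X in _ + X]big_mkcond [X in X + _]big_mkcond -big_split/=.
apply: eq_bigr => a _; case: (a.1 t) => /=; last by rewrite addr0 add0n.
have -> : hs_norm (c%:C *: a.2) ^+ 2 = c ^+ 2 * hs_norm a.2 ^+ 2.
  by rewrite hs_normZc cabs_real exprMn real_normK ?num_real.
by rewrite add0r add1n mulrA -exprSr.
Qed.

End Hypercontractivity.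

(** * Block chaoses as Walsh expansions *)

Section BlockChaos.
Context {R : realType} {E : sepHilbert R} {J : countType}.
Variable N : nat.
Hypothesis N0 : (0 < N)%N.
Implicit Types (al : mindex J) (z : J * nat -> R).

Definition Q_fun (j : J) (k : nat) z : R :=
  k`!%:R / Num.sqrt N%:R ^+ k *
  \sum_(I : {set 'I_N} | #|I| == k) \prod_(a in I) z (j, a : nat).

Definition Psi_fun al z : R :=
  \prod_(j <- finsupp al) (Q_fun j (al j) z / Num.sqrt (al j)`!%:R).

(** The coefficient of every Walsh monomial of degree [k] in the normalised
    [Q_k]. *)
Definition walsh_coef (k : nat) : R := Num.sqrt k`!%:R / Num.sqrt N%:R ^+ k.

Lemma Q_fun_walsh_coef j k z : Q_fun j k z / Num.sqrt k`!%:R =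
  walsh_coef k * \sum_(I : {set 'I_N} | #|I| == k) \prod_(a in I) z (j, a : nat).
Proof.
have f0 : 0 < k`!%:R :> R by rewrite ltr0n fact_gt0.
have s0 : Num.sqrt k`!%:R != 0 :> R by rewrite gt_eqF// sqrtr_gt0.
have n0 : Num.sqrt N%:R ^+ k != 0 :> R.
  by rewrite expf_neq0// gt_eqF// sqrtr_gt0 ltr0n.
rewrite /Q_fun /walsh_coef mulrAC; congr (_ * _).
have {1}-> : k`!%:R = Num.sqrt k`!%:R ^+ 2 :> R by rewrite sqr_sqrtr// ltW.
move: s0 n0; move: (Num.sqrt k`!%:R) (Num.sqrt N%:R ^+ k) => a b a0 b0.
by field; rewrite a0 b0.
Qed.

Variable K : {fset J}.
Local Notation T := (K * 'I_N)%type.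

Definition cell (t : T) : J * nat := (val t.1, val t.2).

Lemma cell_inj : injective cell.
Proof. by move=> [j a] [k b] [/val_inj -> /val_inj ->]. Qed.

(** The Walsh monomials occurring in [Psi_al]: one choice of [al j] signs in each
    block [j]. *)
Definition shape_fam al : pred {ffun K -> {set 'I_N}} :=
  family (fun j : K => [pred I : {set 'I_N} | #|I| == al (val j)]).

Definition walsh_coefs al : R := \prod_(j : K) walsh_coef (al (val j)).

(** Expanding the product over the blocks of the sums over sets of signs. *)
Lemma Psi_fun_walsh al z : (finsupp al `<=` K)%fset ->
  Psi_fun al z = walsh_coefs al * \sum_(p in shape_fam al)
     \prod_(t <- enum {: T}) (if t.2 \in p t.1 then z (cell t) else 1).
Proof.
move=> alK; rewrite /Psi_fun (big_fset_incl _ alK); last first.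
  move=> j _ jn; have -> : al j = 0%N by rewrite fsfun_dflt.
  rewrite Q_fun_walsh_coef /walsh_coef fact0 sqrtr1 expr0 divr1 mul1r (big_pred1 finset.set0).
    by rewrite big_set0.
  by move=> I; rewrite /= cards_eq0.
rewrite big_seq_fsetE/=; under eq_bigr do rewrite Q_fun_walsh_coef.
rewrite big_split/=; congr (_ * _); rewrite bigA_distr_big_dep/=.
apply: eq_bigr => p _; rewrite big_enum/= -(pair_big xpredT xpredT (fun j a => if a \in p j then z (cell (j, a)) else 1))/=.
by apply: eq_bigr => j _; rewrite [LHS]big_mkcond.
Qed.

(** There are [N!/(k! (N-k)!) <= N^k/k!] monomials, each with squared coefficient
    [k!/N^k]: the normalised [Q_k] has variance at most [1]. *)
Lemma walsh_coef_card k : walsh_coef k ^+ 2 * (\sum_(I : {set 'I_N} | #|I| == k) 1) <= 1.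
Proof.
have n0 : 0 < N%:R :> R by rewrite ltr0n.
have -> : \sum_(I : {set 'I_N} | #|I| == k) 1 = 'C(N, k)%:R :> R.
  rewrite -[X in 'C(X, k)](card_ord N) -card_draws -sumr_const.
  by apply: eq_bigl => I; rewrite inE.
rewrite /walsh_coef expr_div_n sqr_sqrtr ?ler0n// exprAC sqr_sqrtr ?ler0n//.
rewrite mulrAC ler_pdivrMr ?exprn_gt0// mul1r -natrM -natrX ler_nat mulnC bin_ffact.
elim: k => [|k IH]; first by rewrite ffactn0 expn0.
by rewrite ffactnSr expnSr leq_mul// leq_subr.
Qed.

Lemma walsh_coefs_card al : walsh_coefs al ^+ 2 * (\sum_(p in shape_fam al) 1) <= 1.
Proof.
have -> : \sum_(p in shape_fam al) 1 =
    \prod_(j : K) \sum_(I : {set 'I_N} | #|I| == al (val j)) (1 : R).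
  by rewrite bigA_distr_big_dep/=; apply: eq_bigr => p _; rewrite big1.
rewrite /walsh_coefs -prodrXl -big_split/=.
apply: (@le_trans _ _ (\prod_(j : K) 1)); last by rewrite big1.
apply: ler_prod => j _; rewrite walsh_coef_card andbT mulr_ge0 ?sqr_ge0//.
by apply: sumr_ge0.
Qed.

Lemma mdegE al : (finsupp al `<=` K)%fset -> mdeg al = (\sum_(j : K) al (val j))%N.
Proof.
move=> alK; rewrite /mdeg (big_fset_incl _ alK); last by move=> j _ jn; rewrite fsfun_dflt.
by rewrite big_seq_fsetE.
Qed.

Definition chaos_list (F : seq (mindex J)) (A : array J E) : seq ((T -> bool) * hs_op E) :=
  [seq (fun t => t.2 \in p.2 t.1, (walsh_coefs p.1)%:C *: A p.1)
     | p : mindex J * {ffun K -> {set 'I_N}} <-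
         [seq (al, p) | al <- F, p <- enum (shape_fam al)]].

Lemma chaos_walsh (F : seq (mindex J)) (A : array J E) z :
  {in F, forall al, (finsupp al `<=` K)%fset} ->
  \sum_(al <- F) (Psi_fun al z)%:C *: A al = walsh cell (enum {: T}) (chaos_list F A) z.
Proof.
move=> FK; rewrite /walsh big_map big_allpairs_dep/= big_seq [RHS]big_seq.
apply: eq_bigr => al alF; rewrite Psi_fun_walsh; last exact: FK.
rewrite mulrC rmorphM/= -scalerA rmorph_sum/= scaler_suml.
by rewrite -big_enum.
Qed.

(** Different multi-indices use different numbers of signs in some block, hence
    different Walsh monomials. *)
Lemma chaos_pairwise (F : seq (mindex J)) (A : array J E) : uniq F ->
  {in F, forall al, (finsupp al `<=` K)%fset} ->
  pairwise (fun a b => has (fun t => a.1 t != b.1 t) (enum {: T})) (chaos_list F A).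
Proof.
move=> uF FK; rewrite /chaos_list pairwise_map.
set ps := [seq _ | _ <- _, _ <- _].
have ups : uniq ps.
  apply: allpairs_uniq_dep => //; first by move=> al _; exact: enum_uniq.
  by move=> [al p] [be q] _ _ /= [-> ->].
move: ups; rewrite uniq_pairwise.
pose Q (p : mindex J * {ffun K -> {set 'I_N}}) := (p.1 \in F) && (p.2 \in shape_fam p.1).
apply: (@sub_in_pairwise _ Q); last first.
  by apply/allP => p /allpairsPdep[al [q [alF]]]; rewrite mem_enum => qal ->; rewrite /Q /= alF.
move=> [al p] [be q] /andP[/= alF pal] /andP[/= beF qbe] /=.
apply: contraNT => /hasPn h.
have pq : p = q.
  apply/ffunP => j; apply/setP => a.
  by have := h (j, a) (mem_enum _ _); rewrite /= negbK => /eqP.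
rewrite -{}pq in qbe *; apply/eqP; congr (_, _); apply/fsfunP => j.
have [jK|jK] := boolP (j \in K); last first.
  by rewrite !fsfun_dflt//; apply: contra jK; apply/fsubsetP; exact: FK.
move/familyP : pal => /(_ [` jK]%fset) /= /eqP <-.
by move/familyP : qbe => /(_ [` jK]%fset) /= /eqP <-.
Qed.

(** All monomials of [Psi_al] have degree [|al|], so that the weight can be taken
    out of the sum of their squared coefficients, which is at most [1]. *)
Lemma chaos_wsum (c : R) (F : seq (mindex J)) (A : array J E) x : uniq F ->
  {in F, forall al, (finsupp al `<=` K)%fset} ->
  wsum c (map cell (enum {: T})) (fun z => \sum_(al <- F) (Psi_fun al z)%:C *: A al) x <=
  \sum_(al <- F) (c ^+ 2) ^+ mdeg al * hs_norm (A al) ^+ 2.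
Proof.
move=> uF FK.
have -> : (fun z => \sum_(al <- F) (Psi_fun al z)%:C *: A al) =
    walsh cell (enum {: T}) (chaos_list F A).
  by apply/funext => z; exact: chaos_walsh.
rewrite wsum_walsh; [|exact: cell_inj|exact: enum_uniq|exact: chaos_pairwise].
rewrite big_map big_allpairs_dep/= big_seq [leRHS]big_seq; apply: ler_sum => al alF.
have cnt (p : {ffun K -> {set 'I_N}}) : p \in shape_fam al ->
    count (fun t : T => t.2 \in p t.1) (enum {: T}) = mdeg al.
  move=> /familyP pal; rewrite (mdegE (FK _ alF)) -sum1_count big_mkcond big_enum/=.
  rewrite -(pair_big xpredT xpredT (fun j a => if a \in p j then 1%N else 0%N))/=.
  apply: eq_bigr => j _; move/eqP : (pal j) => /= <-.
  by rewrite -big_mkcond/= sum1_card.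
rewrite big_enum/= (eq_bigr (fun p => (c ^+ 2) ^+ mdeg al * hs_norm (A al) ^+ 2 * (walsh_coefs al ^+ 2 * 1))).
  rewrite -mulr_sumr -mulr_sumr ler_piMr ?walsh_coefs_card//.
  by rewrite mulr_ge0 ?sqr_ge0// exprn_ge0 ?sqr_ge0.
move=> p pal; rewrite cnt//.
have -> : hs_norm ((walsh_coefs al)%:C *: A al) ^+ 2 = walsh_coefs al ^+ 2 * hs_norm (A al) ^+ 2.
  by rewrite hs_normZc cabs_real exprMn real_normK ?num_real.
by rewrite mulr1 -mulrA (mulrC (hs_norm _ ^+ 2)).
Qed.

End BlockChaos.

Section BlockHypercontractivity.
Context {R : realType} {E : sepHilbert R} {J : countType}.
Context {d : measure_display} {W : measurableType d}.
Variable P : probability W R.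
Variable xi : J -> nat -> {RV P >-> R}.
Hypothesis xi_signs : independent_signs xi.

Lemma Psi_blockE N al w : Psi_block xi N al w = Psi_fun N al (fun ja => xi ja.1 ja.2 w).
Proof. by []. Qed.

Lemma measurable_Psi_block N al : measurable_fun setT (Psi_block xi N al).
Proof.
apply: measurable_prod => j _; apply: measurable_funM => //.
apply: measurable_funM => //; under eq_fun do rewrite big_mkcond.
apply: measurable_sum => I; case: (_ == _) => //.
under eq_fun do rewrite big_mkcond.
by apply: measurable_prod => a _; case: (_ \in _) => //; exact: measurable_funPT.
Qed.

(** The bound does not depend on [N]; only finitely many blocks, and hence
    finitely many signs, occur in a finite chaos. *)
Lemma block_hypercontr (r N : nat) (F : {fset mindex J}) (A : array J E) : (0 < N)%N ->
  mom_le P (r + r) (fun w => \sum_(al <- F) (Psi_block xi N al w)%:C *: A al)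
    ((\sum_(al <- F) (4 * r%:R + 1) ^+ mdeg al * hs_norm (A al) ^+ 2) ^+ r).
Proof.
move=> N0.
pose K : {fset J} := (\bigcup_(al <- F) finsupp al)%fset.
have FK : {in (F : seq _), forall al, (finsupp al `<=` K)%fset}.
  by move=> al alF; exact: bigfcup_sup.
pose c : R := Num.sqrt (4 * r%:R + 1).
have c2 : c ^+ 2 = 4 * r%:R + 1 by rewrite sqr_sqrtr// addr_ge0// mulr_ge0.
pose f z : hs_op E := \sum_(al <- F) (Psi_fun N al z)%:C *: A al.
pose s := map (@cell J N K) (enum {: K * 'I_N}).
have us : uniq s by rewrite map_inj_uniq ?enum_uniq//; exact: cell_inj.
have mf : borel_rv (fun w => f (fun ja => xi ja.1 ja.2 w)).
  by apply: borel_finite_sum => al; exact: measurable_Psi_block.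
have df : depends_on s f.
  move=> y z yz; rewrite /f; apply: eq_big_seq => al alF; congr (_%:C *: _).
  rewrite !(Psi_fun_walsh N0 (K := K)); [|exact: FK|exact: FK].
  congr (_ * _); apply: eq_bigr => p _; apply: eq_big_seq => t tT.
  by case: ifP => // _; apply: yz; exact: map_f.
pose xi2 (ja : J * nat) : {RV P >-> R} := xi ja.1 ja.2.
have xi2_indep : mutually_independent xi2 by case: xi_signs.
have xi2_sign ja : P (xi2 ja @^-1` [set 1]) = (2^-1)%:E /\
                  P (xi2 ja @^-1` [set -1]) = (2^-1)%:E by case: xi_signs => _; apply.
pose x : J * nat -> R := fun=> 0.
rewrite /mom_le /int_le.
have := @int_savg _ _ _ P _ xi2 xi2_indep xi2_sign
  (fun z => hs_norm (f z) ^+ (r + r)) s x us.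
move=> ->.
- have := @hypercontractive R E _ c r s [:: f] x us c2.
  rewrite big_seq1 => h.
  rewrite lee_fin; apply: (@le_trans _ _ (wsum c s f x ^+ r)).
    apply: le_trans h; apply: le_savg => z _.
    by rewrite big_seq1 -exprM mul2n addnn.
  rewrite lerXn2r ?nnegrE//.
  + exact: wsum_ge0.
  + by apply: sumr_ge0 => al _; rewrite mulr_ge0 ?sqr_ge0// exprn_ge0// addr_ge0// mulr_ge0.
  + rewrite -c2; exact: (chaos_wsum N0 c A x (fset_uniq F) FK).
- by move=> z; rewrite exprn_ge0 ?hs_norm_ge0.
- exact: measurable_mom.
- by move=> y z yz; rewrite (df _ _ yz).
Qed.

End BlockHypercontractivity.

(** * From Krawtchouk to Hermite polynomials *)

Section ElementarySymmetric.
Context {R : realType}.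

Fixpoint elsym (s : seq R) (k : nat) : R :=
  match s, k with
  | [::], _ => (k == 0%N)%:R
  | x :: s', 0%N => 1
  | x :: s', k'.+1 => elsym s' k + x * elsym s' k'
  end.

Lemma elsym0 s : elsym s 0 = 1. Proof. by case: s. Qed.

Lemma elsym_poly (s : seq R) k : (\prod_(x <- s) (1 + x%:P * 'X))`_k = elsym s k.
Proof.
elim: s k => [|x s IH] k; first by rewrite big_nil coef1.
rewrite big_cons mulrDl mul1r -mulrA coefD coefCM (mulrC 'X) coefMX !IH.
by case: k => [|k] /=; rewrite ?elsym0 ?mulr0 ?addr0.
Qed.

Lemma elsym_sets (n : nat) (f : 'I_n -> R) k :
  \sum_(I : {set 'I_n} | #|I| == k) \prod_(a in I) f a = elsym [seq f a | a <- enum 'I_n] k.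
Proof.
rewrite -elsym_poly big_map big_enum/=.
have -> : \prod_(a < n) (1 + (f a)%:P * 'X) =
    \sum_(I : {set 'I_n}) (\prod_(a in I) f a)%:P * 'X^#|I|.
  under eq_bigr do rewrite addrC.
  rewrite bigA_distr; apply: eq_bigr => I _.
  rewrite (bigID (mem I))/= [X in _ * X]big1 ?mulr1; last by move=> a /negPf ->.
  under eq_bigr => a -> do [].
  by rewrite big_split/= prodr_const rmorph_prod.
rewrite coef_sum big_mkcond; apply: eq_bigr => I _.
by rewrite coefCM coefXn eq_sym; case: eqP; rewrite ?mulr1 ?mulr0.
Qed.

(** Multiplying the elementary symmetric polynomial of degree [k+1] by the sum of
    the variables, a product of [k+1] of them either gains a new variable or, the
    squares being [1], loses one. *)
Lemma elsym_rec (s : seq R) k : (forall x, x \in s -> x ^+ 2 = 1) ->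
  k.+2%:R * elsym s k.+2 + ((size s)%:R - k%:R) * elsym s k = (\sum_(x <- s) x) * elsym s k.+1.
Proof.
elim: s k => [|x s IH] k sq; first by rewrite big_nil mul0r /= mulr0 add0r; case: k {sq} => [|k] /=; rewrite ?subrr ?mul0r ?mulr0.
have x2 : x ^+ 2 = 1 by apply: sq; rewrite mem_head.
have {}IH l := IH l (fun y ys => sq y (mem_behead (s := x :: s) ys)).
rewrite big_cons /= -(natr1 (size s)).
case: k => [|k].
  have h0 := IH 0%N; rewrite elsym0 in h0 *.
  have e1 : elsym s 1 = \sum_(y <- s) y.
    elim: {IH sq h0} s => [|y s IHs]; first by rewrite big_nil.
    by rewrite big_cons /= IHs elsym0; ring.
  rewrite e1 in h0 *; set S := \sum_(y <- s) y in h0 *.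
  have -> : (x + S) * (S + x * 1) = S * S + 2 * x * S + x ^+ 2 by ring.
  rewrite x2 -h0; ring.
have h0 := IH k.+1; have h1 := IH k.
move: h0 h1; set S := \sum_(y <- s) y.
move: (elsym s k.+3) (elsym s k.+2) (elsym s k.+1) (elsym s k) => a b c d h0 h1.
have -> : (x + S) * (b + x * c) = S * b + x * (S * c) + x * b + x ^+ 2 * c by ring.
rewrite x2 -h0 -h1 -!natr1; ring.
Qed.

End ElementarySymmetric.

Section NormalizedPolynomials.
Context {R : realType}.

(** Two consecutive terms at once, so that the three-term recursion becomes
    structural. *)
Fixpoint krawtchouk2 (N k : nat) (x : R) : R * R :=
  if k is k'.+1 then
    let p := krawtchouk2 N k' x in (p.2, x * p.2 - k'.+1%:R * (1 - k'%:R / N%:R) * p.1)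
  else (1, x).
(** The normalised Krawtchouk polynomial of degree [k] for blocks of size [N]. *)
Definition krawtchouk N k x : R := (krawtchouk2 N k x).1.

Lemma krawtchouk0 N x : krawtchouk N 0 x = 1. Proof. by []. Qed.
Lemma krawtchouk1 N x : krawtchouk N 1 x = x. Proof. by []. Qed.
Lemma krawtchoukSS N k x : krawtchouk N k.+2 x = x * krawtchouk N k.+1 x - k.+1%:R * (1 - k%:R / N%:R) * krawtchouk N k x.
Proof. by []. Qed.

Lemma hermite_deriv k : (@hermite R k.+1)^`() = k.+1%:R *: hermite k.
Proof.
elim: k => [|k IH]; first by rewrite /= -polyC1 derivC subr0 mulr1 derivX scale1r.
rewrite [hermite k.+2]/= derivB derivM derivX mul1r -/(hermite k.+1) IH.
rewrite derivZ -scalerAr [in X in _ + X - _](_ : 'X * hermite k = hermite k.+1 + (hermite k)^`()); last by rewrite /= subrK.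
by rewrite scalerDr addrA addrK -[X in X + _]scale1r -scalerDl nat1r.
Qed.

Lemma hermiteSS k (x : R) : (hermite k.+2).[x] = x * (hermite k.+1).[x] - k.+1%:R * (hermite k).[x].
Proof.
rewrite [hermite k.+2]/= -/(hermite k.+1) hornerD hornerN hornerM hornerX.
by rewrite hermite_deriv hornerZ.
Qed.

(** The coefficients of the three-term recursion converge to those of the Hermite
    polynomials. *)
Lemma krawtchouk_cvg k (u : nat -> R) (x : R) : u N @[N --> \oo] --> x ->
  krawtchouk N k (u N) @[N --> \oo] --> (hermite k).[x].
Proof.
move=> ux.
have inv0 : (N%:R^-1 : R) @[N --> \oo] --> (0 : R).
  apply/cvgrPdist_le => e e0; near=> N.
  have N0 : 0 < N%:R :> R by near: N; exact: nbhs_infty_gtr.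
  rewrite sub0r normrN ger0_norm ?invr_ge0 ?ler0n// -[leRHS]invrK lef_pV2 ?posrE ?invr_gt0//.
  by near: N; exact: nbhs_infty_ger.
have kk : krawtchouk N k (u N) @[N --> \oo] --> (hermite k).[x] /\
    krawtchouk N k.+1 (u N) @[N --> \oo] --> (hermite k.+1).[x].
  elim: k => [|k [IH0 IH1]].
    split; first by under eq_cvg do rewrite krawtchouk0; rewrite /= -polyC1 hornerC; exact: cvg_cst.
    by under eq_cvg do rewrite krawtchouk1; rewrite /= -polyC1 derivC subr0 mulr1 hornerX.
  split => //; under eq_cvg do rewrite krawtchoukSS; rewrite hermiteSS.
  apply: cvgB; first exact: cvgM.
  apply: cvgM => //.
  rewrite -[X in _ --> X]mulr1; apply: cvgM; first exact: cvg_cst.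
  rewrite -[X in _ --> X]subr0; apply: cvgB; first exact: cvg_cst.
  rewrite -[X in _ --> X](mulr0 k%:R); apply: cvgM => //; exact: cvg_cst.
by case: kk.
Unshelve. all: by end_near. Qed.

(** The recursion of elementary symmetric polynomials of signs, rescaled. *)
Lemma Q_fun_krawtchouk (J : countType) (N : nat) (j : J) k (z : J * nat -> R) : (0 < N)%N ->
  (forall a, z (j, a) ^+ 2 = 1) -> Q_fun N j k z = krawtchouk N k (Sfun N j z).
Proof.
move=> N0 sq.
have n0 : 0 < N%:R :> R by rewrite ltr0n.
set s := [seq z (j, val a) | a <- enum 'I_N].
have QE l : Q_fun N j l z = l`!%:R / Num.sqrt N%:R ^+ l * elsym s l.
  by rewrite /Q_fun elsym_sets.
have sE : \sum_(x <- s) x = Num.sqrt N%:R * Sfun N j z.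
  by rewrite /s big_map big_enum/= /Sfun mulrA divff ?mul1r// gt_eqF// sqrtr_gt0.
have szs : size s = N by rewrite size_map size_enum_ord.
have sqs x : x \in s -> x ^+ 2 = 1 by move=> /mapP[a _ ->].
have r0 : Num.sqrt N%:R != 0 :> R by rewrite gt_eqF// sqrtr_gt0.
have rN : Num.sqrt N%:R ^+ 2 = N%:R :> R by rewrite sqr_sqrtr// ler0n.
suff [] : Q_fun N j k z = krawtchouk N k (Sfun N j z) /\ Q_fun N j k.+1 z = krawtchouk N k.+1 (Sfun N j z) by [].
elim: k => [|k [IH0 IH1]].
  rewrite krawtchouk0 krawtchouk1 !QE elsym0 fact0 expr0 divr1 mulr1; split => //.
  have e1 (t : seq R) : elsym t 1 = \sum_(y <- t) y.
    elim: t => [|y t IHt]; first by rewrite big_nil.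
    by rewrite big_cons /= IHt elsym0; ring.
  by rewrite e1 sE expr1 mul1r mulrA mulVf// mul1r.
split => //; rewrite krawtchoukSS -IH0 -IH1 !QE.
have := elsym_rec k sqs; rewrite szs sE => h.
rewrite (factS k.+1) (factS k) !natrM !exprS.
have {}h : k.+2%:R * elsym s k.+2 = Num.sqrt N%:R * Sfun N j z * elsym s k.+1 - (N%:R - k%:R) * elsym s k.
  by rewrite -h addrK.
move: h r0 rN; have : Num.sqrt N%:R ^+ k != 0 :> R by rewrite expf_neq0// gt_eqF// sqrtr_gt0.
move: (Num.sqrt (N%:R : R)) (elsym s k.+2) (elsym s k.+1) (elsym s k) (Sfun N j z) => r a b c S p0 h r0 rN.
rewrite -rN in h *; move: p0; move: (r ^+ k) => p p0.
transitivity (k.+1%:R * k`!%:R / (r * (r * p)) * (k.+2%:R * a)); first by field; rewrite p0 r0.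
by rewrite h; field; rewrite p0 r0.
Qed.

End NormalizedPolynomials.

(** * Transfer of laws *)

Section LawOfFamily.
Context {R : realType} {J : countType}.

(** A family of sets, stable under intersection, that generates the product
    sigma-algebra. *)
Definition boxes : set (set (J -> R)) := [set C | exists F : {fset J}, exists2 B : J -> set R,
  (forall j, measurable (B j)) & C = \bigcap_(j in [set` F]) [set s | B j (s j)]].

Definition real_family := g_sigma_algebraType boxes.

Lemma boxes_setI : setI_closed boxes.
Proof.
move=> _ _ [F [B mB ->]] [G [D mD ->]].
exists (F `|` G)%fset; exists (fun j => (if j \in F then B j else setT) `&` (if j \in G then D j else setT)).
  by move=> j; apply: measurableI; case: ifP.
apply/seteqP; split => [s [hF hG] j /= jFG|s h].
  by split; case: ifPn => // jF; [exact: hF|exact: hG].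
split => j /= jF.
  by have := h j; rewrite /= in_fsetU jF => /(_ isT)[].
by have := h j; rewrite /= in_fsetU jF orbT => /(_ isT)[_].
Qed.

Lemma boxesT : boxes setT.
Proof.
exists fset0; exists (fun=> setT); first by [].
by apply/seteqP; split => // s _ j.
Qed.

Lemma measurable_coord j : measurable_fun setT (fun s : real_family => (s : J -> R) j).
Proof.
move=> _ B mB; rewrite setTI; apply: sub_sigma_algebra.
exists [fset j]%fset; exists (fun=> B) => //.
apply/seteqP; split => [s h i|s]; first by rewrite /= in_fset1 => /eqP ->.
by apply; rewrite /= in_fset1.
Qed.

Section Map.
Context {d : measure_display} {W : measurableType d}.

Lemma measurable_family (S : J -> W -> R) : (forall j, measurable_fun setT (S j)) ->
  measurable_fun setT (fun w => (S ^~ w : real_family)).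
Proof.
move=> mS; apply: (@measurability _ _ _ real_family _ _ boxes) => //.
move=> _ [_ [F [B mB ->]] <-]; rewrite setTI preimage_bigcap.
apply: fin_bigcap_measurable; first exact: finite_fset.
by move=> j _; rewrite -[X in measurable X]setTI; exact: mS.
Qed.
End Map.

Section Transfer.
Context {d d' : measure_display} {W : measurableType d} {W' : measurableType d'}.
Variables (P : probability W R) (P' : probability W' R).
Variables (S : J -> {RV P >-> R}) (S' : J -> {RV P' >-> R}).
Hypotheses (indS : mutually_independent S) (indS' : mutually_independent S').
Hypothesis margin : forall j B, measurable B -> P (S j @^-1` B) = P' (S' j @^-1` B).

Let Sm (w : W) : real_family := S ^~ w.
Let Sm' (w : W') : real_family := S' ^~ w.
Let mSm : measurable_fun setT Sm.
Proof. by apply: measurable_family => j. Qed.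
Let mSm' : measurable_fun setT Sm'.
Proof. by apply: measurable_family => j. Qed.

(** Independent families with the same marginals agree on boxes, hence on the
    product sigma-algebra. *)
Lemma law_transfer (C : set real_family) : measurable C -> P [set w | C (S ^~ w)] = P' [set w | C (S' ^~ w)].
Proof.
move=> mC.
pose Sf : {mfun W >-> real_family} := mfun_Sub (mem_set mSm).
pose Sf' : {mfun W' >-> real_family} := mfun_Sub (mem_set mSm').
have := @measure_unique _ R real_family boxes (fun=> setT) erefl boxes_setI (fun=> boxesT) _
  (distribution P Sf) (distribution P' Sf').
apply => //.
- by apply/seteqP; split => // s _; exists 0%N.
- move=> _ [F [B mB ->]].
  have h : P (\bigcap_(j in [set` F]) (S j @^-1` B j)) = P' (\bigcap_(j in [set` F]) (S' j @^-1` B j)).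
    rewrite (indS F mB) (indS' F mB); apply: eq_bigr => j _; exact: margin.
  exact: h.
- by move=> _; rewrite -ge0_fin_numE ?measure_ge0//; exact: fin_num_measure.
Qed.

Lemma integral_transfer (f : real_family -> \bar R) : measurable_fun setT f -> (forall s, 0 <= f s)%E ->
  (\int[P]_w f (S ^~ w) = \int[P']_w f (S' ^~ w))%E.
Proof.
move=> mf f0.
pose Sf : {mfun W >-> real_family} := mfun_Sub (mem_set mSm).
pose Sf' : {mfun W' >-> real_family} := mfun_Sub (mem_set mSm').
have -> : (\int[P]_w f (S ^~ w) = \int[distribution P Sf]_s f s)%E.
  by rewrite ge0_integral_pushforward.
have -> : (\int[P']_w f (S' ^~ w) = \int[distribution P' Sf']_s f s)%E.
  by rewrite ge0_integral_pushforward.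
apply: eq_measure_integral => C mC _; exact: law_transfer.
Qed.

End Transfer.
End LawOfFamily.

Section CoupledSums.
Context {R : realType} {J : countType} {d d' : measure_display}.
Context {W : measurableType d} {W' : measurableType d'}.
Variables (P : probability W R) (P' : probability W' R).
Variables (xi : J -> nat -> {RV P >-> R}) (g : J -> {RV P' >-> R}).
Hypotheses (xi_signs : independent_signs xi) (g_gauss : independent_std_gaussians g).

Lemma measurable_coupled N j : measurable_fun setT (fun w => quantile_map (block_rv xi N j) (g j w) : R).
Proof.
apply: (@measurableT_comp _ _ _ W' R R); last by [].
exact: measurable_quantile_map.
Qed.

Definition coupled N j : {RV P' >-> R} := mfun_Sub (mem_set (measurable_coupled N j)).

Lemma coupled_indep N : mutually_independent (coupled N).
Proof.
move=> F B mB; have [gi _] := g_gauss.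
apply: (gi F (fun j => quantile_map (block_rv xi N j) @^-1` B j)) => j.
have := @measurable_quantile_map R _ _ P (block_rv xi N j) measurableT _ (mB j). by rewrite setTI.
Qed.

Lemma coupled_margin N j B : measurable B ->
  P (block_rv xi N j @^-1` B) = P' (coupled N j @^-1` B).
Proof.
move=> mB; have [_ gl] := g_gauss.
rewrite -quantile_map_law// -(gl j)//.
have := @measurable_quantile_map R _ _ P (block_rv xi N j) measurableT _ mB. by rewrite setTI.
Qed.

Lemma coupled_cvg j w : coupled N j w @[N --> \oo] --> g j w.
Proof.
apply: (@quantile_map_cvg R _ W P (fun N => block_rv xi N j)) => A B e eta mA mB e0 eta0 AB; exact: (block_clt xi_signs j mA mB e0 eta0 AB).
Qed.

End CoupledSums.

Section SumFunctions.
Context {R : realType} {J : countType}.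
Implicit Types (al : mindex J).

Definition Psi_sum (N : nat) al (s : J -> R) : R :=
  \prod_(j <- finsupp al) (krawtchouk N (al j) (s j) / Num.sqrt (al j)`!%:R).

Lemma measurable_krawtchouk N k : measurable_fun setT (krawtchouk N k : R -> R).
Proof.
suff [] : measurable_fun setT (krawtchouk N k : R -> R) /\ measurable_fun setT (krawtchouk N k.+1 : R -> R) by [].
elim: k => [|k [IH0 IH1]]; first by split; [exact: measurable_cst|exact: measurable_id].
split => //; apply: (@eq_measurable_fun _ _ _ _ _ (fun x : R => x * krawtchouk N k.+1 x - k.+1%:R * (1 - k%:R / N%:R) * krawtchouk N k x)) => //.
apply: measurable_funB; first exact: measurable_funM.
by apply: measurable_funM.
Qed.

Lemma measurable_Psi_sum N al : measurable_fun setT (Psi_sum N al : real_family -> R).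
Proof.
apply: measurable_prod => j _; apply: measurable_funM => //.
apply: (measurableT_comp (measurable_krawtchouk N (al j))); exact: measurable_coord.
Qed.

Lemma Psi_sum_cvg d (W : measurableType d) (P : probability W R) (g : J -> {RV P >-> R})
    (s : nat -> J -> R) al w : (forall j, s N j @[N --> \oo] --> g j w) ->
  Psi_sum N al (s N) @[N --> \oo] --> Psi_gauss g al w.
Proof.
move=> sg; rewrite /Psi_sum /Psi_gauss.
elim: (finsupp al : seq J) => [|j l IH].
  by rewrite big_nil; under eq_cvg do rewrite big_nil; exact: cvg_cst.
rewrite big_cons; under eq_cvg do rewrite big_cons.
apply: cvgM => //; apply: cvgM; [exact: krawtchouk_cvg|exact: cvg_cst].
Qed.

(** Off the null set where some [xi j a] is not a sign. It is null because there
    are countably many pairs [(j, a)]. *)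
Lemma Psi_block_ae d (W : measurableType d) (P : probability W R) (xi : J -> nat -> {RV P >-> R}) N :
  independent_signs xi -> (0 < N)%N ->
  {ae P, forall w, forall al, Psi_block xi N al w = Psi_sum N al (fun j => block_rv xi N j w)}.
Proof.
move=> [ind sgn] N0.
pose bad (ja : J * nat) := ~` ((xi ja.1 ja.2 @^-1` [set 1]) `|` (xi ja.1 ja.2 @^-1` [set -1])).
pose B n := if @choice.unpickle (J * nat)%type n is Some ja then bad ja else set0.
have nB n : P.-negligible (B n).
  rewrite /B; case: choice.unpickle => [ja|]; last exact: negligible_set0.
  exists (bad ja); split => //.
    by apply: measurableC; apply: measurableU; rewrite -[X in measurable X]setTI; exact: measurable_funPT.
  exact: (@sign_ae _ _ _ P _ (fun ja : J * nat => xi ja.1 ja.2) (fun ja => sgn ja.1 ja.2) ja).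
apply: negligibleS (negligible_bigcup nB) => w hx; apply: contrapT => h.
have h2 ja : xi ja.1 ja.2 w ^+ 2 = 1.
  apply: contrapT => hn; apply: h; exists (choice.pickle ja) => //.
  by rewrite /B choice.pickleK /bad /= => -[|] e; apply: hn; rewrite e ?expr1n ?sqrrN ?expr1n.
apply: hx => al; rewrite Psi_blockE /Psi_fun /Psi_sum.
apply: eq_bigr => j _; rewrite Q_fun_krawtchouk// => a; exact: (h2 (j, a)).
Qed.

End SumFunctions.

(** * Limit theorems for moments *)

Section LimitsOfIntegrals.
Context {R : realType} {d : measure_display} {W : measurableType d}.
Variable P : probability W R.

(** Fatou's lemma, with the exceptional null set removed by its indicator. *)
Lemma int_le_fatou (f : nat -> W -> R) (h : W -> R) (K : R) :
  (forall n, measurable_fun setT (f n)) -> measurable_fun setT h ->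
  (forall n w, 0 <= f n w) -> (forall w, 0 <= h w) ->
  {ae P, forall w, f n w @[n --> \oo] --> h w} ->
  (forall n, int_le P (f n) K) -> int_le P h K.
Proof.
move=> mf mh f0 h0 [B [mB PB0 hB]] fK.
have mI : measurable_fun setT (\1_(~` B) : W -> R) by apply: measurable_indic; exact: measurableC.
have I01 w : 0 <= (\1_(~` B) w : R) <= 1 by rewrite indicE; case: (_ \in _); rewrite ?lexx ?ler01.
pose u n w := (f n w * \1_(~` B) w)%:E.
have mu n : measurable_fun setT (u n).
  by apply/measurable_EFinP; exact: measurable_funM.
have u0 n w : (0 <= u n w)%E by rewrite lee_fin mulr_ge0//; case/andP: (I01 w).
have uK n : (\int[P]_w u n w <= K%:E)%E.
  apply: (int_le_mono _ (mf n) _ _ (fK n)).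
  - exact: measurable_funM.
  - by move=> w; rewrite mulr_ge0//; case/andP: (I01 w).
  - by move=> w; rewrite -[leRHS]mulr1 ler_wpM2l//; case/andP: (I01 w).
have ul w : limn_einf (u ^~ w) = (h w * \1_(~` B) w)%:E.
  suff /cvg_limn_einf_sup[-> _] : (u n w @[n --> \oo] --> (h w * \1_(~` B) w)%:E)%E by [].
  apply: cvg_EFin; first by near=> n.
  rewrite /u /= indicE; have [|] := boolP (w \in ~` B) => wB.
    apply: cvgM; last exact: cvg_cst.
    by apply: contrapT => nh; move/set_mem : wB; apply; exact: hB.
  by rewrite /= mulr0; under eq_fun do rewrite mulr0; exact: cvg_cst.
apply: (@le_trans _ _ (\int[P]_w (h w * \1_(~` B) w)%:E)%E).
  apply: ae_ge0_le_integral => //.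
  - by move=> w _; rewrite lee_fin.
  - exact/measurable_EFinP.
  - by move=> w _; rewrite lee_fin mulr_ge0//; case/andP: (I01 w).
  - by apply/measurable_EFinP; exact: measurable_funM.
  exists B; split => // w /= nh; apply: contrapT => nB; apply: nh => _.
  by rewrite lee_fin indicE mem_set// mulr1.
under eq_integral do rewrite -ul.
apply: le_trans (fatou P measurableT mu (fun n w _ => u0 n w)) _.
rewrite limn_einf_lim; apply: lime_le; first exact: is_cvg_einfs.
near=> n; apply: le_trans (uK n).
by rewrite /einfs; apply: ereal_inf_lbound; exists n => /=.
Unshelve. all: by end_near. Qed.

(** The sum of the sequence has finite integral, so it is almost surely finite
    and its terms tend to zero. *)
Lemma int_le_cvg0_ae (f : nat -> W -> R) : (forall n, measurable_fun setT (f n)) ->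
  (forall n w, 0 <= f n w) -> (forall n, int_le P (f n) (1 / (2 ^ n.+1)%:R)) ->
  {ae P, forall w, f n w @[n --> \oo] --> (0 : R)}.
Proof.
move=> mf f0 fI.
have mF n : measurable_fun setT (fun w => (f n w)%:E) by exact/measurable_EFinP.
have F0 n w : setT w -> (0 <= (f n w)%:E)%E by rewrite lee_fin.
pose s w := (\sum_(0 <= n <oo) (f n w)%:E)%E.
have s0 w : (0 <= s w)%E by apply: nneseries_ge0 => n _ _; exact: F0.
have ms : measurable_fun setT s by apply: ge0_emeasurable_sum => // n w _ _; exact: F0.
have si : P.-integrable setT s.
  apply/integrableP; split => //; under eq_integral do rewrite gee0_abs//.
  rewrite /s (integral_nneseries _ _ mF F0)//.
  apply: (@le_lt_trans _ _ 1%:E); last by rewrite ltry.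
  apply: le_trans (epsilon_trick0 xpredT (@ler01 R)).
  by apply: lee_nneseries => [n _ _|n _]; [apply: integral_ge0 => w _; exact: F0|exact: fI].
have := integrable_ae measurableT si; apply: filterS => w /(_ I) sfin.
have tl := @nneseries_tail_cvg R (fun n => (f n w)%:E) xpredT _ (fun n _ => F0 n w I).
have {}tl : ((\sum_(N <= k <oo) (f k w)%:E)%E @[N --> \oo] --> 0%E)%E.
  by move: tl; rewrite -[X in (X < _)%E]/(s w) -ge0_fin_numE ?sfin//; apply.
suff : ((f n w)%:E @[n --> \oo] --> (0 : R)%:E)%E by move/fine_cvg.
apply: (squeeze_cvge _ (cvg_cst _) tl); near=> n; rewrite lee_fin f0/=.
apply: le_trans (nneseries_lim_ge n.+1 (fun k _ _ => F0 k w I)).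
by rewrite big_nat1.
Unshelve. all: by end_near. Qed.

End LimitsOfIntegrals.

Section OperatorLimits.
Context {R : realType} {E : sepHilbert R} {d : measure_display} {W : measurableType d}.
Variable P : probability W R.
Implicit Types X Y : W -> hs_op E.

Lemma hs_norm_cvgl (u : nat -> hs_op E) T : hs_norm (u m - T) @[m --> \oo] --> (0 : R) ->
  hs_norm (u m) @[m --> \oo] --> hs_norm T.
Proof.
move=> /cvgrPdist_le h; apply/cvgrPdist_le => e e0; near=> m.
rewrite distrC; apply: le_trans (hs_norm_dist _ _) _.
by near: m; have := h _ e0; apply: filterS => m; rewrite sub0r normrN ger0_norm ?hs_norm_ge0.
Unshelve. all: by end_near. Qed.

Lemma mom_le_fatou n (Z : nat -> W -> hs_op E) X K :
  (forall m, borel_rv (Z m)) -> borel_rv X ->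
  {ae P, forall w, hs_norm (Z m w - X w) @[m --> \oo] --> (0 : R)} ->
  (forall m, mom_le P n (Z m) K) -> mom_le P n X K.
Proof.
move=> mZ mX ZX ZK; apply: (@int_le_fatou _ _ _ P (fun m w => hs_norm (Z m w) ^+ n)).
- by move=> m; exact: measurable_mom.
- exact: measurable_mom.
- by move=> m w; exact: mom_ge0.
- by move=> w; exact: mom_ge0.
- apply: filterS ZX => w /hs_norm_cvgl h.
  exact: (cvg_comp _ _ h (@exprn_continuous R n (hs_norm (X w)))).
- exact: ZK.
Qed.

Lemma mom_le_ae (Z : nat -> W -> hs_op E) : (forall n, borel_rv (Z n)) ->
  (forall n, mom_le P 2 (Z n) (1 / (2 ^ n.+1)%:R)) ->
  {ae P, forall w, hs_norm (Z n w) @[n --> \oo] --> (0 : R)}.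
Proof.
move=> mZ h.
have := @int_le_cvg0_ae _ _ _ P (fun n w => hs_norm (Z n w) ^+ 2)
  (fun n => measurable_mom 2 (mZ n)) (fun n w => mom_ge0 2 (Z n) w) h.
apply: filterS => w /cvgrPdist_le hw; apply/cvgrPdist_le => e e0.
have e20 : 0 < e ^+ 2 by rewrite exprn_gt0.
near=> n; rewrite sub0r normrN ger0_norm ?hs_norm_ge0//.
rewrite -(@ler_pXn2r _ 2)// ?nnegrE ?hs_norm_ge0 ?(ltW e0)//.
near: n; apply: filterS (hw _ e20) => n; rewrite sub0r normrN ger0_norm//.
exact: mom_ge0.
Unshelve. all: by end_near. Qed.

(** [x <= t + x^2/t]. *)
Lemma mom_le_half n X K t : borel_rv X -> 0 < t -> mom_le P (n + n) X K -> mom_le P n X (t + K / t).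
Proof.
move=> mX t0 h.
have mm := measurable_mom (n + n) mX.
apply: (int_le_mono (g := fun w => t + t^-1 * hs_norm (X w) ^+ (n + n))).
- exact: measurable_mom.
- apply: measurable_funD => //; exact: measurable_funM.
- by move=> w; exact: mom_ge0.
- move=> w; rewrite exprD; have := mom_ge0 n X w; move: (_ ^+ n) => y y0.
  rewrite -subr_ge0; have -> : t + t^-1 * (y * y) - y = (t ^+ 2 + y ^+ 2 - t * y) / t.
    by field; rewrite gt_eqF.
  rewrite divr_ge0 ?(ltW t0)//; nra.
apply: int_leD => //.
- exact: measurable_funM.
- by move=> w; exact: ltW.
- by move=> w; rewrite mulr_ge0 ?invr_ge0 ?(ltW t0)// mom_ge0.
- exact: int_le_cst.
rewrite mulrC; apply: int_leZ => //; first by move=> w; exact: mom_ge0.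
by rewrite invr_ge0 ltW.
Qed.

Lemma near_succ (Q : nat -> Prop) : (\forall N \near \oo, Q N.+1) -> \forall N \near \oo, Q N.
Proof. by move=> [N0 _ h]; exists N0.+1 => // -[|n] //= nN; exact: h. Qed.

(** Bounded moments of twice the order give uniform integrability: the part of the
    [n]-th power above a level [M] has integral at most [K/M], and the part below
    tends to zero by dominated convergence. *)
Lemma vitali n (Z : nat -> W -> hs_op E) K : (forall N, (0 < N)%N -> borel_rv (Z N)) ->
  (0 < n)%N -> (forall w, hs_norm (Z N w) @[N --> \oo] --> (0 : R)) ->
  (forall N, (0 < N)%N -> mom_le P (n + n) (Z N) K) ->
  forall eps, 0 < eps -> \forall N \near \oo, mom_le P n (Z N) eps.
Proof.
move=> mZ n0 Z0 ZK eps eps0.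
have K0 : 0 <= K by exact: (mom_le_ge0 (ZK 1%N isT)).
(* at most [K/M <= eps/2] of the integral lies above the level [M] *)
pose M := 2 * K / eps + 1.
have M0 : 0 < M by rewrite ltr_wpDl// divr_ge0 ?mulr_ge0// ltW.
have KM : M^-1 * K <= eps / 2.
  rewrite mulrC ler_pdivrMr// /M mulrDr mulr1.
  have -> : eps / 2 * (2 * K / eps) = K by field; rewrite gt_eqF.
  by rewrite lerDl divr_ge0// ltW.
pose f N w := Num.min (hs_norm (Z N.+1 w) ^+ n) M.
have mf N : measurable_fun setT (f N).
  by apply: measurable_minr => //; apply: measurable_mom; exact: mZ.
have f0 N w : 0 <= f N w by rewrite le_min mom_ge0 ltW.
have fI : ((\int[P]_w (f N w)%:E) @[N --> \oo] --> 0%E)%E.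
  have := @dominated_convergence _ W R P setT measurableT (fun N w => (f N w)%:E) (fun=> 0%E) (fun=> M%:E).
  case.
  - by move=> N; exact/measurable_EFinP.
  - exact: measurable_cst.
  - apply: aeW => w _; apply: cvg_EFin; first by near=> N.
    apply: (@squeeze_cvgr _ _ _ _ (fun=> 0) (fun N => hs_norm (Z N.+1 w) ^+ n)).
    + by near=> N; rewrite /= f0 ge_min lexx.
    + exact: cvg_cst.
    + have h : hs_norm (Z N.+1 w) @[N --> \oo] --> (0 : R) by have := Z0 w; rewrite -cvg_shiftS.
      rewrite [X in _ --> X](_ : _ = 0 ^+ n); last by rewrite expr0n (gtn_eqF n0).
      exact: (cvg_comp _ _ h (@exprn_continuous R n 0)).
  - exact: finite_measure_integrable_cst.
  - by apply: aeW => w N _; rewrite /= ger0_norm ?f0// lee_fin ge_min lexx orbT.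
  by move=> _ _; rewrite integral0.
apply: near_succ.
have e20 : (0 < (eps / 2)%:E)%E by rewrite lte_fin divr_gt0.
have fI2 : \forall N \near \oo, int_le P (f N) (eps / 2).
  move/fine_cvgP : fI => [fin /cvgrPdist_le /(_ (eps / 2))].
  rewrite divr_gt0// => /(_ isT) h; near=> N.
  have -> : int_le P (f N) (eps / 2) = (fine (\int[P]_w (f N w)%:E) <= eps / 2) :> Prop.
    by rewrite /int_le -lee_fin fineK//; near: N.
  have : `|0 - fine (\int[P]_w (f N w)%:E)| <= eps / 2 by near: N.
  by rewrite sub0r normrN; apply: le_trans; exact: ler_norm.
near=> N.
have mm := measurable_mom (n + n) (mZ N.+1 isT).
apply: (int_le_mono (g := fun w => f N w + M^-1 * hs_norm (Z N.+1 w) ^+ (n + n))).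
- by apply: measurable_mom; exact: mZ.
- apply: measurable_funD => //; exact: measurable_funM.
- by move=> w; exact: mom_ge0.
- move=> w; rewrite exprD /f; have := mom_ge0 n (Z N.+1) w; move: (_ ^+ n) => y y0.
  rewrite minEle; case: ifPn => [_|]; first by rewrite lerDl mulr_ge0 ?invr_ge0 ?(ltW M0)// mulr_ge0.
  rewrite -ltNge => My; rewrite -[leLHS]add0r lerD ?(ltW M0)//.
  by rewrite mulrA ler_peMl// mulrC ler_pdivlMr// mul1r ltW.
rewrite [eps]splitr; apply: int_leD => //.
- exact: measurable_funM.
- by move=> w; rewrite mulr_ge0 ?invr_ge0 ?(ltW M0)// mom_ge0.
- by near: N.
apply: (int_leK KM); apply: int_leZ => //; last exact: ZK.
- by move=> w; exact: mom_ge0.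
by rewrite invr_ge0 ltW.
Unshelve. all: by end_near. Qed.

End OperatorLimits.

(** * Chaos series *)

Lemma big_fsetD (I : choiceType) (V : zmodType) (F G : {fset I}) (f : I -> V) :
  (F `<=` G)%fset ->
  \sum_(i <- G) f i = \sum_(i <- F) f i + \sum_(i <- (G `\` F)%fset) f i.
Proof.
move=> FG; have pe : perm_eq (G : seq _) (F ++ (G `\` F)%fset : seq _).
  apply: uniq_perm; rewrite ?fset_uniq// ?cat_uniq ?fset_uniq ?andbT/=.
    by apply/hasPn => x; rewrite !inE => /andP[].
  move=> x; rewrite mem_cat inE; case: (boolP (x \in F)) => //= xF.
  exact: (fsubsetP FG).
by rewrite (perm_big _ pe) big_cat.
Qed.

Section Chaos.
Context {R : realType} {E : sepHilbert R} {J : countType}.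
Context {d : measure_display} {W : measurableType d}.
Variable P : probability W R.
Variable Psi : mindex J -> W -> R.
Hypothesis mPsi : forall al, measurable_fun setT (Psi al).
Implicit Types (A B : array J E) (F G : {fset mindex J}) (X Y : W -> hs_op E).

Definition chaos A F : W -> hs_op E := fun w => \sum_(al <- F) (Psi al w)%:C *: A al.

Lemma borel_chaos A F : borel_rv (chaos A F).
Proof. exact: borel_finite_sum. Qed.

Lemma chaos_diff A F G : (F `<=` G)%fset -> rvB (chaos A G) (chaos A F) = chaos A (G `\` F)%fset.
Proof.
by move=> FG; apply/funext => w; rewrite /rvB /chaos (big_fsetD _ FG) addrAC subrr add0r.
Qed.

Lemma chaosB_array A B F : rvB (chaos A F) (chaos B F) = chaos (arrayB A B) F.
Proof.
apply/funext => w; rewrite /rvB /chaos -sumrB; apply: eq_bigr => al _.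
by rewrite -scalerBr.
Qed.

(** The unconditional [L^2] convergence of the series, in terms of second moments. *)
Definition L2_approx A X : Prop := borel_rv X /\
  forall eps, 0 < eps -> exists F0, forall F, (F0 `<=` F)%fset -> mom_le P 2 (rvB X (chaos A F)) eps.

Lemma is_L2_sum_approx A X : is_L2_sum P Psi A X -> L2_approx A X.
Proof.
move=> [mX h]; split => // eps eps0.
have s0 : 0 < Num.sqrt eps by rewrite sqrtr_gt0.
have /h [F0 _ hF] : nbhs (0 : \bar R)%E [set x | (x < (Num.sqrt eps)%:E)%E].
  by apply: open_nbhs_nbhs; split; [exact: open_ereal_lt_ereal|rewrite /= lte_fin].
exists F0 => F /hF /= hx; rewrite -[eps]sqr_sqrtr ?(ltW eps0)//.
apply: mom_le_Lnorm2; rewrite ?(ltW s0)//; first exact: (borel_rvB mX (borel_chaos A F)).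
exact: ltW.
Qed.

(** The errors are summable, which will give almost sure convergence; the sets can
    be taken to contain a given [F]. *)
Lemma L2_approx_seq A X F : L2_approx A X -> exists G : nat -> {fset mindex J},
  (forall n, F `<=` G n)%fset /\ forall n, mom_le P 2 (rvB X (chaos A (G n))) (1 / (2 ^ n.+1)%:R).
Proof.
move=> [mX h].
have {}h n : exists G, (F `<=` G)%fset /\ mom_le P 2 (rvB X (chaos A G)) (1 / (2 ^ n.+1)%:R).
  have [|F0 hF] := h (1 / (2 ^ n.+1)%:R); first by rewrite divr_gt0// ltr0n expn_gt0.
  by exists (F0 `|` F)%fset; split; [exact: fsubsetUr|apply: hF; exact: fsubsetUl].
by have [G hG] := boolp.choice h; exists G; split => n; case: (hG n).
Qed.

Lemma L2_approx_ae A X (G : nat -> {fset mindex J}) : borel_rv X ->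
  (forall n, mom_le P 2 (rvB X (chaos A (G n))) (1 / (2 ^ n.+1)%:R)) ->
  {ae P, forall w, hs_norm (chaos A (G n) w - X w) @[n --> \oo] --> (0 : R)}.
Proof.
move=> mX h.
have mD n : borel_rv (rvB X (chaos A (G n))) := borel_rvB mX (borel_chaos A (G n)).
apply: filterS (mom_le_ae mD h) => w hw.
by apply: cvg_trans hw; apply: near_eq_cvg; near=> n; rewrite hs_normBC.
Unshelve. all: by end_near. Qed.

(** The right-hand side of the hypercontractive inequality. *)
Definition wnorm (r : nat) A F : R :=
  \sum_(al <- F) (4 * r%:R + 1) ^+ mdeg al * hs_norm (A al) ^+ 2.

Definition hypercontr (r : nat) : Prop := forall F A, mom_le P (r + r) (chaos A F) (wnorm r A F ^+ r).

Lemma wnorm_ge0 r A F : 0 <= wnorm r A F.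
Proof. by apply: sumr_ge0 => al _; rewrite mulr_ge0 ?sqr_ge0// exprn_ge0// addr_ge0// mulr_ge0. Qed.

(** Along the sets of an almost surely convergent sequence the differences of
    partial sums satisfy the hypercontractive bound; Fatou's lemma passes it to
    the limit. *)
Lemma chaos_tail r A X F del : hypercontr r -> L2_approx A X ->
  (forall G, wnorm r A (G `\` F)%fset <= del) ->
  mom_le P (r + r) (rvB X (chaos A F)) (del ^+ r).
Proof.
move=> hy aX hd; have [mX _] := aX.
have [G [FG Ge]] := L2_approx_seq F aX.
apply: (@mom_le_fatou _ _ _ _ P _ (fun n => rvB (chaos A (G n)) (chaos A F))).
- by move=> n; exact: borel_rvB (borel_chaos _ _) (borel_chaos _ _).
- exact: borel_rvB mX (borel_chaos _ _).
- apply: filterS (L2_approx_ae mX Ge) => w; apply: cvg_trans; apply: near_eq_cvg.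
  by near=> n; rewrite /rvB opprB addrA subrK.
move=> n; rewrite chaos_diff//; apply: int_leK (hy _ _).
by rewrite lerXn2r// nnegrE ?wnorm_ge0// (le_trans (wnorm_ge0 _ _ _) (hd F)).
Unshelve. all: by end_near. Qed.

End Chaos.

(** * Weighted norms of coefficient arrays *)

Section WeightedNorms.
Context {R : realType} {E : sepHilbert R} {J : countType}.
Implicit Types (A B : array J E) (F G : {fset mindex J}).

Lemma sum_sqr_le (I : Type) (s : seq I) (b : I -> R) : (forall i, 0 <= b i) ->
  \sum_(i <- s) b i ^+ 2 <= (\sum_(i <- s) b i) ^+ 2.
Proof.
move=> b0; elim: s => [|i s IH]; first by rewrite !big_nil expr0n.
rewrite !big_cons sqrrD -addrA lerD2l; apply: le_trans IH _.
by rewrite lerDr mulrn_wge0// mulr_ge0// sumr_ge0.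
Qed.

(** Group the multi-indices by degree. As [rho = 4r+1] is at least [1], the weight
    [rho^m] is at most [rho^(2m)], and a sum of squares of nonnegative numbers is
    at most the square of their sum. *)
Lemma wnorm_le_p r A F c : (p_norm (4 * r%:R + 1) A <= c%:E)%E -> wnorm r A F <= c ^+ 2.
Proof.
move=> pc; pose rho : R := 4 * r%:R + 1.
have rho1 : 1 <= rho by rewrite lerDr mulr_ge0.
have rho0 : 0 <= rho by rewrite (le_trans ler01).
pose s2 m : R := \sum_(al <- F | mdeg al == m) hs_norm (A al) ^+ 2.
have s20 m : 0 <= s2 m by apply: sumr_ge0 => al _; exact: sqr_ge0.
pose b m : R := rho ^+ m * Num.sqrt (s2 m).
have b0 m : 0 <= b m by rewrite mulr_ge0 ?exprn_ge0// sqrtr_ge0.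
rewrite /wnorm (partition_big_imfset _ (@mdeg J) F)/=.
set D := [fset mdeg x | x in F]%fset.
apply: (@le_trans _ _ (\sum_(m <- D) b m ^+ 2)).
  apply: ler_sum => m _; rewrite /b exprMn sqr_sqrtr//.
  rewrite mulr_sumr; apply: ler_sum => al /eqP ->.
  by rewrite ler_wpM2r ?sqr_ge0// -exprM ler_weXn2l// leq_pmulr.
apply: le_trans (sum_sqr_le _ b0) _.
suff h : \sum_(m <- D) b m <= c.
  have S0 : 0 <= \sum_(m <- D) b m by apply: sumr_ge0.
  by rewrite lerXn2r// nnegrE// (le_trans S0).
rewrite -lee_fin; apply: le_trans pc; rewrite /p_norm nneseries_esum; last first.
  by move=> m _; rewrite mule_ge0 ?sqrte_ge0// lee_fin exprn_ge0.
apply: esum_ge; exists [set` D]; first by split => //; exact: finite_fset.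
rewrite fsbig_finite ?set_fsetK/=; last exact: finite_fset.
rewrite -sumEFin; apply: lee_sum => m _; rewrite /b EFinM.
apply: lee_wpmul2l; first by rewrite lee_fin exprn_ge0.
rewrite -[X in (X <= _)%E]/(sqrte (s2 m)%:E) lee_sqrt; last first.
  by apply: esum_ge0 => al _; rewrite lee_fin sqr_ge0.
apply: esum_ge; exists [set` [fset al in F | mdeg al == m]%fset].
  by split; [exact: finite_fset|move=> al /=; rewrite !inE/= => /andP[_ /eqP]].
rewrite fsbig_finite ?set_fsetK/=; last exact: finite_fset.
by rewrite sumEFin lee_fin /s2 big_fset.
Qed.

Lemma frakA2_wnorm r A : frakA2 A -> exists2 c, 0 <= c & forall F, wnorm r A F <= c.
Proof.
move=> hA; have [c hc] : exists c, p_norm (4 * r%:R + 1) A = c%:E.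
  have p0 : (0 <= p_norm (4 * r%:R + 1) A)%E.
    by apply: nneseries_ge0 => m _ _; apply: mule_ge0; rewrite ?sqrte_ge0// lee_fin.
  have := hA (4 * r%:R + 1); rewrite lerDr mulr_ge0// => /(_ isT).
  rewrite -ge0_fin_numE// => /fineK e; by exists (fine (p_norm (4 * r%:R + 1) A)).
exists (c ^+ 2); first exact: sqr_ge0.
by move=> F; apply: wnorm_le_p; rewrite hc.
Qed.

Lemma wnorm_diff r A F G : (F `<=` G)%fset -> wnorm r A (G `\` F)%fset = wnorm r A G - wnorm r A F.
Proof.
by move=> FG; rewrite /wnorm (big_fsetD _ FG) addrAC subrr add0r.
Qed.

(** Choose [F] almost attaining the supremum of the finite weighted sums. *)
Lemma wnorm_tail r A eps : frakA2 A -> 0 < eps ->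
  exists F, forall G, wnorm r A (G `\` F)%fset <= eps.
Proof.
move=> hA e0; have [c c0 hc] := frakA2_wnorm r hA.
pose V := [set wnorm r A F | F in setT].
have hV : has_sup V.
  split; first by exists (wnorm r A fset0), fset0.
  by exists c => _ [F _ <-].
have [_ [F _ <-] hF] := sup_adherent e0 hV.
exists F => G.
have -> : (G `\` F = (F `|` G) `\` F)%fset by rewrite fsetDUl fsetDv fset0U.
rewrite wnorm_diff ?fsubsetUl// lerBlDl.
have : wnorm r A (F `|` G)%fset <= sup V by apply: sup_upper_bound => //; exists (F `|` G)%fset.
move=> h; apply: (le_trans h); rewrite addrC -lerBlDl addrC ltW//.
by rewrite addrC.
Qed.

Lemma wnorm_arrayB r A B F : wnorm r A F <= 2 * wnorm r B F + 2 * wnorm r (arrayB A B) F.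
Proof.
rewrite /wnorm !mulr_sumr -big_split/=; apply: ler_sum => al _.
rewrite ![2 * _]mulrCA -mulrDr ler_wpM2l ?exprn_ge0 ?addr_ge0 ?mulr_ge0//.
have : hs_norm (A al) <= hs_norm (B al) + hs_norm (A al - B al).
  by apply: le_trans (hs_normD _ _); rewrite addrC subrK.
rewrite /arrayB; have := hs_norm_ge0 (A al).
move: (hs_norm (A al)) (hs_norm (B al)) (hs_norm (A al - B al)) => a b c a0 h.
have h2 : a ^+ 2 <= (b + c) ^+ 2 by apply: lerXn2r; rewrite ?nnegrE ?(le_trans a0 h).
apply: le_trans h2 _; rewrite -subr_ge0.
by rewrite (_ : _ - _ = (b - c) ^+ 2); [exact: sqr_ge0|ring].
Qed.

Lemma wnorm_cvg r (AN : nat -> array J E) A eps :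
  (forall rho, 1 <= rho -> p_norm rho (arrayB (AN N) A) @[N --> \oo] --> 0%E) -> 0 < eps ->
  \forall N \near \oo, forall F, wnorm r (arrayB (AN N) A) F <= eps.
Proof.
move=> h e0; pose c := Num.sqrt eps; have c0 : 0 < c by rewrite sqrtr_gt0.
have r1 : 1 <= 4 * r%:R + 1 :> R by rewrite lerDr mulr_ge0.
have : nbhs (0 : \bar R)%E [set x | (x < c%:E)%E].
  by apply: open_nbhs_nbhs; split; [exact: open_ereal_lt_ereal|rewrite /= lte_fin].
move=> /(h _ r1) [N0 _ hN0]; exists N0 => // N /hN0 /= hN F.
by rewrite -[eps]sqr_sqrtr ?(ltW e0)//; apply: wnorm_le_p; exact: ltW.
Qed.

End WeightedNorms.

(** * Convergence of the coupled responses *)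

Section ChaosOfCoupledSums.
Context {R : realType} {E : sepHilbert R} {J : countType} {d d' : measure_display}.
Context {W : measurableType d} {W' : measurableType d'}.
Variables (P : probability W R) (P' : probability W' R).
Variables (xi : J -> nat -> {RV P >-> R}) (g : J -> {RV P' >-> R}).
Hypotheses (xi_signs : independent_signs xi) (g_gauss : independent_std_gaussians g).
Implicit Types (A : array J E) (F G : {fset mindex J}).

Lemma int_le_ae (f h : W -> R) K : measurable_fun setT f -> measurable_fun setT h ->
  (forall w, 0 <= f w) -> (forall w, 0 <= h w) -> {ae P, forall w, f w = h w} ->
  int_le P f K -> int_le P h K.
Proof.
move=> mf mh f0 h0 fh fK; apply: (@int_le_fatou _ _ _ P (fun=> f)) => //.
by apply: filterS fh => w ->; exact: cvg_cst.
Qed.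

Definition Psi_of_blocks N al (w : W) : R := Psi_sum N al (fun j => block_rv xi N j w).
Definition Psi_of_coupled N al (w : W') : R := Psi_sum N al (fun j => coupled xi g N j w).

Lemma measurable_Psi_of_blocks N al : measurable_fun setT (Psi_of_blocks N al).
Proof.
have mS : measurable_fun setT (fun w : W => ((fun j => block_rv xi N j w) : @real_family R J)).
  by apply: measurable_family => j.
exact: (measurableT_comp (measurable_Psi_sum N al) mS).
Qed.

Lemma measurable_Psi_of_coupled N al : measurable_fun setT (Psi_of_coupled N al).
Proof.
have mS : measurable_fun setT (fun w : W' => ((fun j => coupled xi g N j w) : @real_family R J)).
  by apply: measurable_family => j.
exact: (measurableT_comp (measurable_Psi_sum N al) mS).
Qed.

Lemma measurable_Psi_gauss al : measurable_fun setT (Psi_gauss g al).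
Proof.
apply: measurable_prod => j _; apply: measurable_funM => //.
apply: (@measurableT_comp _ _ _ W' R R (fun x => (hermite (al j)).[x])) => //.
apply: continuous_measurable_fun; exact: continuous_horner.
Qed.

Lemma borel_sum_fun N A F : borel_rv (fun s : @real_family R J => \sum_(al <- F) (Psi_sum N al s)%:C *: A al).
Proof. by apply: borel_finite_sum => al; exact: measurable_Psi_sum. Qed.

Lemma transfer_moment n N (h : @real_family R J -> hs_op E) K : borel_rv h ->
  mom_le P n (fun w => h (fun j => block_rv xi N j w)) K ->
  mom_le P' n (fun w => h (fun j => coupled xi g N j w)) K.
Proof.
move=> mh hK; have mm := measurable_mom n mh.
have := @integral_transfer R J _ _ W W' P P' (block_rv xi N) (coupled xi g N)
  (block_indep xi_signs N) (coupled_indep xi g_gauss N)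
  (coupled_margin xi g_gauss N) (fun s => (hs_norm (h s) ^+ n)%:E).
rewrite /mom_le /int_le => <- //; first exact/measurable_EFinP.
by move=> s; rewrite lee_fin; exact: mom_ge0.
Qed.

Lemma hypercontr_block r N : (0 < N)%N -> hypercontr (E := E) P (Psi_of_blocks N) r.
Proof.
move=> N0 F A.
apply: (int_le_ae (f := fun w => hs_norm (\sum_(al <- F) (Psi_block xi N al w)%:C *: A al) ^+ (r + r))).
- apply: measurable_mom; apply: borel_finite_sum => al; exact: measurable_Psi_block.
- apply: measurable_mom; apply: borel_chaos => al; exact: measurable_Psi_of_blocks.
- by move=> w; rewrite exprn_ge0// hs_norm_ge0.
- by move=> w; exact: mom_ge0.
- apply: filterS (Psi_block_ae xi_signs N0) => w hw.
  rewrite [in RHS](_ : chaos _ _ _ w = \sum_(al <- F) (Psi_block xi N al w)%:C *: A al)//.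
  by apply: eq_bigr => al _; rewrite hw.
exact: block_hypercontr.
Qed.

Lemma hypercontr_coupled r N : (0 < N)%N -> hypercontr (E := E) P' (Psi_of_coupled N) r.
Proof.
by move=> N0 F A; apply: (transfer_moment (borel_sum_fun N A F)); exact: hypercontr_block.
Qed.

Lemma chaos_cvg A F w :
  hs_norm (rvB (chaos (Psi_of_coupled N) A F) (chaos (Psi_gauss g) A F) w) @[N --> \oo] --> (0 : R).
Proof.
apply: (@squeeze_cvgr _ _ _ _ (fun=> 0)
  (fun N => \sum_(al <- F) `|Psi_of_coupled N al w - Psi_gauss g al w| * hs_norm (A al))).
- near=> N; rewrite hs_norm_ge0/= /rvB /chaos -sumrB.
  apply: le_trans (hs_norm_sum _ _) _; apply: ler_sum => al _.
  by rewrite -scalerBl -rmorphB hs_normZc cabs_real.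
- exact: cvg_cst.
elim: (F : seq _) => [|al l IH].
  by under eq_cvg do rewrite big_nil; exact: cvg_cst.
under eq_cvg do rewrite big_cons.
have h1 : Psi_of_coupled N al w @[N --> \oo] --> Psi_gauss g al w.
  by apply: Psi_sum_cvg => j; exact: coupled_cvg.
have h2 : `|Psi_of_coupled N al w - Psi_gauss g al w| * hs_norm (A al) @[N --> \oo] --> (0 : R).
  have := cvgM (cvg_norm (cvgB h1 (cvg_cst (Psi_gauss g al w)))) (cvg_cst (hs_norm (A al))).
  by rewrite subrr normr0 mul0r => hh; exact: hh.
by have := cvgD h2 IH; rewrite addr0 => hh; exact: hh.
Unshelve. all: by end_near. Qed.

(** Fatou's lemma along the coupled sums: hypercontractivity of the Gaussian chaos
    is inherited from the cube. *)
Lemma hypercontr_gauss r : hypercontr (E := E) P' (Psi_gauss g) r.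
Proof.
move=> F A.
have mc n : borel_rv (chaos (Psi_of_coupled n.+1) A F) := borel_chaos (measurable_Psi_of_coupled n.+1) A F.
have mg : borel_rv (chaos (Psi_gauss g) A F) := borel_chaos measurable_Psi_gauss A F.
have hc n : mom_le P' (r + r) (chaos (Psi_of_coupled n.+1) A F) (wnorm r A F ^+ r).
  exact: (hypercontr_coupled r (ltn0Sn n) F A).
refine (mom_le_fatou mc mg _ hc).
have sh (u : nat -> R) : u N @[N --> \oo] --> (0 : R) -> u N.+1 @[N --> \oo] --> (0 : R).
  by rewrite -cvg_shiftS.
apply: aeW => w.
exact: (sh _ (chaos_cvg A F w)).
Qed.

Section Convergence.
Variables (AN : nat -> array J E) (A : array J E).
Variables (X : nat -> W' -> hs_op E) (Y : W' -> hs_op E).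
Hypotheses (hAN : forall N, frakA2 (AN N)) (hA : frakA2 A).
Hypothesis ANA : forall rho, 1 <= rho -> p_norm rho (arrayB (AN N) A) @[N --> \oo] --> 0%E.
Hypothesis XA : forall N, (0 < N)%N -> L2_approx P' (Psi_of_coupled N) (AN N) (X N).
Hypothesis YA : L2_approx P' (Psi_gauss g) A Y.

Let mX N : (0 < N)%N -> borel_rv (X N). Proof. by move=> /XA[]. Qed.
Let mY : borel_rv Y. Proof. by case: YA. Qed.
Let mC N B F : borel_rv (chaos (E := E) (Psi_of_coupled N) B F).
Proof. by apply: borel_chaos => al; exact: measurable_Psi_of_coupled. Qed.
Let mG B F : borel_rv (chaos (E := E) (Psi_gauss g) B F).
Proof. by apply: borel_chaos => al; exact: measurable_Psi_gauss. Qed.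

Lemma L2_approx_moment (Psi : mindex J -> W' -> R) (B : array J E) (Z : W' -> hs_op E) n :
  (forall al, measurable_fun setT (Psi al)) -> (forall r, hypercontr (E := E) P' Psi r) ->
  frakA2 B -> L2_approx P' Psi B Z -> exists K, mom_le P' n Z K.
Proof.
move=> mPsi hPsi hB hZ; have [c c0 hc] := frakA2_wnorm n hB.
have := @chaos_tail _ _ _ _ _ _ _ mPsi n _ _ fset0 c (hPsi n) hZ (fun G => hc _).
have -> : rvB Z (chaos Psi B fset0) = Z.
  by apply/funext => w; rewrite /rvB /chaos big_seq_fset0 subr0.
by move=> h; exists (1 + c ^+ n / 1); apply: mom_le_half => //; case: hZ.
Qed.

(** Four terms: the tail of [X N], uniformly small in [N]; the change from [AN N]
    to [A] in finitely many coefficients; the convergence of a finite sum with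
    fixed coefficients; and the tail of [Y]. *)
Lemma even_moments_cvg r eps : (0 < r)%N -> 0 < eps ->
  \forall N \near \oo, mom_le P' (r + r) (rvB (X N) Y) eps.
Proof.
move=> r0 eps0.
(* [q] is lost at each use of the triangle inequality for moments; [a] is such
   that four terms of size [a] then add up to at most [eps] *)
pose q : R := 2 ^+ (r + r).
have q1 : 1 <= q by rewrite exprn_ege1// ler1n.
have q0 : 0 < q by rewrite (lt_le_trans ltr01).
pose a := eps / (4 * q ^+ 3).
have a0 : 0 < a by rewrite divr_gt0// mulr_gt0// exprn_gt0.
(* the weighted tail of [AN N] is at most twice those of [A] and of the
   difference, hence the factor [4] *)
pose del := Num.min 1 a / 4.
have m0 : 0 < Num.min 1 a by rewrite lt_min ltr01.
have del0 : 0 < del by rewrite divr_gt0.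
have del4 : (4 * del) ^+ r <= a.
  have -> : 4 * del = Num.min 1 a by rewrite /del mulrC divfK.
  apply: (@le_trans _ _ (Num.min 1 a)); last by rewrite ge_min lexx orbT.
  by rewrite ler_iXnr ?(ltW m0)// ge_min lexx.
have del1 : del ^+ r <= a.
  have d0 := ltW del0; apply: le_trans del4; apply: lerXn2r; rewrite ?nnegrE//.
    exact: mulr_ge0.
  by rewrite ler_peMl// ler1n.
have [F hF] := wnorm_tail r hA del0.
have D4 : mom_le P' (r + r) (rvB (chaos (Psi_gauss g) A F) Y) a.
  apply: (@mom_le_mono _ _ _ _ _ _ _ (rvB Y (chaos (Psi_gauss g) A F))).
  - exact: borel_rvB.
  - exact: borel_rvB.
  - by move=> w; rewrite /rvB hs_normBC.
  exact: (int_leK del1 (chaos_tail measurable_Psi_gauss (hypercontr_gauss r) YA hF)).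
have D3 : \forall N \near \oo,
    mom_le P' (r + r) (rvB (chaos (Psi_of_coupled N) A F) (chaos (Psi_gauss g) A F)) a.
  pose K := wnorm (r + r) A F ^+ (r + r).
  apply: (@vitali _ _ _ _ P' _ _ (2 ^+ (r + r + (r + r)) * (K + K))) => //.
  - by move=> N _; exact: borel_rvB.
  - by rewrite addn_gt0 r0.
  - by move=> w; exact: chaos_cvg.
  - by move=> N N0; apply: mom_leB => //; [exact: hypercontr_coupled|exact: hypercontr_gauss].
have hN := @wnorm_cvg R E J r AN A del ANA del0.
near=> N.
have N0 : (0 < N)%N by near: N; exact: nbhs_infty_gt.
have wN : forall G, wnorm r (arrayB (AN N) A) G <= del by near: N.
have D2 : mom_le P' (r + r) (rvB (chaos (Psi_of_coupled N) (AN N) F) (chaos (Psi_of_coupled N) A F)) a.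
  rewrite chaosB_array; apply: (int_leK del1); apply: (int_leK _ (hypercontr_coupled r N0 _ _)).
  by rewrite lerXn2r ?nnegrE ?wnorm_ge0// ltW.
have D1 : mom_le P' (r + r) (rvB (X N) (chaos (Psi_of_coupled N) (AN N) F)) a.
  have tl G : wnorm r (AN N) (G `\` F)%fset <= 4 * del.
    apply: le_trans (wnorm_arrayB _ _ A _) _.
    have -> : 4 * del = 2 * del + 2 * del by ring.
    by apply: lerD; rewrite ler_pM2l.
  exact: (int_leK del4 (chaos_tail (measurable_Psi_of_coupled N) (hypercontr_coupled r N0) (XA N0) tl)).
have D3N : mom_le P' (r + r) (rvB (chaos (Psi_of_coupled N) A F) (chaos (Psi_gauss g) A F)) a by near: N.
rewrite (rvB_triangle _ (chaos (Psi_of_coupled N) (AN N) F)).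
rewrite (rvB_triangle (chaos (Psi_of_coupled N) (AN N) F) (chaos (Psi_of_coupled N) A F)).
rewrite (rvB_triangle (chaos (Psi_of_coupled N) A F) (chaos (Psi_gauss g) A F)).
have h34 := mom_leD (borel_rvB (mC N A F) (mG A F)) (borel_rvB (mG A F) mY) D3N D4.
have h234 := mom_leD (borel_rvB (mC N (AN N) F) (mC N A F))
  (borel_rvD (borel_rvB (mC N A F) (mG A F)) (borel_rvB (mG A F) mY)) D2 h34.
have := mom_leD (borel_rvB (mX N0) (mC N (AN N) F)) (borel_rvD (borel_rvB (mC N (AN N) F) (mC N A F))
  (borel_rvD (borel_rvB (mC N A F) (mG A F)) (borel_rvB (mG A F) mY))) D1 h234.
apply: int_leK; rewrite -/q.
have -> : eps = 4 * q ^+ 3 * a by rewrite /a mulrC divfK// gt_eqF// mulr_gt0// exprn_gt0.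
rewrite -subr_ge0.
have -> : 4 * q ^+ 3 * a - q * (a + q * (a + q * (a + a))) = a * q * ((q - 1) * (2 * q + 1)) by ring.
apply: mulr_ge0; first by rewrite mulr_ge0 ?(ltW a0) ?(ltW q0).
by apply: mulr_ge0; [rewrite subr_ge0|rewrite addr_ge0// mulr_ge0// ltW].
Unshelve. all: by end_near. Qed.

Lemma chaos_converges : cvg_moments P' X Y.
Proof.
split.
- exact: mX.
- exact: mY.
- move=> n N N0; apply: (L2_approx_moment n (measurable_Psi_of_coupled N) _ (hAN N)); last exact: XA.
  by move=> r; exact: hypercontr_coupled.
- by move=> n; exact: (L2_approx_moment n measurable_Psi_gauss hypercontr_gauss hA).
move=> n eps n0 eps0; have e20 : 0 < eps / 2 by rewrite divr_gt0.
have h := even_moments_cvg n0 (exprn_gt0 2 e20).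
near=> N; have N0 : (0 < N)%N by near: N; exact: nbhs_infty_gt.
have hN : mom_le P' (n + n) (rvB (X N) Y) ((eps / 2) ^+ 2) by near: N.
have := mom_le_half (borel_rvB (mX N0) mY) e20 hN.
apply: int_leK; rewrite expr2 mulfK ?gt_eqF//; have := splitr eps; lra.
Unshelve. all: by end_near. Qed.

End Convergence.
End ChaosOfCoupledSums.

(** * Responses as functions of the block sums *)

Section JointLaws.
Context {R : realType} {E : sepHilbert R} {J : countType} {k : nat}.

Lemma measurable_joint d (V : measurableType d) (s : J -> V -> R) (x : 'I_k -> V -> hs_op E)
    (C : set ((J -> R) * ('I_k -> hs_op E))) :
  (forall j, measurable_fun setT (s j)) -> (forall i, borel_rv (x i)) ->
  <<s @joint_cylinders R J E k >> C -> measurable [set v | C (s ^~ v, x ^~ v)].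
Proof.
move=> ms mx mC.
have mp : measurable_fun setT (fun v => (s ^~ v, x ^~ v) : g_sigma_algebraType (@joint_cylinders R J E k)).
  apply: (@measurability _ _ _ (g_sigma_algebraType (@joint_cylinders R J E k)) _ _ (@joint_cylinders R J E k)) => //.
  move=> _ [_ [[j [B mB ->]]|[i [U oU ->]]] <-]; rewrite setTI.
    by rewrite -[X in measurable X]setTI; exact: ms.
  exact: (borel_open (mx i) oU).
by have := mp measurableT C mC; rewrite setTI.
Qed.

Lemma ae_eq_prob d (V : measurableType d) (Q : probability V R) (A B : set V) :
  measurable A -> measurable B -> {ae Q, forall v, A v <-> B v} -> Q A = Q B.
Proof.
move=> mA mB [N [mN N0 hN]].
have le (C D : set V) : measurable C -> measurable D -> (forall v, ~ N v -> C v -> D v) -> (Q C <= Q D)%E.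
  move=> mC mD CD; apply: (@le_trans _ _ (Q (D `|` N))).
    apply: le_measure; rewrite ?inE//; first exact: measurableU.
    by move=> v Cv; have [Nv|Nv] := pselect (N v); [right|left; exact: CD].
  have e : (Q D + Q N <= Q D)%E by rewrite N0 adde0.
  exact: (le_trans (measureU2 Q mD mN) e).
have nN v : ~ N v -> A v <-> B v by move=> nv; apply: contrapT => h; apply: nv; exact: hN.
by apply/eqP; rewrite eq_le !le// => v /nN[].
Qed.

End JointLaws.

Section Response.
Context {R : realType} {E : sepHilbert R} {J : countType} {d d' : measure_display}.
Context {W : measurableType d} {W' : measurableType d'}.
Variables (P : probability W R) (P' : probability W' R).
Variables (xi : J -> nat -> {RV P >-> R}) (g : J -> {RV P' >-> R}).
Hypotheses (xi_signs : independent_signs xi) (g_gauss : independent_std_gaussians g).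

Lemma borel_family d0 (V : measurableType d0) (f : @real_family R J -> hs_op E) (s : J -> V -> R) :
  borel_rv f -> (forall j, measurable_fun setT (s j)) -> borel_rv (fun v => f (fun j => s j v)).
Proof. move=> mf ms; exact: (measurableT_comp mf (measurable_family ms)). Qed.

(** The almost sure limit along finite sets with summable errors is a Borel
    function [f] of the family of block sums. The series evaluated at the coupled
    sums then converges in [L^2] to [f] of the coupled sums, because all second
    moments involved depend on the joint law only. *)
Lemma exists_response N (B : array J E) (Z : W -> hs_op E) : (0 < N)%N -> is_Phi_block xi N B Z ->
  exists f : @real_family R J -> hs_op E, [/\ borel_rv f,
    {ae P, forall w, Z w = f (fun j => block_rv xi N j w)} &
    L2_approx P' (Psi_of_coupled xi g N) B (fun w => f (fun j => coupled xi g N j w))].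
Proof.
move=> N0 hZ.
have aZ : L2_approx P (Psi_block xi N) B Z := is_L2_sum_approx (fun al => measurable_Psi_block xi N al) hZ.
have [mZ ZF] := aZ.
have [G [_ hG]] := L2_approx_seq fset0 aZ.
pose c (F : {fset mindex J}) (s : @real_family R J) : hs_op E := \sum_(al <- F) (Psi_sum N al s)%:C *: B al.
have mc F : borel_rv (c F) := borel_sum_fun N B F.
have cE F : {ae P, forall w, chaos (Psi_block xi N) B F w = c F (fun j => block_rv xi N j w)}.
  apply: filterS (Psi_block_ae xi_signs N0) => w hw.
  by apply: eq_bigr => al _; rewrite hw.
pose f s := hs_lim (fun n => c (G n) s).
have mf : borel_rv f by apply: borel_hs_lim => n; exact: mc.
have mfS : borel_rv (fun w => f (fun j => block_rv xi N j w)) by apply: borel_family.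
have Zf : {ae P, forall w, Z w = f (fun j => block_rv xi N j w)}.
  have cE' := ae_foralln (fun n => cE (G n)).
  have hZ0 := L2_approx_ae (fun al => measurable_Psi_block xi N al) mZ hG.
  apply: filterS2 cE' hZ0 => w hw hl; apply/esym; rewrite /f; apply: hs_limP.
  by apply: cvg_trans hl; apply: near_eq_cvg; near=> n; rewrite hw.
have mfC : borel_rv (fun w => f (fun j => coupled xi g N j w)) by apply: borel_family.
exists f; split; [exact: mf|exact: Zf|split; first exact: mfC].
move=> eps eps0; have [F0 hF] := ZF _ eps0; exists F0 => F FF.
pose h s := f s - c F s.
have mh : borel_rv h := borelB mf (mc F).
apply: (transfer_moment xi_signs g_gauss (h := h) mh).
apply: (int_le_ae (f := fun w => hs_norm (rvB Z (chaos (Psi_block xi N) B F) w) ^+ 2)).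
- exact: (measurable_mom 2 (borel_rvB mZ (borel_chaos (fun al => measurable_Psi_block xi N al) B F))).
- by apply: (measurable_mom 2 (borel_family mh _)).
- by move=> w; exact: mom_ge0.
- by move=> w; rewrite exprn_ge0// hs_norm_ge0.
- by apply: filterS2 Zf (cE F) => w; rewrite /rvB /h => -> ->.
exact: hF.
Unshelve. all: by end_near. Qed.

End Response.

Section LawConvergence.
Context {R : realType} {E : sepHilbert R} {k : nat}.

(** Convergence in the product topology is convergence of each component. *)
Lemma continuous_seq_cont (F : {ptws 'I_k -> hs_op E} -> R) : continuous F ->
  seq_cont (F : ('I_k -> hs_op E) -> R).
Proof.
move=> cF u f uf.
have h : (fun n => u n : {ptws 'I_k -> hs_op E}) @ \oo --> (f : {ptws 'I_k -> hs_op E}).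
  apply/cvg_sup => i U.
  rewrite (@nbhsE (initial_topology (fun f : 'I_k -> hs_op E => f i)) f).
  case=> B [[C oC <-] Cf] /filterS; apply.
  have /hs_cvgP h := uf i.
  by apply: h; apply: open_nbhs_nbhs.
exact: (cvg_comp _ _ h (cF f)).
Qed.

End LawConvergence.

(** * Convergence in law and the coupling *)

Section ExpectationLimits.
Context {R : realType} {E : sepHilbert R} {d : measure_display} {W : measurableType d}.
Variables (P : probability W R) (k : nat).
Variables (X : nat -> 'I_k -> W -> hs_op E) (Y : 'I_k -> W -> hs_op E).
Hypothesis XY : forall i, cvg_moments P (fun N => X N i) (Y i).

(** Otherwise some subsequence of the expectations stays away from the limit; a
    further subsequence of the random operators converges almost surely, and
    dominated convergence contradicts this. *)
Lemma expectation_cvg (G : ('I_k -> hs_op E) -> R) (M : R) : seq_cont G ->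
  (forall x, `|G x| <= M) ->
  (\int[P]_w (G (X N ^~ w))%:E @[N --> \oo] --> \int[P]_w (G (Y ^~ w))%:E)%E.
Proof.
move=> cG GM; set l := (\int[P]_w (G (Y ^~ w))%:E)%E.
pose a N := (\int[P]_w (G (X N ^~ w))%:E)%E.
have mX N i : (0 < N)%N -> borel_rv (X N i) by case: (XY i) => h _ _ _ _; exact: h.
have mY i : borel_rv (Y i) by case: (XY i).
move=> U nU; apply: contrapT => hU.
pose good n N := forall i, mom_le P 2 (rvB (X N i) (Y i)) (1 / (2 ^ n.+1)%:R).
have goodn n : \forall N \near \oo, good n N.
  apply: filter_forall => i; case: (XY i) => _ _ _ _; apply => //.
have ex n : exists N, [/\ (0 < N)%N, good n N & ~ U (a N)].
  apply: contrapT => no.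
  have : ~ (\forall N \near \oo, U (a N)) := hU; apply; near=> N; apply: contrapT => nUN; apply: no.
  exists N; split => //; last by near: N; exact: goodn.
  by near: N; exact: nbhs_infty_gt.
have [s hs] := boolp.choice ex.
have aec : {ae P, forall w, forall i, hs_norm (X (s n) i w - Y i w) @[n --> \oo] --> (0 : R)}.
  apply: filter_forall => i.
  apply: (mom_le_ae (Z := fun n => rvB (X (s n) i) (Y i))) => n.
    by have [s0 _ _] := hs n; apply: borel_rvB => //; exact: mX.
  by have [_ gn _] := hs n; exact: gn.
have al : (a (s n) @[n --> \oo] --> l)%E.
  have := @dominated_convergence _ W R P setT measurableT
    (fun n w => (G (X (s n) ^~ w))%:E) (fun w => (G (Y ^~ w))%:E) (fun=> M%:E).
  case => //.
  - move=> n; apply/measurable_EFinP; apply: seq_cont_measurable_fun => // i.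
    by have [s0 _ _] := hs n; exact: mX.
  - by apply/measurable_EFinP; exact: seq_cont_measurable_fun.
  - apply: filterS aec => w hw _; apply: cvg_EFin; first by near=> n.
    by apply: cG => i; exact: hw.
  - exact: finite_measure_integrable_cst.
  - by apply: aeW => w n _; rewrite /= lee_fin; exact: GM.
have : \forall n \near \oo, U (a (s n)) by exact: al.
move=> [n _ hn]; have [_ _ nUn] := hs n; apply: nUn; exact: (hn n (leqnn n)).
Unshelve. all: by end_near. Qed.

End ExpectationLimits.

Section Assembly.
Context {R : realType} {E : sepHilbert R} {J : countType} {d d' : measure_display}.
Context {W : measurableType d} {W' : measurableType d'}.
Variables (P : probability W R) (P' : probability W' R).
Variables (xi : J -> nat -> {RV P >-> R}) (g : J -> {RV P' >-> R}).
Hypotheses (xi_signs : independent_signs xi) (g_gauss : independent_std_gaussians g).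

Lemma transfer_expectation N (h : @real_family R J -> R) : measurable_fun setT h ->
  (\int[P]_w (h (fun j => block_rv xi N j w))%:E = \int[P']_w (h (fun j => coupled xi g N j w))%:E)%E.
Proof.
move=> mh; have mE : measurable_fun setT (EFin \o h) by exact/measurable_EFinP.
have tr := @integral_transfer R J _ _ W W' P P' (block_rv xi N) (coupled xi g N)
  (block_indep xi_signs N) (coupled_indep xi g_gauss N) (coupled_margin xi g_gauss N).
rewrite [LHS]integralE [RHS]integralE; congr (_ - _)%E.
  transitivity (\int[P]_w (EFin \o h)^\+ (fun j => block_rv xi N j w))%E; first by apply: eq_integral => w _; rewrite !funepos.unlock.
  by rewrite (tr (fun s => (EFin \o h)^\+ s)%E); [apply: eq_integral => w _; rewrite !funepos.unlock|exact: measurable_funepos|move=> s; exact: funepos_ge0].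
transitivity (\int[P]_w (EFin \o h)^\- (fun j => block_rv xi N j w))%E; first by apply: eq_integral => w _; rewrite !funeneg.unlock.
by rewrite (tr (fun s => (EFin \o h)^\- s)%E); [apply: eq_integral => w _; rewrite !funeneg.unlock|exact: measurable_funeneg|move=> s; exact: funeneg_ge0].
Qed.

Variables (k : nat) (AN : nat -> 'I_k -> array J E) (A : 'I_k -> array J E).
Hypotheses (hAN : forall N i, frakA2 (AN N i)) (hA : forall i, frakA2 (A i)).
Hypothesis ANA : forall (i : 'I_k) (rho : R), 1 <= rho ->
  p_norm rho (arrayB (AN N i) (A i)) @[N --> \oo] --> 0%E.

(** The coupling lives on the space of the given Gaussians, with the given
    Gaussian responses themselves as limits; the copies are the same Borel
    functions of the coupled sums as the block responses are of the block sums. *)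
Lemma responses_converge_of_arrays : responses_converge xi g AN A.
Proof.
move=> X Y hX hY.
have ex (Ni : nat * 'I_k) : exists f : @real_family R J -> hs_op E, (0 < Ni.1)%N -> [/\ borel_rv f,
    {ae P, forall w, X Ni.1 Ni.2 w = f (fun j => block_rv xi Ni.1 j w)} &
    L2_approx P' (Psi_of_coupled xi g Ni.1) (AN Ni.1 Ni.2) (fun w => f (fun j => coupled xi g Ni.1 j w))].
  have [N0|] := posnP Ni.1; first by exists (fun=> 0); rewrite N0.
  by move=> N0; have [f hf] := exists_response xi_signs g_gauss N0 (hX _ Ni.2 N0); exists f.
have [f hf] := boolp.choice ex.
pose X' N i w := f (N, i) (fun j => coupled xi g N j w).
have conv i : cvg_moments P' (fun N => X' N i) (Y i).
  apply: (chaos_converges xi_signs g_gauss (fun N => hAN N i) (hA i) (ANA i)).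
    by move=> N N0; have [_ _] := hf (N, i) N0.
  exact: (is_L2_sum_approx (measurable_Psi_gauss g) (hY i)).
have mX N i : (0 < N)%N -> borel_rv (X N i) by move=> N0; case: (hX N i N0).
have mf N i : (0 < N)%N -> borel_rv (f (N, i)) by move=> /(hf (N, i))[].
have Xf N : (0 < N)%N -> {ae P, forall w, X N ^~ w = (fun i => f (N, i) (fun j => block_rv xi N j w))}.
  move=> N0; have : {ae P, forall w, forall i, X N i w = f (N, i) (fun j => block_rv xi N j w)}.
    by apply: filter_forall => i; have [_ h _] := hf (N, i) N0.
  by apply: filterS => w h; apply/funext => i; exact: h.
have law (G : ('I_k -> hs_op E) -> R) M : seq_cont G -> (forall x, `|G x| <= M) ->
    (\int[P]_w (G (X N ^~ w))%:E @[N --> \oo] --> \int[P']_w (G (Y ^~ w))%:E)%E.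
  move=> cG GM; apply: cvg_trans (expectation_cvg conv cG GM); apply: near_eq_cvg.
  near=> N; have N0 : (0 < N)%N by near: N; exact: nbhs_infty_gt.
  have mh : measurable_fun setT (fun s : @real_family R J => G (fun i => f (N, i) s)).
    by apply: (seq_cont_measurable_fun (X := fun i => f (N, i))) => // i; exact: mf.
  rewrite -(transfer_expectation N mh); apply/esym; apply: ae_eq_integral => //.
  - by apply/measurable_EFinP; apply: (seq_cont_measurable_fun (X := X N) cG) => i; exact: mX.
  - apply/measurable_EFinP; apply: (seq_cont_measurable_fun (X := fun i w => f (N, i) (fun j => block_rv xi N j w))) => // i.
    by apply: borel_family => //; exact: mf.
  by apply: filterS (Xf N N0) => w h _; rewrite h.
have EE d0 (V : measurableType d0) (Q : probability V R) (Z : V -> R) :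
    ('E_Q[Z] = \int[Q]_v (Z v)%:E)%E by rewrite expectation.unlock.
split.
- move=> F cF [M FM]; rewrite EE; under eq_fun do rewrite EE.
  exact: (law _ M (continuous_seq_cont cF) FM).
- move=> q F cF [M FM]; rewrite EE; under eq_fun do rewrite EE.
  apply: (law (fun x => F (star_poly_eval q x)) M) => [u x ux|x]; last exact: FM.
  have h1 : star_poly_eval q (u n) @[n --> \oo] --> star_poly_eval q x := seq_cont_star_poly ux.
  exact: (cvg_comp _ _ h1 (cF _)).
exists d', W', P', (coupled xi g), X', g, Y; split.
- by [].
- move=> N N0 C mC.
  have mfC : measurable [set s : @real_family R J | C (s, fun i => f (N, i) s)].
    apply: (measurable_joint (s := fun j (s : @real_family R J) => (s : J -> R) j)
      (x := fun i => f (N, i))) mC => [j|i]; [exact: measurable_coord|exact: mf].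
  have := law_transfer (block_indep xi_signs N) (coupled_indep xi g_gauss N)
    (coupled_margin xi g_gauss N) mfC => <-.
  apply: ae_eq_prob.
  + apply: measurable_joint mC => [j|i]; last exact: mX.
    exact: (measurable_funPT (block_rv xi N j)).
  + apply: (measurable_joint (s := fun j => block_rv xi N j)
      (x := fun i w => f (N, i) (fun j => block_rv xi N j w))) mC => // i.
    by apply: borel_family => //; exact: mf.
  by apply: filterS (Xf N N0) => w h /=; rewrite h.
- move=> p i p1; exact: cvg_moments_Lp.
- move=> p q p1; exact: (cvg_moments_Lp p1 (cvg_moments_star_poly q conv)).
Unshelve. all: by end_near. Qed.

End Assembly.

Unset Implicit Arguments.
Set Strict Implicit.
Local Close Scope complex_scope.

Theorem theorem5p7 (R : realType) (J : countType) (E : sepHilbert R)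
    (d : measure_display) (W : measurableType d) (P : probability W R)
    (d' : measure_display) (W' : measurableType d') (P' : probability W' R)
    (xi : J -> nat -> {RV P >-> R}) (g : J -> {RV P' >-> R})
    (k : nat) (A : 'I_k -> array J E) :
  independent_signs xi ->
  independent_std_gaussians g ->
  (forall i, frakA2 (A i)) ->
  responses_converge xi g (fun=> A) A /\
  (forall AN : nat -> 'I_k -> array J E,
    (forall N i, frakA2 (AN N i)) ->
    (forall (i : 'I_k) (rho : R), 1 <= rho ->
      p_norm rho (arrayB (AN N i) (A i)) @[N --> \oo] --> 0%E) ->
    responses_converge xi g AN A).
Proof.
move=> xi_signs g_gauss hA; split; last first.
  by move=> AN hAN ANA; exact: responses_converge_of_arrays.
apply: responses_converge_of_arrays => // i rho rho1.
have -> : p_norm rho (arrayB (A i) (A i)) = 0%E.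
  rewrite /p_norm eseries0// => m _ _; rewrite esum1; first by rewrite sqrte0 mule0.
  by move=> al _; rewrite /arrayB subrr hs_norm0 expr0n.
exact: cvg_cst.
Qed.
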